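(* Let $n=4$ or $n=6$, let $m,k$ be integers with $m\neq0$, and let $J=J_n(m,k)$ be the group $\langle t,y\mid t^n,\ y^{m-k}t^3y^kt^2\rangle$. (a) The metabelian quotient $J/J''$ is finite. (b) The derived group $J'$ is trivial if and only if one of $k$, $m-k$, or $m-2k$ is congruent to zero modulo $nm$, in which case $J\cong\mathbb{Z}_{nm}$. (c) If $m$ and $k$ are relatively prime, then $J$ is metabelian, and hence finite. In this case, if $m-2k\not\equiv0$ mod $n$ then $J'$ is cyclic and $J$ is metacyclic, and if $m-2k\equiv0$ mod $n$ then $J'$ is the direct product of two cyclic groups of equal order and $J$ is not metacyclic. (d) If $m$ and $k$ are not relatively prime and $J'$ is non-trivial, then $J''$ is a finitely generated non-abelian free group, so $J$ is virtually free and non-elementary.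
   Context: For a group $G$, $G'$ is the derived (commutator) subgroup and $G''=(G')'$. $G$ is metabelian if $G''=1$, and metacyclic if it has a cyclic normal subgroup $C$ such that $G/C$ is cyclic. $\mathbb{Z}_{nm}$ denotes the cyclic group of order $|nm|$. A virtually free group is non-elementary if it is not virtually cyclic.
   Formalization: In (c), ''J is not metacyclic'' is stated only when J' is non-trivial; as written it fails for n=4, m=2, k=1, where m-2k=0 and J is cyclic of order 8. Whenever J' is trivial, J is cyclic by (b). *)

(* Defs.v *)
(* Groups are [groupType]s, possibly infinite, and their subgroups are
   [groupClosed] predicates (made decidable by classical logic). *)
From HB Require Import structures.
From mathcomp Require Import all_boot all_algebra.
From mathcomp Require Import boolp classical_sets cardinality.

Set Implicit Arguments.
Unset Strict Implicit.
Unset Printing Implicit Defensive.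

Local Open Scope classical_set_scope.
Local Open Scope quotient_scope.
Local Open Scope group_scope.

HB.mixin Record isNormalClosed (G : groupType) (S : {pred G}) := {
  gpredNJ : forall x g, x \in S -> x ^ g \in S
}.

#[short(type="normalClosed")]
HB.structure Definition NormalClosed (G : groupType) :=
  {S of GroupClosed G S & isNormalClosed G S}.

Section FullSubgroup.
Variable G : groupType.

Definition full_subgroup : {pred G} := predT.

Fact full_subgroupV : invg_closed full_subgroup. Proof. by []. Qed.
Fact full_subgroup1 : 1 \in full_subgroup. Proof. by []. Qed.
Fact full_subgroupM : mulg_closed full_subgroup. Proof. by []. Qed.
Fact full_subgroupJ x g : x \in full_subgroup -> x ^ g \in full_subgroup.
Proof. by []. Qed.

HB.instance Definition _ := isInvClosed.Build G full_subgroup full_subgroupV.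
HB.instance Definition _ := isMulClosed.Build G full_subgroup full_subgroupM.
HB.instance Definition _ := isMul1Closed.Build G full_subgroup full_subgroup1.
HB.instance Definition _ := isNormalClosed.Build G full_subgroup full_subgroupJ.
End FullSubgroup.

Section Generated.
Variables (G : groupType) (A : {pred G}).

Definition generated : {pred G} :=
  fun x => `[< forall S : groupClosed G, {subset A <= S} -> x \in S >].

Lemma generatedP x :
  reflect (forall S : groupClosed G, {subset A <= S} -> x \in S)
          (x \in generated).
Proof. exact: asboolP. Qed.

Fact generatedV : invg_closed generated.
Proof.
by move=> x /generatedP xA; apply/generatedP => S AS; rewrite gpredV xA.
Qed.
Fact generated1 : 1 \in generated.
Proof. by apply/generatedP => S _; exact: gpred1. Qed.
Fact generatedM : mulg_closed generated.
Proof.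
move=> x y /generatedP xA /generatedP yA; apply/generatedP => S AS.
by rewrite gpredM ?xA ?yA.
Qed.

HB.instance Definition _ := isInvClosed.Build G generated generatedV.
HB.instance Definition _ := isMulClosed.Build G generated generatedM.
HB.instance Definition _ := isMul1Closed.Build G generated generated1.

Definition normal_closure : {pred G} :=
  fun x => `[< forall S : normalClosed G, {subset A <= S} -> x \in S >].

Lemma normal_closureP x :
  reflect (forall S : normalClosed G, {subset A <= S} -> x \in S)
          (x \in normal_closure).
Proof. exact: asboolP. Qed.

Fact normal_closureV : invg_closed normal_closure.
Proof.
by move=> x /normal_closureP xA; apply/normal_closureP => S AS; rewrite gpredV xA.
Qed.
Fact normal_closure1 : 1 \in normal_closure.
Proof. by apply/normal_closureP => S _; exact: gpred1. Qed.
Fact normal_closureM : mulg_closed normal_closure.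
Proof.
move=> x y /normal_closureP xA /normal_closureP yA.
by apply/normal_closureP => S AS; rewrite gpredM ?xA ?yA.
Qed.
Fact normal_closureJ x g : x \in normal_closure -> x ^ g \in normal_closure.
Proof.
move=> /normal_closureP xA; apply/normal_closureP => S AS.
exact/gpredNJ/xA.
Qed.

HB.instance Definition _ := isInvClosed.Build G normal_closure normal_closureV.
HB.instance Definition _ := isMulClosed.Build G normal_closure normal_closureM.
HB.instance Definition _ := isMul1Closed.Build G normal_closure normal_closure1.
HB.instance Definition _ :=
  isNormalClosed.Build G normal_closure normal_closureJ.
End Generated.

Section PreimConj.
Variables (G : groupType) (S : groupClosed G) (g : G).

Definition preim_conj : {pred G} := fun x => x ^ g \in S.

Lemma in_preim_conj x : (x \in preim_conj) = (x ^ g \in S).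
Proof. by []. Qed.

Fact preim_conjV : invg_closed preim_conj.
Proof. by move=> x; rewrite !in_preim_conj conjVg gpredV. Qed.
Fact preim_conj1 : 1 \in preim_conj.
Proof. by rewrite in_preim_conj conj1g gpred1. Qed.
Fact preim_conjM : mulg_closed preim_conj.
Proof. by move=> x y; rewrite !in_preim_conj conjMg => xS yS; rewrite gpredM. Qed.

HB.instance Definition _ := isInvClosed.Build G preim_conj preim_conjV.
HB.instance Definition _ := isMulClosed.Build G preim_conj preim_conjM.
HB.instance Definition _ := isMul1Closed.Build G preim_conj preim_conj1.
End PreimConj.

Section Derived.
Variables (G : groupType) (N : normalClosed G).

Definition commutators (H : {pred G}) : {pred G} :=
  fun c => `[< exists x y, [/\ x \in H, y \in H & c = [~ x, y]] >].

Definition derived : {pred G} := generated (commutators N).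

HB.instance Definition _ := GroupClosed.copy derived (generated (commutators N)).

Fact derivedJ x g : x \in derived -> x ^ g \in derived.
Proof.
move=> /generatedP /(_ (preim_conj derived g)); apply.
move=> _ /asboolP[u [v [uN vN ->]]]; rewrite in_preim_conj.
apply/generatedP => S; apply; apply/asboolP; exists (u ^ g), (v ^ g).
by rewrite conjRg !gpredNJ.
Qed.
HB.instance Definition _ := isNormalClosed.Build G derived derivedJ.
End Derived.

(* The derived series of G: [der G 1] is G' and [der G 2] is G''. *)
Fixpoint der (G : groupType) (i : nat) : normalClosed G :=
  if i is j.+1 then derived (der G j) else @full_subgroup G.

Definition subgroup (G : groupType) (H : groupClosed G) : Type :=
  {x : G | x \in H}.

Section SubgroupGroup.
Variables (G : groupType) (H : groupClosed G).
HB.instance Definition _ := SubChoice.on (subgroup H).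
Fact subgroup_closed : group_closed [pred x | x \in H].
Proof. split; [exact: gpred1 | exact: gpredF]. Qed.
HB.instance Definition _ :=
  SubChoice_isSubGroup.Build G _ (subgroup H) subgroup_closed.
End SubgroupGroup.

Section Quotient.
Variables (G : groupType) (N : normalClosed G).

Definition coset_eq (x y : G) : bool := x^-1 * y \in N.

Fact coset_eq_equiv : equiv_class_of coset_eq.
Proof.
split=> [x|x y|y x z]; rewrite /coset_eq ?mulVg ?gpred1 //.
  by rewrite -gpredV invgM invgK.
move=> xyN yzN; have -> : x^-1 * z = x^-1 * y * (y^-1 * z).
  by rewrite mulgA mulgK.
exact: gpredM.
Qed.
Canonical coset_eq_rel := EquivRelPack coset_eq_equiv.

Definition quotient : Type := {eq_quot coset_eq}.
HB.instance Definition _ := Choice.on quotient.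
HB.instance Definition _ := EqQuotient.on quotient.

Definition quot_proj (x : G) : quotient := \pi_quotient x.

Lemma quot_projP x y : reflect (quot_proj x = quot_proj y) (x^-1 * y \in N).
Proof.
have -> : x^-1 * y \in N = (quot_proj x == quot_proj y).
  by rewrite /quot_proj [RHS](@eqmodE _ coset_eq_rel).
exact: eqP.
Qed.

Definition quot_mul (a b : quotient) : quotient := quot_proj (repr a * repr b).
Definition quot_inv (a : quotient) : quotient := quot_proj (repr a)^-1.

Lemma quot_reprK a : quot_proj (repr a) = a. Proof. exact: reprK. Qed.

Lemma quot_projM x y : quot_proj (x * y) = quot_mul (quot_proj x) (quot_proj y).
Proof.
apply/quot_projP; set x' := repr _; set y' := repr _.
have xx' : x^-1 * x' \in N by apply/quot_projP; rewrite quot_reprK.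
have yy' : y^-1 * y' \in N by apply/quot_projP; rewrite quot_reprK.
have -> : (x * y)^-1 * (x' * y') = (x^-1 * x') ^ y * (y^-1 * y').
  by rewrite /conjg invgM !mulgA mulgK.
by rewrite gpredM ?gpredNJ.
Qed.

Lemma quot_projV x : quot_proj x^-1 = quot_inv (quot_proj x).
Proof.
apply/quot_projP; set x' := repr _.
have x'x : x'^-1 * x \in N by apply/quot_projP; rewrite quot_reprK.
have -> : (x^-1)^-1 * x'^-1 = (x'^-1 * x) ^ x^-1.
  by rewrite /conjg invgK mulgK.
exact: gpredNJ.
Qed.

Fact quot_mulA : associative quot_mul.
Proof.
move=> a b c; rewrite -(quot_reprK a) -(quot_reprK b) -(quot_reprK c).
by rewrite -!quot_projM mulgA.
Qed.
Fact quot_mul1 : left_id (quot_proj 1) quot_mul.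
Proof. by move=> a; rewrite -(quot_reprK a) -quot_projM mul1g. Qed.
Fact quot_mulr1 : right_id (quot_proj 1) quot_mul.
Proof. by move=> a; rewrite -(quot_reprK a) -quot_projM mulg1. Qed.
Fact quot_mulV : left_inverse (quot_proj 1) quot_inv quot_mul.
Proof. by move=> a; rewrite -(quot_reprK a) -quot_projV -quot_projM mulVg. Qed.
Fact quot_mulrV : right_inverse (quot_proj 1) quot_inv quot_mul.
Proof. by move=> a; rewrite -(quot_reprK a) -quot_projV -quot_projM mulgV. Qed.

HB.instance Definition _ := isGroup.Build quotient
  quot_mulA quot_mul1 quot_mulr1 quot_mulV quot_mulrV.
HB.instance Definition _ := isMultiplicative.Build G quotient quot_proj quot_projM.
End Quotient.

(* The free group on X: words in the letters (x, true) = x and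
   (x, false) = x^-1, modulo insertion and deletion of x x^-1 and x^-1 x. *)
Section FreeGroup.
Variable X : choiceType.
Implicit Types u v w : seq (X * bool).

Inductive free_equiv : seq (X * bool) -> seq (X * bool) -> Prop :=
  | FreeCancel u v x b : free_equiv (u ++ (x, b) :: (x, ~~ b) :: v) (u ++ v)
  | FreeRefl u : free_equiv u u
  | FreeSym u v : free_equiv u v -> free_equiv v u
  | FreeTrans u v w : free_equiv u v -> free_equiv v w -> free_equiv u w.

Definition free_eq u v : bool := `[< free_equiv u v >].

Fact free_eq_equiv : equiv_class_of free_eq.
Proof.
split=> [u|u v|v u w]; first exact/asboolP/FreeRefl.
  by apply/asboolP/asboolP; exact: FreeSym.
by move=> /asboolP uv /asboolP vw; apply/asboolP/(FreeTrans uv vw).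
Qed.
Canonical free_eq_rel := EquivRelPack free_eq_equiv.

Definition free_group : Type := {eq_quot free_eq}.
HB.instance Definition _ := Choice.on free_group.
HB.instance Definition _ := EqQuotient.on free_group.

Definition free_word u : free_group := \pi_free_group u.

Lemma free_wordP u v : free_word u = free_word v <-> free_equiv u v.
Proof.
have E : (free_word u == free_word v) = free_eq u v.
  by rewrite /free_word [LHS](@eqmodE _ free_eq_rel).
by split=> [/eqP|uv]; [|apply/eqP]; rewrite E; [move/asboolP|apply/asboolP].
Qed.

Lemma free_equiv_cat2 w w' u v :
  free_equiv u v -> free_equiv (w ++ u ++ w') (w ++ v ++ w').
Proof.
elim=> {u v} [u v x b|u|u v _|u v z _ uv _ vz].
- by have := FreeCancel (w ++ u) (v ++ w') x b; rewrite -!catA /=.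
- exact: FreeRefl.
- exact: FreeSym.
- exact: FreeTrans uv vz.
Qed.

Definition word_inv u := rev [seq (p.1, ~~ p.2) | p <- u].

Lemma word_invK : involutive word_inv.
Proof.
move=> u; rewrite /word_inv map_rev revK -map_comp -[RHS]map_id.
by apply: eq_map => -[x b] /=; rewrite negbK.
Qed.

Lemma word_mulV u : free_equiv (u ++ word_inv u) [::].
Proof.
elim: u => [|[x b] u IHu]; first exact: FreeRefl.
rewrite /word_inv /= rev_cons -cats1 -/(word_inv u) catA.
apply: (@FreeTrans _ ([:: (x, b)] ++ [::] ++ [:: (x, ~~ b)])).
  by rewrite -[(x, b) :: _]/([:: (x, b)] ++ _); exact: free_equiv_cat2.
exact: (FreeCancel [::] [::]).
Qed.

Lemma word_inv_equiv u v : free_equiv u v -> free_equiv (word_inv u) (word_inv v).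
Proof.
elim=> {u v} [u v x b|u|u v _|u v z _ uv _ vz].
- rewrite /word_inv !map_cat !rev_cat /= !rev_cons -!cats1 -!catA /= negbK.
  exact: FreeCancel.
- exact: FreeRefl.
- exact: FreeSym.
- exact: FreeTrans uv vz.
Qed.

Definition free_mul (a b : free_group) : free_group :=
  free_word (repr a ++ repr b).
Definition free_inv (a : free_group) : free_group :=
  free_word (word_inv (repr a)).
Definition free_one : free_group := free_word [::].

Lemma free_reprK a : free_word (repr a) = a. Proof. exact: reprK. Qed.

Lemma free_wordM u v : free_word (u ++ v) = free_mul (free_word u) (free_word v).
Proof.
apply/free_wordP; set u' := repr _; set v' := repr _.
have uu' : free_equiv u u' by apply/free_wordP; rewrite free_reprK.
have vv' : free_equiv v v' by apply/free_wordP; rewrite free_reprK.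
apply: (@FreeTrans _ (u' ++ v)); first exact: (free_equiv_cat2 [::] v uu').
by have := free_equiv_cat2 u' [::] vv'; rewrite !cats0.
Qed.

Lemma free_wordV u : free_word (word_inv u) = free_inv (free_word u).
Proof.
apply/free_wordP/word_inv_equiv.
by apply/free_wordP; rewrite free_reprK.
Qed.

Fact free_mulA : associative free_mul.
Proof.
move=> a b c; rewrite -(free_reprK a) -(free_reprK b) -(free_reprK c).
by rewrite -!free_wordM catA.
Qed.
Fact free_mul1 : left_id free_one free_mul.
Proof. by move=> a; rewrite -(free_reprK a) -free_wordM. Qed.
Fact free_mulr1 : right_id free_one free_mul.
Proof. by move=> a; rewrite -(free_reprK a) -free_wordM cats0. Qed.
Fact free_mulrV : right_inverse free_one free_inv free_mul.
Proof.
move=> a; rewrite -(free_reprK a) -free_wordV -free_wordM.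
exact/free_wordP/word_mulV.
Qed.
Fact free_mulV : left_inverse free_one free_inv free_mul.
Proof.
move=> a; rewrite -(free_reprK a) -free_wordV -free_wordM.
by apply/free_wordP; rewrite -{2}(word_invK (repr a)); exact: word_mulV.
Qed.

HB.instance Definition _ := isGroup.Build free_group
  free_mulA free_mul1 free_mulr1 free_mulV free_mulrV.

Definition free_gen (x : X) : free_group := free_word [:: (x, true)].
End FreeGroup.

Definition presented (X : choiceType) (rels : seq (free_group X)) : groupType :=
  quotient (normal_closure (mem rels)).

Definition zexp (G : groupType) (x : G) (z : int) : G :=
  match z with Posz i => x ^+ i | Negz i => x ^- i.+1 end.

(* J_n(m,k) = < t, y | t^n, y^(m-k) t^3 y^k t^2 >, with t, y indexed by bool. *)
Definition Jgroup (n : nat) (m k : int) : groupType :=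
  let t := free_gen true in
  let y := free_gen false in
  presented [:: t ^+ n; zexp y (m - k)%R * t ^+ 3 * zexp y k * t ^+ 2].

Definition isomorphic (G H : groupType) : Prop :=
  exists f : {multiplicative G -> H}, bijective f.

Definition trivial_group (G : groupType) : Prop := forall x : G, x = 1.

Definition abelian_group (G : groupType) : Prop := forall x y : G, commute x y.

Definition cyclic_group (G : groupType) : Prop :=
  exists g : G, forall x : G, exists z : int, x = zexp g z.

Definition finite_group (G : groupType) : Prop := finite_set [set: G].

Definition metabelian (G : groupType) : Prop := trivial_group (subgroup (der G 2)).

Definition metacyclic (G : groupType) : Prop :=
  exists C : normalClosed G,
    cyclic_group (subgroup C) /\ cyclic_group (quotient C).

Definition finitely_generated (G : groupType) : Prop :=
  exists s : seq G, forall x : G, x \in generated (mem s).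

Definition is_free (G : groupType) : Prop :=
  exists X : choiceType, isomorphic G (free_group X).

Definition left_coset (G : groupType) (H : groupClosed G) (g : G) : set G :=
  [set g * h | h in [set h | h \in H]].

Definition finite_index (G : groupType) (H : groupClosed G) : Prop :=
  finite_set (range (left_coset H)).

Definition virtually (P : groupType -> Prop) (G : groupType) : Prop :=
  exists H : groupClosed G, finite_index H /\ P (subgroup H).

(* Direct product of two cyclic groups of equal order. *)
Definition square_of_cyclic (G : groupType) : Prop :=
  exists C D : groupType,
    [/\ cyclic_group C, cyclic_group D, ([set: C] #= [set: D])%card
      & isomorphic G (C * D)%type].

(* Main.v *)
(* The relator says that c = y^m equals a word in t and its conjugate by y^k, and
   c commutes with y^k. From this alone c^n = 1, and t and r = c^{-1} (n = 4) or
   r = c (n = 6) satisfy the relations of rotations by the same angle in the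
   Euclidean triangle group (2,4,4) or (2,3,6). The translation tau = t r^-1 and
   its conjugates therefore generate modules over Z[e], e = i or a primitive 6th
   root of 1, r acting as e; conjugation by y^k acts as (1 + e), resp.
   (1 + e) / 2e.

   Let m and k be coprime. As y^m acts as a unit of Z[e] and y^k as above, the
   module is annihilated by alpha = (1 + e)^|m| - (unit), resp.
   (1 + e)^|m| - (2e)^|m| (unit), and an explicit action on Z[e] / alpha by affine
   maps shows that J' = Z[e] / alpha. If m - 2k is divisible by n, then alpha is
   a unit times an integer; otherwise no rational prime divides alpha and
   Z[e] / alpha is cyclic. The norm of alpha decides when J' is trivial.

   In general, let d = gcd(m,k). Adjoining a d-th root of y to J_n(m/d,k/d) gives
   J_n(m,k), an amalgamated product over <y^d>. Hence J' is the free product of d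
   copies of the finite abelian group A = J_n(m/d,k/d)', and J'' is the kernel of
   the map of this free product onto A^d, which is free. *)

Require Import Defs.
From HB Require Import structures.
From mathcomp Require Import all_boot all_algebra.
From mathcomp Require Import boolp classical_sets cardinality.
From mathcomp Require Import zify ring.

Set Implicit Arguments.
Unset Strict Implicit.
Unset Printing Implicit Defensive.

Import GRing.Theory Num.Theory.
Local Open Scope group_scope.

(** It becomes available once alpha is known to annihilate the translations: [gam] and [del] are
    comaximal, hence both are units modulo alpha, and every power of y then acts by a ring element.
    Only after this do translations times powers of y exhaust J. The affine model runs the argument
    backwards: the maps for y^m and y^k are prescribed, and y is recovered from them by Bezout. The
    arithmetic is tractable because (1 + e)^2 is 2e or 3e: up to units, powers of 1 + e are integers
    or integers times 1 + e, so only the parity of m and an exponent modulo n matter. For J'',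
    freeness comes from an explicit left inverse: letting an element act while recording its path,
    then contracting a spanning tree, reads off its expression in the basis. *)

Section Zexp.
Variable G : groupType.
Implicit Types (x y g : G) (a b : int).

Lemma zexp0 x : zexp x 0 = 1. Proof. by []. Qed.
Lemma zexp1 x : zexp x 1 = x. Proof. by []. Qed.
Lemma zexp_nat x (i : nat) : zexp x i%:Z = x ^+ i. Proof. by []. Qed.

Lemma zexpN x a : zexp x (- a) = (zexp x a)^-1.
Proof.
case: a => [[|i]|i] /=; rewrite ?invg1 // ?NegzE ?opprK /= ?invgK //.
Qed.

Lemma zexpS x a : zexp x (a + 1) = zexp x a * x.
Proof.
case: a => [i|i] /=; first by rewrite addn1 expgSr.
rewrite NegzE; have -> : (- i.+1%:Z + 1 = - i%:Z)%R by lia.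
by rewrite zexpN zexp_nat expgS invgM mulgVK.
Qed.

Lemma zexpD x a b : zexp x (a + b) = zexp x a * zexp x b.
Proof.
elim/int_rec: b => [|b IH|b IH]; first by rewrite addr0 mulg1.
  by rewrite -addn1 PoszD addrA !zexpS IH mulgA.
have := zexpS x (a - b.+1%:Z); have := zexpS x (- b.+1%:Z).
have -> : (a - b.+1%:Z + 1 = a - b%:Z)%R by lia.
have -> : (- b.+1%:Z + 1 = - b%:Z)%R by lia.
rewrite IH => -> /(congr1 (fun z => z * x^-1)).
by rewrite mulgK mulgA mulgK.
Qed.

Lemma zexp_commute x y a b : commute x y -> commute (zexp x a) (zexp y b).
Proof.
have cN u v z : commute u v -> commute u (zexp v z).
  by case: z => i cuv; [exact: commuteX|exact/commuteV/commuteX].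
by move=> cxy; apply/cN/commute_sym/cN/commute_sym.
Qed.

Lemma zexpMn x y a : commute x y -> zexp (x * y) a = zexp x a * zexp y a.
Proof.
move=> cxy; case: a => i /=; first exact: expgMn.
by rewrite (expgMn _ cxy) invgM; apply/commute_sym/(zexp_commute (Negz i) (Negz i)).
Qed.

Lemma zexpVg x a : zexp x^-1 a = (zexp x a)^-1.
Proof. by case: a => i /=; rewrite expVgn. Qed.

Lemma zexpM x a b : zexp x (a * b) = zexp (zexp x a) b.
Proof.
have natM (c : nat) : zexp x (a * c%:Z) = zexp (zexp x a) c%:Z.
  elim: c => [|c IH]; first by rewrite mulr0.
  by rewrite -addn1 PoszD mulrDr mulr1 (zexpD x (a * c%:Z) a) IH zexpS.
by case: b => j; rewrite ?NegzE ?mulrN ?zexpN natM.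
Qed.

Lemma zexpJ x g a : zexp x a ^ g = zexp (x ^ g) a.
Proof. by case: a => i /=; rewrite ?conjVg conjXg. Qed.

Lemma zexp1g a : zexp (1 : G) a = 1.
Proof. by case: a => i /=; rewrite expg1n ?invg1. Qed.

Lemma gpred_zexp (S : groupClosed G) x a : x \in S -> zexp x a \in S.
Proof. by case: a => i xS /=; rewrite ?gpredV gpredXn. Qed.

Lemma zexp_modz x a b : zexp x b = 1 -> zexp x a = zexp x (a %% b)%Z.
Proof.
move=> xb; rewrite {1}(divz_eq a b) zexpD mulrC zexpM xb.
by rewrite zexp1g mul1g.
Qed.

Lemma zexp_mod x a (N : nat) : x ^+ N = 1 -> zexp x a = zexp x (a %% N%:Z)%Z.
Proof. exact: (@zexp_modz x a N%:Z). Qed.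

(** Produces a single element with prescribed m-th and k-th powers; this is how y is built in the
    affine model. *)
Lemma zexp_bezout x w (m k u v : int) : commute x w -> zexp w m = zexp x k ->
  (u * m + v * k = 1)%R ->
  zexp (zexp x u * zexp w v) m = x /\ zexp (zexp x u * zexp w v) k = w.
Proof.
move=> cxw wm uv; have cuv : commute (zexp x u) (zexp w v) by exact: zexp_commute.
split; rewrite zexpMn // -!zexpM.
  by rewrite (mulrC v m) (zexpM w m v) wm -zexpM -zexpD (mulrC k v) uv.
by rewrite (mulrC u k) (zexpM x k u) -wm -zexpM -zexpD (mulrC m u) uv.
Qed.
End Zexp.

(* [gmulf1] and its consequences require a [UMagmaMorphism]; between groups a
   [{multiplicative _ -> _}] is one. *)
Section GroupMorphism.
Variables (G H : groupType) (f : {multiplicative G -> H}).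
Implicit Types x y : G.

Lemma hom1 : f 1 = 1.
Proof. by apply: (mulgI (f 1)); rewrite -gmulfM !mulg1. Qed.

Let fU : UMagmaMorphism.type G H :=
  HB.pack (f : G -> H) f (Multiplicative_isUMagmaMorphism.Build G H f hom1).

Lemma homM x y : f (x * y) = f x * f y. Proof. exact: gmulfM. Qed.
Lemma homV x : f x^-1 = (f x)^-1. Proof. exact: (gmulfV fU). Qed.
Lemma homF x y : f (x / y) = f x / f y. Proof. exact: (gmulfF fU). Qed.
Lemma homX n x : f (x ^+ n) = f x ^+ n. Proof. exact: (gmulfXn fU). Qed.
Lemma homJ x y : f (x ^ y) = f x ^ f y. Proof. exact: (gmulfJ fU). Qed.
Lemma homR x y : f [~ x, y] = [~ f x, f y]. Proof. exact: (gmulfR fU). Qed.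
Lemma hom_inj : (forall x, f x = 1 -> x = 1) -> injective f.
Proof. exact: (gmulf_inj (f := fU)). Qed.
Lemma hom_zexp x a : f (zexp x a) = zexp (f x) a.
Proof. by case: a => i /=; rewrite ?homV homX. Qed.
End GroupMorphism.

(** * Subgroups given by predicates *)

Section PredSubgroup.
Variables (G : groupType) (P : G -> Prop).

Definition pred_subgroup (P1 : P 1) (PF : forall x y, P x -> P y -> P (x / y)) :
  {pred G} := fun x => `[< P x >].

Variables (P1 : P 1) (PF : forall x y, P x -> P y -> P (x / y)).
Local Notation S := (pred_subgroup P1 PF).

Lemma pred_subgroupP x : reflect (P x) (x \in S).
Proof. exact: asboolP. Qed.

Let PV x : P x -> P x^-1. Proof. by move/(PF P1); rewrite mul1g. Qed.

Fact pred_subgroup1 : 1 \in S. Proof. exact/pred_subgroupP. Qed.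
Fact pred_subgroupV : invg_closed S.
Proof. by move=> x /pred_subgroupP xP; apply/pred_subgroupP/PV. Qed.
Fact pred_subgroupM : mulg_closed S.
Proof.
move=> x y /pred_subgroupP xP /pred_subgroupP /PV /(PF xP).
by rewrite invgK => xyP; apply/pred_subgroupP.
Qed.
HB.instance Definition _ := isInvClosed.Build G S pred_subgroupV.
HB.instance Definition _ := isMulClosed.Build G S pred_subgroupM.
HB.instance Definition _ := isMul1Closed.Build G S pred_subgroup1.

Hypothesis PJ : forall x g, P x -> P (x ^ g).
(** The proof of invariance under conjugation is an argument, so that the normal structure can be
    attached to this name. *)
Definition pred_normal of (forall x g, P x -> P (x ^ g)) := S.
HB.instance Definition _ := GroupClosed.copy (pred_normal PJ) S.
Fact pred_normalJ x g : x \in pred_normal PJ -> x ^ g \in pred_normal PJ.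
Proof. by move=> /asboolP xP; apply/asboolP/PJ. Qed.
HB.instance Definition _ := isNormalClosed.Build G (pred_normal PJ) pred_normalJ.

Lemma pred_normalP x : reflect (P x) (x \in pred_normal PJ).
Proof. exact: asboolP. Qed.
End PredSubgroup.

Lemma generated_ind (G : groupType) (A : {pred G}) (P : G -> Prop) :
  P 1 -> (forall x y, P x -> P y -> P (x / y)) -> (forall x, x \in A -> P x) ->
  forall x, x \in generated A -> P x.
Proof.
move=> P1 PF PA x /generatedP /(_ (pred_subgroup P1 PF)) xS.
by apply/(pred_subgroupP P1 PF)/xS => z /PA Pz; apply/pred_subgroupP.
Qed.

Lemma generated_sub (G : groupType) (A : {pred G}) x : x \in A -> x \in generated A.
Proof. by move=> xA; apply/generatedP => S; apply. Qed.

(** * Derived subgroups *)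

Section Der.
Variable G : groupType.

Lemma mem_derived (N : normalClosed G) x y :
  x \in N -> y \in N -> [~ x, y] \in derived N.
Proof. by move=> xN yN; apply/generated_sub/asboolP; exists x, y. Qed.

Lemma derived_sub (N : normalClosed G) (S : groupClosed G) :
  {in N &, forall x y, [~ x, y] \in S} -> {subset derived N <= S}.
Proof.
move=> cS; apply: generated_ind => [|x y|z /asboolP[x [y [xN yN ->]]]].
- exact: gpred1.
- exact: gpredF.
- exact: cS.
Qed.

Lemma derived_sub_self (N : normalClosed G) : {subset derived N <= N}.
Proof. by apply: derived_sub => x y xN yN; exact: gpredR. Qed.
End Der.

Lemma hom_der (G H : groupType) (f : {multiplicative G -> H}) i x :
  x \in der G i -> f x \in der H i.
Proof.
elim: i x => [//|i IH]; apply: generated_ind => [|x y fx fy|z].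
- by rewrite hom1 gpred1.
- by rewrite homF gpredF.
- by case/asboolP=> x [y [xN yN ->]]; rewrite homR mem_derived ?IH.
Qed.

(** * Universal properties *)

Section FreeLift.
Variables (X : choiceType) (G : groupType) (f : X -> G).

Definition free_eval (u : seq (X * bool)) : G :=
  \prod_(p <- u) (if p.2 then f p.1 else (f p.1)^-1).

Lemma free_eval_equiv u v : free_equiv u v -> free_eval u = free_eval v.
Proof.
elim=> {u v} [u v x b|//|//|u v w _ -> _ -> //].
rewrite /free_eval !big_cat !big_cons /=.
by case: b; rewrite /= ?mulKg ?mulVKg.
Qed.

Definition free_lift (a : free_group X) : G := free_eval (repr a).

Lemma free_lift_word u : free_lift (free_word u) = free_eval u.
Proof. by apply: free_eval_equiv; apply/free_wordP; rewrite free_reprK. Qed.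

Fact free_liftM : {morph free_lift : a b / a * b}.
Proof.
move=> a b; rewrite -(free_reprK a) -(free_reprK b) -[_ * _]free_wordM.
by rewrite !free_lift_word /free_eval big_cat.
Qed.
HB.instance Definition _ := isMultiplicative.Build _ _ free_lift free_liftM.

Lemma free_lift_gen x : free_lift (free_gen x) = f x.
Proof. by rewrite free_lift_word /free_eval big_seq1. Qed.
End FreeLift.

Lemma free_group_ind (X : choiceType) (P : free_group X -> Prop) :
  P 1 -> (forall a x, P a -> P (a * free_gen x)) ->
  (forall a x, P a -> P (a * (free_gen x)^-1)) -> forall a, P a.
Proof.
move=> P1 Pg PV a; rewrite -(free_reprK a).
elim/last_ind: (repr a) => [//|u [x b] IH]; rewrite -cats1 free_wordM.
case: b; first exact: Pg.
have -> : free_word [:: (x, false)] = (free_gen x)^-1.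
  by rewrite -[(free_gen x)^-1]free_wordV.
exact: PV.
Qed.

Lemma eq_free_morph (X : choiceType) (G : groupType)
    (f g : {multiplicative free_group X -> G}) :
  (forall x, f (free_gen x) = g (free_gen x)) -> f =1 g.
Proof.
move=> fg; elim/free_group_ind => [|a x IH|a x IH]; first by rewrite !hom1.
  by rewrite !homM IH fg.
by rewrite !homM !homV IH fg.
Qed.

Section QuotLift.
Variables (G H : groupType) (N : normalClosed G) (f : {multiplicative G -> H}).

Definition quot_lift of (forall x, x \in N -> f x = 1) : quotient N -> H :=
  fun a => f (repr a).

Hypothesis fN : forall x, x \in N -> f x = 1.

Lemma quot_liftE x : quot_lift fN (quot_proj N x) = f x.
Proof.
rewrite /quot_lift; apply: invg_inj; apply: (mulIg (f x)); rewrite mulVg.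
rewrite -homV -homM; apply: fN.
by apply/quot_projP; rewrite quot_reprK.
Qed.

Fact quot_liftM : {morph quot_lift fN : a b / a * b}.
Proof.
move=> a b; rewrite -(quot_reprK a) -(quot_reprK b) -homM !quot_liftE.
exact: homM.
Qed.
HB.instance Definition _ := isMultiplicative.Build _ _ (quot_lift fN) quot_liftM.
End QuotLift.

Lemma quot_proj_eq1 (G : groupType) (N : normalClosed G) x :
  (quot_proj N x = 1) <-> (x \in N).
Proof.
split=> [|xN]; last by apply/esym/quot_projP; rewrite invg1 mul1g.
by move/esym/quot_projP; rewrite invg1 mul1g.
Qed.

Section Presented.
Variables (X : choiceType) (rels : seq (free_group X)).
Local Notation P := (presented rels).

Definition pgen (x : X) : P := quot_proj _ (free_gen x).

Lemma presented_rel r : r \in rels -> quot_proj (normal_closure (mem rels)) r = 1.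
Proof. by move=> rr; apply/quot_proj_eq1/normal_closureP => S; apply. Qed.

Lemma presented_lift (G : groupType) (f : X -> G) :
  (forall r, r \in rels -> free_lift f r = 1) ->
  exists F : {multiplicative P -> G}, forall x, F (pgen x) = f x.
Proof.
move=> fr.
have F1 : free_lift f 1 = 1 by rewrite hom1.
have FF x y : free_lift f x = 1 -> free_lift f y = 1 -> free_lift f (x / y) = 1.
  by move=> fx fy; rewrite homF /= fx fy divgg.
have FJ x g : free_lift f x = 1 -> free_lift f (x ^ g) = 1.
  by move=> fx; rewrite homJ /= fx conj1g.
have fN x : x \in normal_closure (mem rels) -> free_lift f x = 1.
  move=> /normal_closureP /(_ (pred_normal F1 FF FJ)) xS.
  by apply/(pred_normalP F1 FF FJ)/xS => z /fr fz; apply/pred_normalP.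
exists (quot_lift fN : {multiplicative _ -> _}) => x.
exact: (etrans (quot_liftE _ _) (free_lift_gen f x)).
Qed.

Lemma presented_ind (Q : P -> Prop) :
  Q 1 -> (forall a x, Q a -> Q (a * pgen x)) ->
  (forall a x, Q a -> Q (a * (pgen x)^-1)) -> forall a, Q a.
Proof.
move=> Q1 Qg QV a; rewrite -(quot_reprK a).
elim/free_group_ind: (repr a) => [|b x|b x].
- by rewrite hom1.
- by rewrite homM; exact: Qg.
- by rewrite homM homV; exact: QV.
Qed.
End Presented.

(** * Groups of bijections *)

(** The inverse is stored, so group inversion swaps fields; being determined by the function, it
    does not affect equality. *)
Record bij_of (T : Type) := BijOf {
  bij_fun : T -> T; bij_inv : T -> T;
  bij_funK : cancel bij_fun bij_inv; bij_invK : cancel bij_inv bij_fun }.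

HB.instance Definition _ T := gen_eqMixin (bij_of T).
HB.instance Definition _ T := gen_choiceMixin (bij_of T).

Section BijGroup.
Variable T : Type.
Implicit Types f g h : bij_of T.

Lemma eq_bij f g : bij_fun f =1 bij_fun g -> f = g.
Proof.
case: f g => [f f' fK f'K] [g g' gK g'K] /= /funext fg; subst g.
have /funext E : f' =1 g' by move=> x; rewrite -{1}(g'K x) fK.
by subst g'; congr BijOf; exact: Prop_irrelevance.
Qed.

(* Bijections act on the right: [f * g] is [f] followed by [g]. *)
Definition bij_mul f g : bij_of T :=
  BijOf (can_comp (bij_funK g) (bij_funK f)) (can_comp (bij_invK f) (bij_invK g)).
Definition bij_one : bij_of T := @BijOf T id id (fun=> erefl) (fun=> erefl).
Definition bij_V f : bij_of T := BijOf (bij_invK f) (bij_funK f).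

Fact bij_mulA : associative bij_mul. Proof. by move=> f g h; exact: eq_bij. Qed.
Fact bij_mul1 : left_id bij_one bij_mul. Proof. by move=> f; exact: eq_bij. Qed.
Fact bij_mulr1 : right_id bij_one bij_mul. Proof. by move=> f; exact: eq_bij. Qed.
Fact bij_mulV : left_inverse bij_one bij_V bij_mul.
Proof. by move=> f; apply: eq_bij => x; exact: bij_invK. Qed.
Fact bij_mulrV : right_inverse bij_one bij_V bij_mul.
Proof. by move=> f; apply: eq_bij => x; exact: bij_funK. Qed.

HB.instance Definition _ := isGroup.Build (bij_of T)
  bij_mulA bij_mul1 bij_mulr1 bij_mulV bij_mulrV.

Lemma bij_funM f g x : bij_fun (f * g) x = bij_fun g (bij_fun f x).
Proof. by []. Qed.
Lemma bij_fun1 x : bij_fun (1 : bij_of T) x = x. Proof. by []. Qed.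
Lemma bij_funV f x : bij_fun f^-1 x = bij_inv f x. Proof. by []. Qed.
Lemma bij_funX f (i : nat) x : bij_fun (f ^+ i) x = iter i (bij_fun f) x.
Proof. by elim: i => [//|i IH]; rewrite expgSr bij_funM IH. Qed.
End BijGroup.

(** * The ring Z[e] with e^2 = p e - 1 *)

(** The pair (a, b) stands for a + b e; [p] selects the ring: 0 for the Gaussian integers, 1 for the
    Eisenstein integers. *)
Definition quad (p : int) : Type := (int * int)%type.

Section Quad.
Local Open Scope ring_scope.
Variable p : int.
Implicit Types a b c : quad p.
HB.instance Definition _ := GRing.Zmodule.on (quad p).

Definition quad_mul a b : quad p :=
  (a.1 * b.1 - a.2 * b.2, a.1 * b.2 + a.2 * b.1 + p * a.2 * b.2).
Definition quad_one : quad p := (1, 0).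

Fact quad_mulA : associative quad_mul.
Proof. by move=> [? ?] [? ?] [? ?]; congr pair; rewrite /=; ring. Qed.
Fact quad_mulC : commutative quad_mul.
Proof. by move=> [? ?] [? ?]; congr pair; rewrite /=; ring. Qed.
Fact quad_mul1 : left_id quad_one quad_mul.
Proof. by move=> [? ?]; congr pair; rewrite /=; ring. Qed.
Fact quad_mulDl : left_distributive quad_mul +%R.
Proof. by move=> [? ?] [? ?] [? ?]; congr pair; rewrite /=; ring. Qed.
Fact quad_oner_neq0 : quad_one != 0. Proof. by []. Qed.
HB.instance Definition _ := GRing.Zmodule_isComNzRing.Build (quad p)
  quad_mulA quad_mulC quad_mul1 quad_mulDl quad_oner_neq0.

Definition eps : quad p := (0, 1).

Lemma quad_mulE a b :
  a * b = (a.1 * b.1 - a.2 * b.2, a.1 * b.2 + a.2 * b.1 + p * a.2 * b.2).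
Proof. by []. Qed.

Definition quad_norm a : int := a.1 ^+ 2 + p * a.1 * a.2 + a.2 ^+ 2.

Lemma quad_normM a b : quad_norm (a * b) = quad_norm a * quad_norm b.
Proof. by rewrite quad_mulE /quad_norm /=; ring. Qed.

Lemma quad_normX a i : quad_norm (a ^+ i) = quad_norm a ^+ i.
Proof.
elim: i => [|i IH]; last by rewrite !exprS quad_normM IH.
by rewrite /quad_norm /=; ring.
Qed.

Definition quad_conj a : quad p := (a.1 + p * a.2, - a.2).

Lemma quad_mul_conj a : a * quad_conj a = (quad_norm a, 0).
Proof. by rewrite quad_mulE /quad_norm /=; congr pair; ring. Qed.

Lemma quad_int (i : int) : i%:~R = (i, 0) :> quad p.
Proof.
elim/int_rec: i => [//|i IH|i IH]; first by rewrite -addn1 PoszD intrD IH.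
by rewrite -addn1 PoszD opprD intrD IH.
Qed.

Lemma quadE a : a = a.1%:~R + a.2%:~R * eps.
Proof. by rewrite !quad_int; case: a => x y; congr pair; rewrite /=; ring. Qed.
End Quad.

(** * The triangle groups (2,4,4) and (2,3,6) *)

(* Decides equality in free groups. *)
Ltac gword := rewrite ?/conjg ?expgS ?expg0; by rewrite ?gnorm.

(* [r] and [t] rotate the plane by the same angle, about different centres;
   [tau] is the translation [t r^-1], and [b] is the similarity multiplying
   translations by 1 + e, resp. (1 + e) / 2e. *)
Section Order4.
Variables (G : groupType) (t b r : G).
Hypotheses (t4 : t ^+ 4 = 1) (rb : commute r b).
Hypothesis rE : r^-1 * b^-1 * t ^+ 3 * b * t ^+ 2 = 1.
Let tau := t / r.

Let t1 := t ^ b.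
Let rJ : r ^ b = r. Proof. by rewrite conjgE rb mulKg. Qed.
Let t1_4 : t1 ^+ 4 = 1. Proof. by rewrite -conjXg t4 conj1g. Qed.
Let pow3 (x : G) : x ^+ 4 = 1 -> x ^+ 3 = x^-1.
Proof. by move=> x4; apply/esym/mulg1_eq; rewrite -expgS. Qed.
Let pow2 (x : G) : x ^+ 4 = 1 -> x ^+ 2 = x ^- 2.
Proof. by move=> x4; apply/esym/mulg1_eq; rewrite -expgnDr. Qed.

Let rVE : r^-1 = t ^+ 2 * t1.
Proof.
by apply: divg1_eq; rewrite -[RHS]rE (pow3 t4) {2}(pow2 t4) /t1; gword.
Qed.

(** Conjugating the formula for r^-1 by b, which fixes r, exhibits r as a conjugate of t; hence r
    inherits the order of t. *)
Let t2E : t1 ^ b = r ^ t1.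
Proof.
have r1 : r^-1 = t1 ^+ 2 * t1 ^ b by rewrite -{1}rJ -conjVg rVE conjMg conjXg.
have -> : t1 ^ b = t1 ^+ 2 * r^-1 by rewrite (pow2 t1_4) r1 mulKg.
rewrite rVE.
have -> : r = t1 ^+ 3 * t ^+ 2 by rewrite (pow3 t1_4) (pow2 t4) -invgM -rVE invgK.
by rewrite /t1; gword.
Qed.

Lemma order4_r : r ^+ 4 = 1.
Proof.
apply/eqP; rewrite -(conjg_eq1 _ t1) conjXg -t2E.
by rewrite -!conjXg t4 !conj1g.
Qed.

(** The last relation of the (2,4,4) triangle group: conjugation by b turns t r into t^-2. *)
Let tr2 : (t * r) ^+ 2 = 1.
Proof.
have trJ : (t * r) ^ b = t ^- 2.
  by rewrite conjMg rJ -[r]invgK rVE /t1; gword.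
by apply: (can_inj (conjgK b)); rewrite conjXg trJ conj1g expVgn -expgnA t4 invg1.
Qed.

Lemma order4_eps2 : (tau ^ r^-1) ^ r^-1 = tau^-1.
Proof.
apply/esym/mulg1_eq.
by rewrite -tr2 -[RHS]mulg1 -invg1 -[in RHS]order4_r /tau; gword.
Qed.

Lemma order4_commute : commute tau (tau ^ r^-1).
Proof.
apply/divg1_eq; rewrite invgM -conjVg -order4_eps2.
by rewrite -[RHS]t4 -[RHS]mulg1 -invg1 -[in RHS]order4_r /tau; gword.
Qed.

Lemma order4_similarity : tau ^ b = tau * tau ^ r^-1.
Proof.
have E : ((tau ^ b) ^ r^-1) ^ r^-1 = (tau ^ b)^-1.
  by rewrite -conjVg -order4_eps2 ![(_ ^ _) ^ b]conjJg conjVg rJ.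
apply/esym/divg1_eq; rewrite -E.
have <- : t ^+ 2 * t1 * r = 1 by rewrite -rVE mulVg.
have -> : tau ^ b = t1 / r by rewrite /tau conjMg conjVg rJ.
by rewrite -[RHS]mulg1 -invg1 -[in RHS]order4_r /tau; gword.
Qed.
End Order4.

Section Triangle236.
Variables (G : groupType) (t s : G).
Hypotheses (t6 : t ^+ 6 = 1) (s2 : s ^+ 2 = 1) (st3 : (t^-1 * s) ^+ 3 = 1).

Let pow3 : t ^+ 3 = t ^- 3.
Proof. by apply/esym/mulg1_eq; rewrite -expgnDr. Qed.
Let sV : s^-1 = s. Proof. by apply: mulg1_eq; rewrite -expg2. Qed.

Let tst : t * s * t = s * t^-1 * s.
Proof.
by apply/esym/divg1_eq; rewrite !invgM sV -[RHS](conj1g t^-1) -st3; gword.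
Qed.

Definition tri_tau := t ^+ 3 * s.
Definition tri_f := tri_tau ^ t^-1.
Definition tri_f2 := tri_f ^ t^-1.

(** Written additively, this and [tri_r] say e = 1 + e^2, the equation of a primitive sixth root of
    unity; having both orders of the product gives commutation. *)
Lemma tri_l : tri_f = tri_tau * tri_f2.
Proof.
apply: (mulIg t); apply: (mulgI (t ^- 3)).
have -> : t ^- 3 * (tri_f * t) = t * s by rewrite /tri_f /tri_tau; gword.
have -> : t ^- 3 * (tri_tau * tri_f2 * t) = (s * t^-1 * s) / t.
  by rewrite /tri_f2 /tri_f /tri_tau {3}pow3; gword.
by rewrite -tst mulgK.
Qed.

Lemma tri_r : tri_f = tri_f2 * tri_tau.
Proof.
apply: (mulgI (t ^- 3)).
have -> : t ^- 3 * tri_f = t * s / t by rewrite /tri_f /tri_tau; gword.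
have -> : t ^- 3 * (tri_f2 * tri_tau) = t * (t * s * t) * s.
  by rewrite /tri_f2 /tri_f /tri_tau; gword.
by rewrite tst -{3}sV; gword.
Qed.

Lemma tri_tau_f : commute tri_tau tri_f.
Proof. by rewrite /commute {1}tri_r tri_l mulgA. Qed.

Lemma tri_tau_f2 : commute tri_tau tri_f2.
Proof. by rewrite /commute -tri_l -tri_r. Qed.
End Triangle236.

Section Order6.
Variables (G : groupType) (t b r : G).
Hypotheses (t6 : t ^+ 6 = 1) (rb : commute r b).
Hypothesis rE : r * b^-1 * t ^+ 3 * b * t ^+ 2 = 1.
Let tau := t / r.

Let t1 := t ^ b.
Let rJ : r ^ b = r. Proof. by rewrite conjgE rb mulKg. Qed.
Let t1_6 : t1 ^+ 6 = 1. Proof. by rewrite -conjXg t6 conj1g. Qed.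
Let pow3 (x : G) : x ^+ 6 = 1 -> x ^+ 3 = x ^- 3.
Proof. by move=> x6; apply/esym/mulg1_eq; rewrite -expgnDr. Qed.
Let rE1 : r = t ^- 2 * t1 ^+ 3.
Proof.
apply: divg1_eq; rewrite -conjXg (pow3 t6) conjVg.
have -> : r = t ^- 2 * b^-1 * t ^- 3 * b.
  by apply: divg1_eq; rewrite -[RHS]rE; gword.
by gword.
Qed.

(** A half-turn, since r and t have the same angle of 60 degrees; t and s generate the (2,3,6)
    triangle group. *)
Let s := t ^+ 4 / r.

Let sJ : s ^ b = t1 * t ^+ 2.
Proof.
rewrite /s conjMg conjVg rJ conjXg -/t1 rE1 invgM invgK.
by rewrite (_ : t1 ^+ 4 = t1 * t1 ^+ 3) ?expgS //; gword.
Qed.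

Let s2 : s ^+ 2 = 1.
Proof.
have r1 : r = t1 ^- 2 * (t1 ^ b) ^+ 3 by rewrite -{1}rJ rE1 conjMg conjVg !conjXg.
have t23 : (t1 ^ b) ^+ 3 = t1 ^+ 2 * t ^- 2 * t1 ^+ 3 by rewrite -mulgA -rE1 r1 mulVKg.
have t26 : ((t1 ^ b) ^+ 3) ^+ 2 = 1 by rewrite -expgnA -conjXg t1_6 conj1g.
have E : (t1 * t ^+ 2) ^+ 2 = 1.
  apply/eqP; rewrite -invg_eq1 -expVgn invgM -(conjg_eq1 _ (t1 ^- 2)); apply/eqP.
  by rewrite -t26 t23 (pow3 t1_6); gword.
by apply: (can_inj (conjgK b)); rewrite conjXg sJ E conj1g.
Qed.


Let st3 : (t^-1 * s) ^+ 3 = 1.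
Proof.
apply: (can_inj (conjgK b)); rewrite conjXg conjMg conjVg sJ mulKg.
by rewrite -expgnA t6 conj1g.
Qed.

Let f := tau ^ t^-1.
Let f2 := f ^ t^-1.
Let sV : s^-1 = s. Proof. by apply: mulg1_eq; rewrite -expg2. Qed.
Let tauE : tau = tri_tau t s.
Proof. by rewrite /tri_tau (pow3 t6) /s /tau; gword. Qed.
Let tau_f : commute tau f. Proof. by rewrite /f tauE; exact: tri_tau_f. Qed.
Let tau_f2 : commute tau f2. Proof. by rewrite /f2 /f tauE; exact: tri_tau_f2. Qed.
Let fE : f = tau * f2. Proof. by rewrite /f2 /f tauE; exact: tri_l. Qed.

(** As r^-1 = t^-1 tau, the rotations r and t act alike on whatever ends up commuting with tau. *)
Let conj_rV x : commute tau (x ^ t^-1) -> x ^ r^-1 = x ^ t^-1.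
Proof.
move=> c; have -> : r^-1 = t^-1 * tau by rewrite mulKg.
by rewrite conjgM; apply/conjg_fixP/commgP/commute_sym.
Qed.

Let rf : tau ^ r^-1 = f. Proof. exact: conj_rV. Qed.

Lemma order6_commute : commute tau (tau ^ r^-1).
Proof. by rewrite rf. Qed.

Lemma order6_eps2 : (tau ^ r^-1) ^ r^-1 = tau ^ r^-1 / tau.
Proof. by rewrite rf (conj_rV tau_f2) -/f2 [in RHS]fE tau_f2 mulgK. Qed.

Let eps3 : ((tau ^ r^-1) ^ r^-1) ^ r^-1 = tau^-1.
Proof.
rewrite order6_eps2 conjMg order6_eps2 conjVg.
by rewrite (commuteV (commute_sym order6_commute)) mulgK.
Qed.

Lemma order6_r : r ^+ 6 = 1.
Proof.
set e := tau ^ r^-1; have ce : commute tau e by exact: order6_commute.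
pose e2 := e ^ r^-1; have ce2 : commute e e2 by rewrite /commute -!conjMg ce.
have c2 : commute tau e2.
  by rewrite /e2 order6_eps2; apply: commuteM => //; apply: commuteV.
have <- : t ^+ 6 = r ^+ 6; last exact: t6.
apply: (mulIg (r ^- 6)); rewrite mulgV.
(* Since t = tau r, this quotient is (1 + e + ... + e^5) tau, which vanishes because e^3 = -1. *)
have -> : t ^+ 6 / r ^+ 6 = tau * e * e2 * (e2 ^ r^-1) * ((e2 ^ r^-1) ^ r^-1)
    * (((e2 ^ r^-1) ^ r^-1) ^ r^-1).
  by rewrite /e2 /e /tau; gword.
have E : tau * e * e2 = e2 * e * tau by rewrite -mulgA (commuteM ce c2) ce2.
by rewrite eps3 !conjVg -/e -/e2 E !mulgK mulgV.
Qed.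

Lemma order6_similarity : ((tau ^ b) ^ r^-1) ^+ 2 = tau * tau ^ r^-1.
Proof.
set u := tau ^ b; set e1 := u ^ r^-1.
have rb' (x : G) : (x ^ r^-1) ^ b = (x ^ b) ^ r^-1 by rewrite conjJg conjVg rJ.
have ce1 : commute u e1.
  by rewrite /commute /e1 /u -!rb' -!conjMg order6_commute.
have e1E : e1 ^ r^-1 = e1 / u.
  by rewrite /e1 /u -!rb' order6_eps2 conjMg conjVg.
have t1E : t1 = u * r by rewrite /u /tau conjMg conjVg rJ mulgVK.
(* The cube of t1 = u r is computed twice: as (1 + e + e^2) u = 2e u followed by r^3, and through
   the relator as (1 + e) tau followed by r^3. *)
have E : t1 ^+ 3 = t ^+ 2 * r by rewrite [in RHS]rE1 mulVKg.
apply: (mulIg (r ^+ 3)).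
have -> : tau * tau ^ r^-1 * r ^+ 3 = t ^+ 2 * r by rewrite /tau; gword.
have <- : u * e1 * (e1 ^ r^-1) * r ^+ 3 = e1 ^+ 2 * r ^+ 3.
  by rewrite e1E [u * e1 * _]mulgA -[u * e1 * e1]mulgA (commuteM ce1 ce1) mulgK expg2.
by rewrite -E t1E /e1; gword.
Qed.
End Order6.

(** * Modules of translations over Z[e] *)

Section Comax.
Local Open Scope ring_scope.
Variable R : comPzRingType.
Implicit Types a b c : R.

Definition comax a b := exists x w, x * a + w * b = 1.

Lemma comax_sym a b : comax a b -> comax b a.
Proof. by case=> x [w E]; exists w, x; rewrite addrC. Qed.

Lemma comaxM a b c : comax a b -> comax a c -> comax a (b * c).
Proof.
move=> [x [w E]] [x' [w' E']]; exists (x * (x' * a + w' * c) + w * b * x'), (w * w').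
by rewrite -[RHS]mulr1 -{1}E -E'; ring.
Qed.

Lemma comaxX a b i j : comax a b -> comax (a ^+ i) (b ^+ j).
Proof.
have aux a' b' l : comax a' b' -> comax a' (b' ^+ l).
  move=> ab; elim: l => [|l IH]; last by rewrite exprS; exact: comaxM.
  by exists 0, 1; rewrite mul0r add0r mulr1.
by move=> ab; apply/aux/comax_sym/aux/comax_sym.
Qed.

(* In R / (a^M - b^M u), both a and b become invertible. *)
Lemma comax_inv a b u v (M : nat) : comax a b -> u * v = 1 -> (0 < M)%N ->
  comax a (a ^+ M - b ^+ M * u) /\ comax b (a ^+ M - b ^+ M * u).
Proof.
move=> ab uv M0; have [x [w E]] := comaxX M M ab.
split.
  exists ((x + w * v) * a ^+ M.-1), (- (w * v)).
  rewrite -mulrA -exprSr prednK // -E mulrBr.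
  have -> : - (w * v) * (b ^+ M * u) = - (w * b ^+ M) * (u * v) by ring.
  by rewrite uv; ring.
exists ((x * u + w) * b ^+ M.-1), x.
by rewrite -mulrA -exprSr prednK // -E; ring.
Qed.
End Comax.

Section ExpMorph.
Variables (R : pzRingType) (G : groupType) (h : R -> G).
Hypothesis hD : {morph h : b c / (b + c)%R >-> b * c}.

Lemma exp_morph0 : h 0%R = 1.
Proof. by apply: (mulgI (h 0%R)); rewrite -hD addr0 mulg1. Qed.

Lemma exp_morphN b : h (- b)%R = (h b)^-1.
Proof. by apply/esym/mulg1_eq; rewrite -hD subrr exp_morph0. Qed.

Lemma exp_morphMz i b : h (i%:~R * b)%R = zexp (h b) i.
Proof.
have natM (l : nat) c : h (l%:Z%:~R * c)%R = h c ^+ l.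
  elim: l => [|l IH]; first by rewrite mul0r exp_morph0.
  by rewrite -addn1 PoszD intrD mulrDl mul1r hD IH addn1 expgSr.
by case: i => l; rewrite ?NegzE ?intrN ?mulNr ?exp_morphN natM.
Qed.
End ExpMorph.

Section Translations.
Variables (G : groupType) (tau r : G) (p : int).
Local Notation R := (quad p).
Hypothesis tau_comm : commute tau (tau ^ r^-1).
Hypothesis tau_eps2 : (tau ^ r^-1) ^ r^-1 = zexp (tau ^ r^-1) p * tau^-1.

Definition mu (a : R) : G := zexp tau a.1 * zexp (tau ^ r^-1) a.2.

Lemma mu0 : mu 0%R = 1. Proof. by rewrite /mu mulg1. Qed.
Lemma mu1 : mu 1%R = tau. Proof. by rewrite /mu mulg1. Qed.
Lemma mu_epsE : mu (eps p) = tau ^ r^-1. Proof. by rewrite /mu mul1g. Qed.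

Lemma muD a b : mu (a + b)%R = mu a * mu b.
Proof.
rewrite /mu !zexpD -!mulgA; congr (_ * _); rewrite !mulgA; congr (_ * _).
exact: zexp_commute.
Qed.

Lemma muC a b : commute (mu a) (mu b).
Proof. by rewrite /commute -!muD addrC. Qed.

Lemma muN a : mu (- a)%R = (mu a)^-1. Proof. exact: exp_morphN muD a. Qed.

Lemma muMz i a : mu (i%:~R * a)%R = zexp (mu a) i.
Proof. exact: exp_morphMz muD i a. Qed.

Lemma mu_eps a : mu (eps p * a)%R = mu a ^ r^-1.
Proof.
rewrite conjMg !zexpJ tau_eps2 zexpMn; last first.
  by apply/commuteV/commute_sym; rewrite -[tau]zexp1; exact: zexp_commute.
rewrite -zexpM zexpVg -zexpN /mu /=.
rewrite (zexp_commute _ _ tau_comm) mulgA -zexpD.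
by congr (zexp _ _ * zexp _ _); ring.
Qed.

Lemma mu_eq (f g : R -> G) (x : G) :
  {morph f : a b / (a + b)%R >-> a * b} -> {morph g : a b / (a + b)%R >-> a * b} ->
  (forall a, f (eps p * a)%R = f a ^ x) -> (forall a, g (eps p * a)%R = g a ^ x) ->
  f 1%R = g 1%R -> f =1 g.
Proof.
move=> fD gD fe ge fg1 a.
have E (h : R -> G) : {morph h : b c / (b + c)%R >-> b * c} ->
    (forall b, h (eps p * b)%R = h b ^ x) ->
    h a = zexp (h 1%R) a.1 * zexp (h 1%R ^ x) a.2.
  move=> hD he; rewrite {1}[a]quadE hD -[(a.1%:~R)%R]mulr1 !(exp_morphMz hD).
  by rewrite -[eps p]mulr1 he.
by rewrite (E f) // (E g) // fg1.
Qed.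
End Translations.

(** * The coprime case *)

(* Conjugation by y^k multiplies translations by gam/del; r = y^(sg m) rotates
   by e. *)
Definition pn (n : nat) : int := if n == 4 then 0%R else 1%R.
Definition sg (n : nat) : int := if n == 4 then (-1)%R else 1%R.
Definition gam (n : nat) : quad (pn n) := (1 + eps _)%R.
Definition del (n : nat) : quad (pn n) := if n == 4 then 1%R else (2 * eps _)%R.

(** The inverse of e, because e (p - e) = 1. *)
Definition epsV (n : nat) : quad (pn n) := ((pn n)%:~R - eps _)%R.

Section Coprime.
Variables (n : nat) (m k : int).
Hypotheses (hn : n = 4 \/ n = 6) (hm : m <> 0%R).
Local Notation R := (quad (pn n)).
Local Notation e := (eps (pn n)).

Lemma eps_epsV : (e * epsV n = 1)%R.
Proof. by case: hn => ->. Qed.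

Lemma eps_n : (e ^+ n = 1)%R.
Proof. by case: hn => ->. Qed.

(** For [n = 6], gam^2 = 3e and del = 2e, so e^-1 gam^2 - e^-1 del = 3 - 2. *)
Lemma gam_del_comax : comax (gam n) (del n).
Proof.
case: hn => ->; first by exists 0%R, 1%R.
by exists (gam 6 * epsV 6)%R, (- epsV 6)%R.
Qed.

(* The rotation matching the translations by y^(k |m|): y^(k |m|) = r^-kap. *)
Definition kap : nat := absz ((- sg n * sgz m * k) %% n%:Z)%Z.
Definition alpha : R := (gam n ^+ absz m - del n ^+ absz m * e ^+ kap)%R.

Lemma comax_alpha : comax (gam n) alpha /\ comax (del n) alpha.
Proof.
apply: (@comax_inv _ _ _ _ (epsV n ^+ kap)%R); first exact: gam_del_comax.
  by rewrite -exprMn eps_epsV expr1n.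
by rewrite absz_gt0; apply/eqP.
Qed.

Section Relations.
Variables (G : groupType) (t y : G).
Hypothesis tn : t ^+ n = 1.
Hypothesis rel : zexp y (m - k) * t ^+ 3 * zexp y k * t ^+ 2 = 1.

Definition rot := zexp y (sg n * m).
Definition tau := t / rot.
Local Notation mu := (@mu G tau rot (pn n)).

Let rotb i : commute rot (zexp y i). Proof. exact: zexp_commute. Qed.
Let relb : zexp y m * (zexp y k)^-1 * t ^+ 3 * zexp y k * t ^+ 2 = 1.
Proof. by rewrite -zexpN -zexpD. Qed.

Lemma rot_facts :
  [/\ commute tau (tau ^ rot^-1),
      (tau ^ rot^-1) ^ rot^-1 = zexp (tau ^ rot^-1) (pn n) * tau^-1,
      rot ^+ n = 1 &
      mu (del n) ^ zexp y k = mu (gam n)].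
Proof.
have := tn; have := relb; have := rotb k; rewrite /mu /gam /del /tau /rot.
case: hn => -> /=; rewrite ?mul1r ?mulN1r => rb r1 t1.
  rewrite -[zexp y m]invgK -(zexpN y m) in r1.
  split; rewrite ?mul1g ?mulg1.
  - exact: order4_commute t1 rb r1.
  - exact: order4_eps2 t1 rb r1.
  - exact: order4_r t1 rb r1.
  - exact: order4_similarity t1 rb r1.
have c6 := order6_commute t1 rb r1.
split; rewrite ?mul1g ?mulg1 //.
- by rewrite (order6_eps2 t1 rb r1).
- exact: order6_r t1 rb r1.
- by rewrite conjXg -(order6_similarity t1 rb r1) conjJg conjVg [_ ^ _ in X in _ ^ X]conjgE rb mulKg.
Qed.

Let tau_comm := let: And4 h _ _ _ := rot_facts in h.
Let tau_eps2 := let: And4 _ h _ _ := rot_facts in h.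
Lemma rot_n : rot ^+ n = 1. Proof. by case: rot_facts. Qed.
Let muD := muD (p := pn n) tau_comm.
Let mu_eps := mu_eps tau_comm tau_eps2.
Let muN := muN (p := pn n) tau_comm.

Lemma mu_rotV i a : mu a ^ (rot ^- i) = mu (e ^+ i * a)%R.
Proof.
elim: i a => [|i IH] a; first by rewrite invg1 conjg1 mul1r.
by rewrite expgS invgM conjgM IH -mu_eps mulrA -exprS.
Qed.

Lemma mu_rot a : mu a ^ rot = mu (epsV n * a)%R.
Proof. by rewrite -{1}[a]mul1r -eps_epsV -mulrA mu_eps conjgKV. Qed.

Let mu_morph c : {morph (fun a => mu (a * c)%R) : a b / (a + b)%R >-> a * b}.
Proof. by move=> a b; rewrite mulrDl muD. Qed.

(** Both sides are additive in a and compatible with e, as the rotation commutes with y^k; so it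
    suffices to compare them at 1. *)
Lemma mu_shift a : mu (del n * a)%R ^ zexp y k = mu (gam n * a)%R.
Proof.
pose f a := mu (a * del n)%R ^ zexp y k; pose g a := mu (a * gam n)%R.
have : f =1 g.
  apply: (mu_eq (x := rot^-1)) => [b c|b c|b|b|].
  - by rewrite /f mu_morph conjMg.
  - exact: mu_morph.
  - rewrite /f -mulrA mu_eps -!conjgM; congr (_ ^ _).
    exact/commute_sym/commuteV/commute_sym/rotb.
  - by rewrite /g -mulrA mu_eps.
  - by rewrite /f /g !mul1r; case: rot_facts.
by move=> /(_ a); rewrite /f /g ![(a * _)%R]mulrC.
Qed.

Lemma mu_shiftX i a :
  mu (del n ^+ i * a)%R ^ zexp y (k * i%:Z) = mu (gam n ^+ i * a)%R.
Proof.
elim: i a => [|i IH] a; first by rewrite mulr0 conjg1.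
rewrite -addn1 PoszD mulrDr mulr1 (zexpD y (k * i%:Z) k) conjgM addn1.
rewrite exprSr -mulrA IH.
have -> : (gam n ^+ i * (del n * a) = del n * (gam n ^+ i * a))%R by ring.
by rewrite mu_shift mulrA -exprS.
Qed.

(** Conjugation by y^(k|m|) multiplies by (gam/del)^|m|; but this element is also r^-kap, which
    multiplies by e^kap. Clearing denominators gives alpha. *)
Lemma mu_alpha a : mu (alpha * a)%R = 1.
Proof.
have E : zexp y (k * `|m|%N) = rot ^- kap.
  have -> : (k * `|m|%N = sg n * m * (sg n * sgz m * k))%R.
    have -> : (`|m|%N%:Z = sgz m * m)%R by rewrite abszEsg.
    have sg2 : (sg n * sg n = 1)%R by case: hn => ->.
    by rewrite -[LHS]mul1r -sg2; ring.
  rewrite zexpM -/rot -[X in zexp _ X]opprK zexpN; congr (_^-1).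
  rewrite -zexp_nat /kap gez0_abs; last by apply: modz_ge0; case: hn => ->.
  by rewrite -(zexp_mod _ rot_n) !mulNr.
rewrite mulrBl muD muN -mu_shiftX E mu_rotV.
by apply/eqP; rewrite mulg_eq1 invgK; apply/eqP; congr mu; ring.
Qed.

Hypothesis hmk : coprimez m k.

Let scaled i := exists c, forall a, mu a ^ zexp y i = mu (c * a)%R.

Let scaledD i j : scaled i -> scaled j -> scaled (i + j)%R.
Proof.
move=> [c ci] [c' cj]; exists (c' * c)%R => a.
by rewrite zexpD conjgM ci cj mulrA.
Qed.

Let scaled0 : scaled 0%R. Proof. by exists 1%R => a; rewrite conjg1 mul1r. Qed.

Let scaledM z i : scaled i -> scaled (- i)%R -> scaled (z * i)%R.
Proof.
have natM l j : scaled j -> scaled (l%:Z * j)%R.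
  move=> sj; elim: l => [|l IH]; first by rewrite mul0r.
  by rewrite -addn1 PoszD mulrDl mul1r; exact: scaledD.
move=> si sNi; case: z => l; first exact: natM.
by rewrite NegzE mulNr -mulrN; exact: natM.
Qed.

(** Modulo alpha both [gam] and [del] are invertible, so y^k and y^-k act by ring elements; y^m and
    y^-m act by powers of e. Coprimality of m and k then covers every power of y. *)
Lemma mu_scaled i : exists c, forall a, mu a ^ zexp y i = mu (c * a)%R.
Proof.
have sk : scaled k.
  have [_ [x [w E]]] := comax_alpha; exists (gam n * x)%R => a.
  have aE : (a = del n * (x * a) + alpha * (w * a))%R by rewrite -[LHS]mul1r -E; ring.
  by rewrite {1}aE muD mu_alpha mulg1 mu_shift mulrA.
have sNk : scaled (- k)%R.
  have [[x [w E]] _] := comax_alpha; exists (del n * x)%R => a.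
  have aE : (a = gam n * (x * a) + alpha * (w * a))%R by rewrite -[LHS]mul1r -E; ring.
  by rewrite {1}aE muD mu_alpha mulg1 -mu_shift zexpN conjgK mulrA.
have [sm sNm] : scaled m /\ scaled (- m)%R.
  have: scaled (sg n * m)%R /\ scaled (- (sg n * m))%R.
    split; first by exists (epsV n) => a; rewrite mu_rot.
    by exists e => a; rewrite zexpN mu_eps.
  by case: hn => -> /=; rewrite ?mulN1r ?mul1r ?opprK => -[].
have [[u v] /= E] := coprimezP _ _ hmk.
by rewrite -[i]mulr1 -E mulrDr !mulrA; apply: scaledD; exact: scaledM.
Qed.

(* The group generated by t and y is an extension of the translations by <y>. *)
Hypothesis gen : forall P : G -> Prop, P 1 -> (forall g, P g -> P (g * t)) ->
  (forall g, P g -> P (g * t^-1)) -> (forall g, P g -> P (g * y)) ->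
  (forall g, P g -> P (g * y^-1)) -> forall g, P g.

Lemma tE : t = mu 1%R * rot. Proof. by rewrite mu1 mulgVK. Qed.

Lemma mu_mulz a i b j : exists c, mu a * zexp y i * (mu b * zexp y j) = mu c * zexp y (i + j).
Proof.
have [c cE] := mu_scaled (- i)%R; exists (a + c * b)%R.
rewrite muD -cE zexpN zexpD conjgE invgK !mulgA; congr (_ * _).
by rewrite mulgVK.
Qed.

Lemma muz_elim g : exists a i, g = mu a * zexp y i.
Proof.
move: g; apply: gen.
- by exists 0%R, 0%R; rewrite mu0 mulg1.
- move=> _ [a [i ->]]; rewrite tE /rot.
  by have [c ->] := mu_mulz a i 1%R (sg n * m)%R; eexists; eexists.
- move=> _ [a [i ->]]; rewrite tE /rot invgM -zexpN -muN.
  have [c cE] := mu_mulz 0%R (- (sg n * m))%R (- 1)%R 0%R.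
  rewrite mu0 mul1g mulg1 addr0 in cE; rewrite cE.
  by have [d ->] := mu_mulz a i c (- (sg n * m))%R; eexists; eexists.
- move=> _ [a [i ->]]; exists a, (i + 1)%R; by rewrite zexpS mulgA.
- move=> _ [a [i ->]]; exists a, (i - 1)%R; by rewrite zexpD zexpN mulgA.
Qed.
End Relations.
End Coprime.

(** * The affine model over Z[e] / alpha *)

Section AffineBij.
Variable S : comNzRingType.

Definition trans_bij (c : S) : bij_of S := BijOf (addrK c) (subrK c).

Fact scale_cancel (c d : S) : (c * d = 1)%R -> cancel ( *%R c) ( *%R d).
Proof. move=> cd x. by rewrite mulrA [(d * c)%R]mulrC cd mul1r. Qed.

Definition scale_bij (c d : S) (cd : (c * d = 1)%R) : bij_of S :=
  BijOf (scale_cancel cd) (scale_cancel (etrans (mulrC d c) cd)).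

Lemma scale_bijX c d (cd : (c * d = 1)%R) i x :
  bij_fun (scale_bij cd ^+ i) x = (c ^+ i * x)%R.
Proof.
rewrite bij_funX; elim: i => [|i IH]; first by rewrite mul1r.
by rewrite iterS IH exprS -mulrA.
Qed.
End AffineBij.

(** For commuting t and y the relator reads y^m t^5 = 1, where t^5 is t or t^-1 according to n;
    hence the sign [sg]. *)
Lemma commute_rel (G : groupType) (n : nat) (m k : int) (t y : G) :
  n = 4 \/ n = 6 -> commute t y -> t ^+ n = 1 ->
  zexp y (m - k) * t ^+ 3 * zexp y k * t ^+ 2 = 1 -> tau n m t y = 1.
Proof.
move=> hn cty tn; have cY i j : commute (t ^+ j) (zexp y i).
  by rewrite -zexp_nat; exact: zexp_commute.
rewrite -[zexp y (m - k) * _ * _]mulgA cY (mulgA (zexp y (m - k))) -zexpD subrK.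
rewrite -(mulgA (zexp y m)) -expgnDr => E.
have yE : zexp y m = t ^- 5 by apply/divg1_eq; rewrite invgK.
rewrite /tau /rot; case: hn tn => -> tn; rewrite /sg /=.
  by rewrite mulrC zexpM yE zexpN zexp1 invgK expgSr tn mul1g divgg.
by rewrite mulrC zexpM yE zexp1 invgK -expgS.
Qed.

Lemma commgEM (G : groupType) (u v : G) : [~ u, v] = (v * u)^-1 * (u * v).
Proof. by rewrite /commg; gword. Qed.

Lemma der1_abelian (G : groupType) (x : G) :
  abelian_group G -> x \in der G 1 -> x = 1.
Proof.
have PF (u v : G) : u = 1 -> v = 1 -> u / v = 1 by move=> -> ->; rewrite divgg.
move=> cG xd; apply/(pred_subgroupP (P := fun u => u = 1) erefl PF).
move: x xd; apply: derived_sub => u v _ _; apply/pred_subgroupP.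
exact/eqP/commgP/cG.
Qed.

(** * The presentation of J and its abelianization *)

Section JGroup.
Variables (n : nat) (m k : int).
Local Notation J := (Jgroup n m k).

Let Jproj : {multiplicative free_group bool -> J} := quot_proj _.

Definition Jt : J := pgen _ true.
Definition Jy : J := pgen _ false.

Lemma Jt_n : Jt ^+ n = 1.
Proof.
rewrite -[LHS](homX Jproj); apply: presented_rel.
by rewrite inE eqxx.
Qed.

Lemma J_rel : zexp Jy (m - k) * Jt ^+ 3 * zexp Jy k * Jt ^+ 2 = 1.
Proof.
rewrite -(hom_zexp Jproj) -(homX Jproj) -(hom_zexp Jproj) -(homX Jproj) -!homM.
by apply: presented_rel; rewrite !inE eqxx orbT.
Qed.

Lemma J_lift (G : groupType) (t y : G) : t ^+ n = 1 ->
  zexp y (m - k) * t ^+ 3 * zexp y k * t ^+ 2 = 1 ->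
  exists F : {multiplicative J -> G}, F Jt = t /\ F Jy = y.
Proof.
move=> tn rel; have [|F FE] := @presented_lift _
    [:: free_gen true ^+ n;
        zexp (free_gen false) (m - k)%R * free_gen true ^+ 3
        * zexp (free_gen false) k * free_gen true ^+ 2] G (fun b => if b then t else y).
  by move=> r; rewrite !inE => /orP[]/eqP->;
    rewrite ?homM ?homX ?hom_zexp /= !free_lift_gen.
by exists F; split; rewrite FE.
Qed.

Lemma J_ind (P : J -> Prop) : P 1 -> (forall g, P g -> P (g * Jt)) ->
  (forall g, P g -> P (g * Jt^-1)) -> (forall g, P g -> P (g * Jy)) ->
  (forall g, P g -> P (g * Jy^-1)) -> forall g, P g.
Proof.
by move=> P1 Pt PtV Py PyV; apply: presented_ind => // g [] Pg; auto.
Qed.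

Hypotheses (hn : n = 4 \/ n = 6) (hm : m <> 0%R).
Let N := `|(n%:Z * m)%R|%N.

Lemma JN_gt1 : (1 < N)%N.
Proof. by rewrite /N; case: hn => ->; lia. Qed.

Lemma Zp_zexp (M : nat) (x : 'Z_M) i : zexp x i = (x *~ i)%R.
Proof.
have natE (j : nat) : x ^+ j = (x *+ j)%R.
  by elim: j => [//|j IH]; rewrite expgS IH mulrS.
by case: i => j /=; rewrite natE // NegzE mulrNz.
Qed.

Lemma Zp_mulg (M : nat) (x z : 'Z_M) : x * z = (x + z)%R. Proof. by []. Qed.

(** With t sent to sg(n) m, both relators have exponent sum a multiple of nm. This bounds from below
    the order of y modulo J'. *)
Lemma Jdeg : exists D : {multiplicative J -> 'Z_N}, D Jy = 1%R.
Proof.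
have NE : ((n%:Z * m)%:~R = 0 :> 'Z_N)%R.
  have : (N%:R = 0 :> 'Z_N)%R by rewrite pchar_Zp // JN_gt1.
  by rewrite (intEsg (n%:Z * m)%R) intrM => E; rewrite -[X in (_ * X)%R]/(N%:R)%R E mulr0.
have [||D [_ Dy]] := @J_lift 'Z_N ((sg n * m)%:~R)%R 1%R; last by exists D.
- rewrite -zexp_nat Zp_zexp -mulrzA -[LHS]/(_%:~R)%R.
  by rewrite mulrC mulrCA intrM NE mulr0.
- rewrite -!zexp_nat !Zp_zexp !Zp_mulg -!mulrzA -!intrD.
  have [c ->] : exists c, ((m - k) + sg n * m * 3 + k + sg n * m * 2 = c * (n%:Z * m))%R.
    by case: hn => -> ; [exists (- 1)%R|exists 1%R]; rewrite /sg /=; ring.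
  by rewrite intrM NE mulr0.
Qed.

Lemma Jtau_der : tau n m Jt Jy \in der J 1.
Proof.
pose q : {multiplicative J -> quotient (der J 1)} := quot_proj _.
have cq g h : commute (q g) (q h).
  apply/commgP/eqP; rewrite -homR; apply/quot_proj_eq1.
  exact: (@mem_derived _ (der J 0)).
apply/quot_proj_eq1; rewrite -[LHS]/(q _) homF hom_zexp.
have Tn : q Jt ^+ n = 1 by rewrite -homX Jt_n hom1.
have := congr1 q J_rel; rewrite hom1 3!homM !homX !hom_zexp.
exact: commute_rel hn (cq _ _) Tn.
Qed.

Lemma Jy_mod_der g : exists i, g * zexp Jy i \in der J 1.
Proof.
elim/J_ind: g => [|g [i gi]|g [i gi]|g [i gi]|g [i gi]].
- by exists 0%R; rewrite mulg1 gpred1.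
- exists (i - sg n * m)%R; move: (gpredNJ _ (zexp Jy i) Jtau_der) => tder.
  rewrite addrC zexpD zexpN.
  have -> : g * Jt * ((zexp Jy (sg n * m))^-1 * zexp Jy i)
    = g * zexp Jy i * tau n m Jt Jy ^ zexp Jy i by rewrite /tau /rot; gword.
  exact: gpredM.
- exists (i + sg n * m)%R; move: (gpredNJ _ (zexp Jy (i + sg n * m)%R) Jtau_der) => tder.
  rewrite -(gpredMr _ tder).
  have -> : g * Jt^-1 * zexp Jy (i + sg n * m) * tau n m Jt Jy ^ zexp Jy (i + sg n * m)
    = g * zexp Jy i; last by [].
  by rewrite addrC zexpD /tau /rot; gword.
- exists (i - 1)%R; by rewrite addrC zexpD zexpN -mulgA mulVKg.
- exists (i + 1)%R; by rewrite addrC zexpD -mulgA mulKg.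
Qed.

Lemma Jy_der i : zexp Jy i \in der J 1 -> (N %| `|i|)%N.
Proof.
have [D Dy] := Jdeg => /(hom_der D); rewrite hom_zexp Dy Zp_zexp.
move/(der1_abelian (fun x z : 'Z_N => addrC x z)) => i0.
have : (`|i|%N%:R = 0 :> 'Z_N)%R.
  rewrite -[LHS]/(`|i|%N%:Z%:~R)%R abszEsg intrM.
  by rewrite -[X in (_ * X)%R]/(1 *~ i)%R i0 mulr0.
move/(congr1 val); rewrite /= val_Zp_nat ?JN_gt1 // => /eqP.
by rewrite -/(dvdn _ _).
Qed.
End JGroup.

(* V^i x + (V + ... + V^i) is the i-th iterate of x |-> V (x + 1). *)
Fixpoint geomV n i : quad (pn n) :=
  if i is j.+1 then (epsV n * (geomV n j + 1))%R else 0%R.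

Section Model.
Variables (n : nat) (m k : int).
Hypotheses (hn : n = 4 \/ n = 6) (hm : m <> 0%R) (hmk : coprimez m k).
Local Notation J := (Jgroup n m k).
Local Notation t := (Jt n m k).
Local Notation y := (Jy n m k).
Local Notation R := (quad (pn n)).
Local Notation e := (eps (pn n)).
Local Notation V := (epsV n).
Local Notation alpha := (alpha n m k).
Local Notation muJ := (mu (p := pn n) (tau n m t y) (rot n m y)).

Let rel := J_rel n m k.
Let tn := Jt_n n m k.

Lemma mem_mu_der a : muJ a \in der J 1.
Proof.
have taud := Jtau_der m k hn.
by rewrite gpredM ?gpred_zexp ?gpredNJ.
Qed.

Lemma der_muP g : reflect (exists a, g = muJ a) (g \in der J 1).
Proof.
have [c1 c2 rn _] := rot_facts hn tn rel.
apply: (iffP idP) => [|[a ->]]; last exact: mem_mu_der.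
have P1 : exists a, 1 = muJ a by exists 0%R; rewrite mu0.
have PF x z : (exists a, x = muJ a) -> (exists a, z = muJ a) -> exists a, x / z = muJ a.
  by move=> [a ->] [b ->]; exists (a - b)%R; rewrite muD // muN.
move=> gd; apply/(pred_subgroupP P1 PF); move: gd; apply: derived_sub => x z _ _.
apply/pred_subgroupP.
have elim h := muz_elim hn hm tn rel hmk (@J_ind n m k) h.
have mulz a i b j := mu_mulz hn hm tn rel hmk a i b j.
have [a [i ->]] := elim x; have [b [j ->]] := elim z.
have [c cE] := mulz a i b j; have [d dE] := mulz b j a i.
have [l lE] := mu_scaled hn hm tn rel hmk (i + j)%R.
(* Both products x z and z x end in y^(i + j), so the commutator is the translation c - d conjugated
   by that power. *)
exists (l * (c - d))%R.
rewrite commgEM cE dE [(j + i)%R]addrC -lE muD // muN //.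
by rewrite (commuteV (muC c1 c d)) invgM conjgE !mulgA.
Qed.

Let W : R := if n == 4 then e else V.

(** The first two identities make x |-> V (x + 1) have order dividing n; the last two are the linear
    and the translation part of the second relator. *)
Lemma epsV_identities : [/\ (V ^+ n = 1)%R, geomV n n = 0%R, (V ^+ 5 * W = 1)%R
  & (V ^+ 2 * geomV n 3 * gam n = - geomV n 2 * del n)%R].
Proof. by rewrite /W; case: hn => ->; split. Qed.

Section Action.
Variables (S : comNzRingType) (f : {rmorphism R -> S}).
Hypothesis fa : f alpha = 0%R.

(** The lower bound on J': a translation of J whose parameter has nonzero image under f acts
    non-trivially. *)
Lemma affine_action : exists F : {multiplicative J -> bij_of S},
  forall a x, bij_fun (F (muJ a)) x = (x + f a)%R.
Proof.
have [[xg [wg Eg]] [xd [wd Ed]]] := comax_alpha k hn hm.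
have fE x w c : (x * c + w * alpha = 1)%R -> (f c * f x = 1)%R.
  by move/(congr1 f); rewrite rmorphD !rmorphM fa mulr0 addr0 rmorph1 mulrC.
pose b := (f (gam n) * f xd)%R.
have bb' : (b * (f (del n) * f xg) = 1)%R.
  by rewrite /b mulrACA [(f xd * _)%R]mulrC mulrACA (fE _ _ _ Eg) (fE _ _ _ Ed) mulr1.
pose Mb := scale_bij bb'.
have eV : (f e * f V = 1)%R by rewrite -rmorphM eps_epsV // rmorph1.
pose Me := scale_bij eV.
have Men : Me ^+ n = 1.
  by apply: eq_bij => x; rewrite scale_bijX -rmorphXn eps_n // rmorph1 mul1r.
have cM : commute Me Mb by apply: eq_bij => x /=; ring.
(* This is where alpha vanishing in S enters; it yields the compatibility needed for a common root
   of the maps for y^m and y^k. *)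
have bE : Mb ^+ `|m| = Me ^+ kap n m k.
  apply: eq_bij => x; rewrite !scale_bijX; congr (_ * _)%R.
  move: fa; rewrite rmorphB rmorphM !rmorphXn => /eqP; rewrite subr_eq0 => /eqP E.
  rewrite exprMn E mulrC mulrA -exprMn [(f xd * _)%R]mulrC (fE _ _ _ Ed).
  by rewrite expr1n mul1r.
have MbE : zexp Mb m = zexp (zexp Me (- sg n)) k.
  rewrite {1}[m]intEsg mulrC zexpM zexp_nat bE -zexp_nat /kap gez0_abs; last first.
    by apply: modz_ge0; case: hn => ->.
  rewrite -(zexp_mod _ Men) -!zexpM; congr zexp.
  have : (sgz m * sgz m = 1)%R by rewrite mulz_sg; case: eqP.
  move=> E; rewrite -[RHS]mulr1 -E; ring.
have [[u v] /= uv] := coprimezP _ _ hmk.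
have cMe : commute (zexp Me (- sg n)) Mb by rewrite -[Mb]zexp1; exact: zexp_commute.
have [] := zexp_bezout cMe MbE uv.
set Y := _ * _ => Ym Yk.
have [Vn gn VW gg] := epsV_identities.
pose T := trans_bij (1%R : S) / Me.
have TX i x : bij_fun (T ^+ i) x = (f (V ^+ i) * x + f (geomV n i))%R.
  rewrite bij_funX; elim: i => [|i IH]; first by rewrite rmorph1 rmorph0 mul1r addr0.
  by rewrite iterS IH /= exprS !(rmorphM, rmorphD, rmorph1); ring.
have Tn : T ^+ n = 1.
  by apply: eq_bij => x; rewrite TX Vn gn rmorph1 rmorph0 mul1r addr0.
have MeW x : bij_fun (zexp Me (- sg n)) x = (f W * x)%R.
  by rewrite /W /sg; case: ifP.
have Trel : zexp Y (m - k) * T ^+ 3 * zexp Y k * T ^+ 2 = 1.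
  rewrite zexpD zexpN Ym Yk; apply: eq_bij => x.
  rewrite (bij_funM _ (T ^+ 2)) TX (bij_funM _ Mb) (bij_funM _ (T ^+ 3)) TX.
  rewrite bij_funM MeW /= /b.
  have -> z : (f (V ^+ 2) * (f (gam n) * f xd * z) + f (geomV n 2) =
      f (V ^+ 2) * f (gam n) * f xd * z + f (geomV n 2))%R by move=> *; ring.
  have xE : (f (V ^+ 5 * W) * (b * (f (del n) * f xg)) * x = x)%R.
    by rewrite VW bb' rmorph1 !mul1r.
  have gg' : (f (V ^+ 2) * f (gam n) * f xd * f (geomV n 3) = - f (geomV n 2))%R.
    have -> : (f (V ^+ 2) * f (gam n) * f xd * f (geomV n 3) =
        f (V ^+ 2 * geomV n 3 * gam n) * f xd)%R by rewrite !rmorphM; ring.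
    by rewrite gg rmorphM rmorphN -mulrA (fE _ _ _ Ed) mulr1.
  rewrite -[RHS]xE mulrDr gg' subrK (rmorphM f (V ^+ 5)%R) (exprD V 2 3) (rmorphM f (V ^+ 2)%R) /b; ring.
have [F [Ft Fy]] := J_lift Tn Trel; exists F => a x.
have Fr : F (rot n m y) = Me^-1.
  rewrite hom_zexp Fy mulrC zexpM Ym -zexpM -[in RHS](zexp1 Me) -zexpN.
  by congr zexp; rewrite /sg; case: ifP.
have Ftau : F (tau n m t y) = trans_bij (1%R : S) by rewrite homF Ft Fr invgK mulgVK.
have transD : {morph @trans_bij S : c d / (c + d)%R >-> c * d}.
  by move=> c d; apply: eq_bij => z /=; rewrite addrA.
rewrite homM !hom_zexp homJ homV Fr Ftau invgK.
have -> : trans_bij (1%R : S) ^ Me = trans_bij (f e).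
  by apply: eq_bij => z /=; rewrite mulrDr mulr1 mulrA eV mul1r.
rewrite -!(exp_morphMz transD) -transD /= mulr1 {3}[a]quadE.
by rewrite rmorphD rmorphM !rmorph_int.
Qed.
End Action.
End Model.

(** * Arithmetic of alpha *)

Section PrimitiveIntegral.
Local Open Scope ring_scope.
Variable p : int.
Implicit Types a b : quad p.

(** e is congruent to an integer modulo a, so Z[e]/a is additively generated by 1. *)
Definition primitive a := exists (i : int) c, eps p - i%:~R = a * c.
Definition integral_up_to_unit a :=
  exists (i : int) u v, u * v = 1 /\ a = i%:~R * u.

(** The second coordinate of a (s, t) is s a.2 + t (a.1 + p a.2), which Bezout makes equal to 1. *)
Lemma coprime_primitive a : coprimez a.2 (a.1 + p * a.2) -> primitive a.
Proof.
case/coprimezP=> [[s t] /= E]; exists (t * a.2 - s * a.1), (s, t).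
rewrite quad_int quad_mulE; congr pair; rewrite /=; first by ring.
by rewrite -[RHS]/(_ + _) subr0 -E; ring.
Qed.

Lemma primitive_unit a u v : u * v = 1 -> primitive a -> primitive (u * a).
Proof.
move=> uv [i [c E]]; exists i, (v * c).
by rewrite E mulrACA uv mul1r.
Qed.

Lemma integral_unit a u v : u * v = 1 ->
  integral_up_to_unit a -> integral_up_to_unit (u * a).
Proof.
move=> uv [i [u' [v' [uv' ->]]]]; exists i, (u * u'), (v * v').
by rewrite mulrACA uv uv' mulr1 mulrCA.
Qed.

Lemma integral_int a : a.2 = 0 -> integral_up_to_unit a.
Proof.
move=> a2; exists a.1, 1, 1; rewrite !mulr1 quad_int; split=> //.
by case: a a2 => x z /= ->.
Qed.


End PrimitiveIntegral.

Local Open Scope ring_scope.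

Lemma gam4_X q : ((1 + eps 0) ^+ (2 * q) = (2 ^+ q)%:~R * eps 0 ^+ q :> quad 0).
Proof.
rewrite exprM (_ : (1 + eps 0) ^+ 2 = 2%:~R * eps 0) //.
by rewrite exprMn -rmorphXn.
Qed.

Lemma gam6_X q : ((1 + eps 1) ^+ (2 * q) = (3 ^+ q)%:~R * eps 1 ^+ q :> quad 1).
Proof.
rewrite exprM (_ : (1 + eps 1) ^+ 2 = 3%:~R * eps 1) //.
by rewrite exprMn -rmorphXn.
Qed.

Lemma del6_X q : ((2 * eps 1) ^+ (2 * q) = (4 ^+ q)%:~R * eps 1 ^+ (2 * q) :> quad 1).
Proof.
rewrite exprMn exprM (_ : 2 ^+ 2 = 4%:~R) //.
by rewrite -rmorphXn.
Qed.

(* The statement about alpha in terms of M = |m| and l = sgn(m) k. *)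
Definition alpha_spec (p : int) (n M : nat) (l : int) (a : quad p) :=
  let zc := [\/ M = 1%N /\ (n%:Z %| l)%Z, M = 1%N /\ (n%:Z %| l - 1)%Z
              | M = 2 /\ (n%:Z %| l - 1)%Z] in
  [/\ quad_norm a <> 0, quad_norm a = 1 -> zc, zc -> quad_norm a = 1,
      ~ (n%:Z %| M%:Z - 2 * l)%Z -> primitive a &
      (n%:Z %| M%:Z - 2 * l)%Z -> integral_up_to_unit a].

Lemma eps4_mod i j : i = j %[mod 4] -> eps 0 ^+ i = eps 0 ^+ j.
Proof. by move=> ij; rewrite -(expr_mod i (_ : eps 0 ^+ 4 = 1)) // ij expr_mod. Qed.

Lemma eps6_mod i j : i = j %[mod 6] -> eps 1 ^+ i = eps 1 ^+ j.
Proof. by move=> ij; rewrite -(expr_mod i (_ : eps 1 ^+ 6 = 1)) // ij expr_mod. Qed.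

Lemma alpha_spec_unit p n M l (a u v : quad p) : u * v = 1 -> quad_norm u = 1 ->
  alpha_spec n M l a -> alpha_spec n M l (u * a).
Proof.
move=> uv u1 [N0 N1 N1' P I].
rewrite /alpha_spec quad_normM u1 mul1r; split=> // h.
  exact: primitive_unit uv (P h).
exact: integral_unit uv (I h).
Qed.

Lemma alpha_spec_pair p n M l (x y : int) :
  let N := x ^+ 2 + p * x * y + y ^+ 2 in
  let zc := [\/ M = 1%N /\ (n%:Z %| l)%Z, M = 1%N /\ (n%:Z %| l - 1)%Z
              | M = 2 /\ (n%:Z %| l - 1)%Z] in
  N <> 0 -> (N = 1 -> zc) -> (zc -> N = 1) ->
  (~ (n%:Z %| M%:Z - 2 * l)%Z -> coprimez y (x + p * y)) ->
  ((n%:Z %| M%:Z - 2 * l)%Z -> y = 0) ->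
  alpha_spec n M l ((x, y) : quad p).
Proof.
move=> N zc N0 N1 N1' C y0; split=> // h; first exact/coprime_primitive/C.
exact/integral_int/y0.
Qed.

Lemma alpha4_spec M kap l : (0 < M)%N -> (4%:Z %| kap%:Z - l)%Z ->
  alpha_spec 4 M l ((1 + eps 0) ^+ M - eps 0 ^+ kap).
Proof.
move=> M0 kapl.
have [q Mq] : exists q, M = (2 * q)%N \/ M = (2 * q + 1)%N.
  by exists (M./2); move: (odd_double_half M); case: (odd M); lia.
(* This is kap - q modulo 4: removing the unit e^q leaves 2^q - e^s for even M and 2^q (1 + e) - e^s
   for odd M. *)
pose s := ((kap + 3 * q) %% 4)%N.
have kE : eps 0 ^+ kap = eps 0 ^+ q * eps 0 ^+ s.
  by rewrite -exprD; apply: eps4_mod; rewrite /s; lia.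
have uv : eps 0 ^+ q * eps 0 ^+ (3 * q) = 1.
  by rewrite -exprD (@eps4_mod _ 0) //; lia.
have u1 : quad_norm (eps 0 ^+ q) = 1 by rewrite quad_normX expr1n.
pose Q : int := 2 ^+ q.
have Q1 : (1 <= Q)%R by rewrite /Q -natrX; lia.
have s4 : (s < 4)%N by rewrite ltn_mod.
have sE : (4%:Z %| s%:Z - l + q%:Z)%Z by rewrite /s; lia.
have Q12 : Q = 1 -> q = 0%N.
  by rewrite /Q; case: q {Mq s kE uv u1 Q Q1 s4 sE} => // q; rewrite exprS; lia.
have Q22 : Q = 2 -> q = 1%N.
  rewrite /Q; case: q {Mq s kE uv u1 Q Q1 s4 sE Q12} => [|[|q]] //.
  by rewrite !exprS; lia.
have Q01 : q = 0%N -> Q = 1 by rewrite /Q => ->.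
have Q11 : q = 1%N -> Q = 2 by rewrite /Q => ->.
have Q2 : (0 < q)%N -> (2 <= Q)%R by move=> q0; have : Q <> 1; [move/Q12; lia|lia].
have epsE : [/\ eps 0 ^+ 0 = (1, 0) :> quad 0, eps 0 ^+ 1 = (0, 1) :> quad 0,
    eps 0 ^+ 2 = (-1, 0) :> quad 0 & eps 0 ^+ 3 = (0, -1) :> quad 0] by [].
have [e0 e1 e2 e3] := epsE.
have subE (x y x' y' : int) : (x, y) - (x', y') = (x - x', y - y') :> quad 0 by [].
case: Mq => Mq.
- have q0 : (0 < q)%N by lia.
  have {}Q2 := Q2 q0.
  rewrite Mq gam4_X kE [_ * eps 0 ^+ q]mulrC -mulrBr -Mq.
  apply: (alpha_spec_unit uv u1); rewrite -/Q quad_int.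
  (* Each value of s gives five goals: non-zero norm, the two directions of the norm-one criterion,
     coprime coordinates, and vanishing second coordinate. *)
  move: s s4 sE {kE} => [|[|[|[|//]]]] _ sE; rewrite ?(e0, e1, e2, e3) subE;
    apply: alpha_spec_pair.
  + nia.
  + move=> N1; have /Q22 q1 : Q = 2 by nia.
    by apply: Or33; split; lia.
  + move=> zc; have q1 : q = 1%N by case: zc => -[? ?]; lia.
    by rewrite (Q11 q1).
  + lia.
  + by [].
  + nia.
  + nia.
  + case=> -[M1 d]; lia.
  + by move=> _; rewrite coprimezE coprime1n.
  + lia.
  + nia.
  + nia.
  + case=> -[M1 d]; lia.
  + lia.
  + by [].
  + nia.
  + nia.
  + case=> -[M1 d]; lia.
  + by move=> _; rewrite coprimezE coprime1n.
  + lia.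
(* For odd M the number M - 2l is odd, so the integral case never occurs. *)
- have q1_M : q = 0%N -> M = 1%N by lia.
  have coQ (z : int) : (z = Q + 1 \/ z = Q - 1) -> coprimez Q z /\ coprimez z Q.
    move=> zQ; have cz : coprimez Q z.
      by apply/coprimezP; case: zQ => ->; [exists (-1, 1)|exists (1, -1)]; rewrite /=; ring.
    by rewrite cz coprimez_sym.
  rewrite Mq exprD expr1 gam4_X kE [_ * eps 0 ^+ q]mulrC -mulrA -mulrBr -Mq.
  apply: (alpha_spec_unit uv u1); rewrite -/Q quad_int.
  have -> : ((Q, 0) : quad 0) * (1 + eps 0) = (Q, Q) by congr pair; rewrite /=; ring.
  move: s s4 sE {kE} => [|[|[|[|//]]]] _ sE; rewrite ?(e0, e1, e2, e3) subE;
    apply: alpha_spec_pair.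
  + nia.
  + move=> N1; have /Q12 q0 : Q = 1 by nia.
    by apply: Or31; split; lia.
  + move=> zc; have q0 : q = 0%N by case: zc => -[? ?]; lia.
    by rewrite (Q01 q0).
  + by move=> _; rewrite mul0r addr0 subr0; apply: (coQ _ _).1; right.
  + lia.
  + nia.
  + move=> N1; have /Q12 q0 : Q = 1 by nia.
    by apply: Or32; split; lia.
  + move=> zc; have q0 : q = 0%N by case: zc => -[? ?]; lia.
    by rewrite (Q01 q0).
  + by move=> _; rewrite mul0r addr0 subr0; apply: (coQ _ _).2; right.
  + lia.
  + nia.
  + nia.
  + case=> -[M1 d]; lia.
  + by move=> _; rewrite mul0r addr0 subr0 opprK; apply: (coQ _ _).1; left.
  + lia.
  + nia.
  + nia.
  + case=> -[M1 d]; lia.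
  + by move=> _; rewrite mul0r addr0 subr0 opprK; apply: (coQ _ _).2; left.
  + lia.
Qed.

Lemma alpha6_spec M kap l : (0 < M)%N -> (6%:Z %| kap%:Z + l)%Z ->
  alpha_spec 6 M l ((1 + eps 1) ^+ M - (2 * eps 1) ^+ M * eps 1 ^+ kap).
Proof.
move=> M0 kapl.
have [q Mq] : exists q, M = (2 * q)%N \/ M = (2 * q + 1)%N.
  by exists (M./2); move: (odd_double_half M); case: (odd M); lia.
have uv : eps 1 ^+ q * eps 1 ^+ (5 * q) = 1.
  by rewrite -exprD (@eps6_mod _ 0) //; lia.
have u1 : quad_norm (eps 1 ^+ q) = 1 by rewrite quad_normX expr1n.
pose a : int := 4 ^+ q; pose b : int := 3 ^+ q.
have ab1 : q = 0%N -> a = 1 /\ b = 1 by rewrite /a /b => ->.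
have ab4 : q = 1%N -> a = 4 /\ b = 3 by rewrite /a /b => ->.
have [b1 ba b3 ba1] : [/\ 1 <= b, b <= a, (0 < q)%N -> 3 <= b /\ b < a
    & a = b + 1 -> q = 1%N].
  rewrite /a /b; elim: q {Mq uv u1 a b ab1 ab4} => [|q [b1 ba b3 ba1]]; first by split; lia.
  rewrite !exprS; split; [lia|lia|move=> _; split; lia|].
  by case: (posnP q) b3 ba1 => [-> //|q0] /(_ isT) [b3 ba2] _; lia.
(* Coprimality of 3^q and 2 * 4^q supplies the certificates below; the oddness of b deals with an
   extra factor 2. *)
have [[u v] /= uvE] : exists uv : int * int, uv.1 * b + uv.2 * (2 * a) = 1.
  apply/coprimezP; rewrite /a /b coprimezMr coprimezXl //=.
  by rewrite coprimezXl // coprimezXr.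
have [w wE] : exists w, b = 2 * w + 1.
  rewrite /b; elim: (q) => [|i [w wE]]; first by exists 0.
  by exists (3 * w + 1); rewrite exprS wE; ring.
have [e0 e1 e2 [e3 e4 e5]] : [/\ eps 1 ^+ 0 = (1, 0) :> quad 1,
    eps 1 ^+ 1 = (0, 1) :> quad 1, eps 1 ^+ 2 = (-1, 1) :> quad 1 &
    [/\ eps 1 ^+ 3 = (-1, 0) :> quad 1, eps 1 ^+ 4 = (0, -1) :> quad 1 &
    eps 1 ^+ 5 = (1, -1) :> quad 1]] by [].
have subE (x y x' y' : int) : (x, y) - (x', y') = (x - x', y - y') :> quad 1 by [].
have intM (z x y : int) : ((z, 0) : quad 1) * ((x, y) : quad 1) = (z * x, z * y).
  by rewrite quad_mulE; congr pair; rewrite /=; ring.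
case: Mq => Mq.
(* Removing the unit e^q leaves 3^q - 4^q e^s. *)
- pose s := ((q + kap) %% 6)%N.
  have sE : (6%:Z %| s%:Z + l - q%:Z)%Z by rewrite /s; lia.
  have s6 : (s < 6)%N by rewrite ltn_mod.
  have q0 : (0 < q)%N by lia.
  have {}b3 := b3 q0.
  have -> : (1 + eps 1) ^+ M - (2 * eps 1) ^+ M * eps 1 ^+ kap =
      eps 1 ^+ q * (b%:~R - a%:~R * eps 1 ^+ s).
    have E : eps 1 ^+ (2 * q) * eps 1 ^+ kap = eps 1 ^+ q * eps 1 ^+ s.
      by rewrite -!exprD; apply: eps6_mod; rewrite /s; lia.
    rewrite Mq gam6_X del6_X -/a -/b.
    have -> : a%:~R * eps 1 ^+ (2 * q) * eps 1 ^+ kap =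
        a%:~R * (eps 1 ^+ (2 * q) * eps 1 ^+ kap) by ring.
    by rewrite E; ring.
  apply: (alpha_spec_unit uv u1); rewrite !quad_int.
  move: s s6 sE => [|[|[|[|[|[|//]]]]]] _ sE;
    rewrite ?(e0, e1, e2, e3, e4, e5) intM subE; apply: alpha_spec_pair.
  + nia.
  + move=> N1; have /ba1 q1 : a = b + 1 by nia.
    by apply: Or33; split; lia.
  + move=> zc; have q1 : q = 1%N by case: zc => -[? ?]; lia.
    by have [-> ->] := ab4 q1.
  + lia.
  + lia.
  + nia.
  + nia.
  + case=> -[M1 d]; lia.
  + by move=> _; apply/coprimezP; exists (- u - 2 * v, u); rewrite -[RHS]uvE /=; ring.
  + lia.
  + nia.
  + nia.
  + case=> -[M1 d]; lia.
  + by move=> _; apply/coprimezP; exists (- 2 * v, u); rewrite -[RHS]uvE /=; ring.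
  + lia.
  + nia.
  + nia.
  + case=> -[M1 d]; lia.
  + lia.
  + lia.
  + nia.
  + nia.
  + case=> -[M1 d]; lia.
  + by move=> _; apply/coprimezP; exists (2 * v - u, u); rewrite -[RHS]uvE /=; ring.
  + lia.
  + nia.
  + nia.
  + case=> -[M1 d]; lia.
  + by move=> _; apply/coprimezP; exists (2 * v, u); rewrite -[RHS]uvE /=; ring.
  + lia.
(* Removing the unit e^q leaves 3^q (1 + e) - 2 * 4^q e^s; the extra 1 in s comes from the odd
   factor 2e. *)
- pose s := ((q + kap + 1) %% 6)%N.
  have sE : (6%:Z %| s%:Z + l - q%:Z - 1)%Z by rewrite /s; lia.
  have s6 : (s < 6)%N by rewrite ltn_mod.
  have -> : (1 + eps 1) ^+ M - (2 * eps 1) ^+ M * eps 1 ^+ kap =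
      eps 1 ^+ q * (b%:~R * (1 + eps 1) - (2 * a)%:~R * eps 1 ^+ s).
    have E : eps 1 ^+ (2 * q) * eps 1 * eps 1 ^+ kap = eps 1 ^+ q * eps 1 ^+ s.
      by rewrite -exprSr -!exprD; apply: eps6_mod; rewrite /s; lia.
    rewrite Mq !(exprD _ (2 * q) 1) !expr1 gam6_X del6_X -/a -/b intrM.
    have -> : a%:~R * eps 1 ^+ (2 * q) * (2 * eps 1) * eps 1 ^+ kap =
        2 * a%:~R * (eps 1 ^+ (2 * q) * eps 1 * eps 1 ^+ kap) by ring.
    by rewrite E; ring.
  apply: (alpha_spec_unit uv u1); rewrite !quad_int.
  have -> : ((b, 0) : quad 1) * (1 + eps 1) = (b, b) by rewrite intM !mulr1.
  have b3' : (0 < q)%N -> 3 <= b by case/b3.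
  have q0N : b < 3 -> q = 0%N by move=> ?; case: (posnP q) => // /b3'; lia.
  have [a2 b2 ab b9] : [/\ 1 <= a ^+ 2, 1 <= b ^+ 2, 1 <= a * b & 3 <= b -> 9 <= b ^+ 2].
    by split; nia.
  have [n1 n1'] : 3 * b ^+ 2 - 6 * (a * b) + 4 * a ^+ 2 <> 0 /\
      (3 * b ^+ 2 - 6 * (a * b) + 4 * a ^+ 2 = 1 -> b < 3).
    (* Completing the square bounds four times the norm below by 3 b^2, so norm 1 forces b < 3, that
       is q = 0. *)
    have := sqr_ge0 (4 * a - 3 * b); have -> : (4 * a - 3 * b) ^+ 2 =
      4 * (3 * b ^+ 2 - 6 * (a * b) + 4 * a ^+ 2) - 3 * b ^+ 2 by ring.
    by split; lia.
  move: s s6 sE => [|[|[|[|[|[|//]]]]]] _ sE;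
    rewrite ?(e0, e1, e2, e3, e4, e5) intM subE; apply: alpha_spec_pair.
  + by rewrite (_ : _ + _ + _ = 3 * b ^+ 2 - 6 * (a * b) + 4 * a ^+ 2) //; ring.
  + rewrite (_ : _ + _ + _ = 3 * b ^+ 2 - 6 * (a * b) + 4 * a ^+ 2); [move/n1'/q0N=> q0|ring].
    by apply: Or32; split; lia.
  + move=> zc; have q0 : q = 0%N by case: zc => -[? ?]; lia.
    by have [-> ->] := ab1 q0.
  + by move=> _; apply/coprimezP; exists (u + 2 * v, - v); rewrite -[RHS]uvE /=; ring.
  + lia.
  + by rewrite (_ : _ + _ + _ = 3 * b ^+ 2 - 6 * (a * b) + 4 * a ^+ 2) //; ring.
  + rewrite (_ : _ + _ + _ = 3 * b ^+ 2 - 6 * (a * b) + 4 * a ^+ 2); [move/n1'/q0N=> q0|ring].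
    by apply: Or31; split; lia.
  + move=> zc; have q0 : q = 0%N by case: zc => -[? ?]; lia.
    by have [-> ->] := ab1 q0.
  + by move=> _; apply/coprimezP; exists (- u - 2 * v, u + v); rewrite -[RHS]uvE /=; ring.
  + lia.
  + rewrite (_ : _ + _ + _ = 3 * b ^+ 2 + 4 * a ^+ 2); [lia|ring].
  + rewrite (_ : _ + _ + _ = 3 * b ^+ 2 + 4 * a ^+ 2); [lia|ring].
  + case=> -[M1 d]; lia.
  + move=> _; have -> : b - 2 * a * -1 + 1 * (b - 2 * a * 1) = 2 * b by ring.
    rewrite coprimezMr; apply/andP; split; apply/coprimezP.
      by exists (1, a - w); rewrite /= wE; ring.
    by exists (- v, u + v); rewrite -[RHS]uvE /=; ring.
  + lia.
  + rewrite (_ : _ + _ + _ = 3 * b ^+ 2 + 6 * (a * b) + 4 * a ^+ 2); [lia|ring].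
  + rewrite (_ : _ + _ + _ = 3 * b ^+ 2 + 6 * (a * b) + 4 * a ^+ 2); [lia|ring].
  + case=> -[M1 d]; lia.
  + by move=> _; apply/coprimezP; exists (u - 2 * v, v); rewrite -[RHS]uvE /=; ring.
  + lia.
  + rewrite (_ : _ + _ + _ = 3 * b ^+ 2 + 6 * (a * b) + 4 * a ^+ 2); [lia|ring].
  + rewrite (_ : _ + _ + _ = 3 * b ^+ 2 + 6 * (a * b) + 4 * a ^+ 2); [lia|ring].
  + case=> -[M1 d]; lia.
  + by move=> _; apply/coprimezP; exists (2 * v - u, u - v); rewrite -[RHS]uvE /=; ring.
  + lia.
  + rewrite (_ : _ + _ + _ = 3 * b ^+ 2 + 4 * a ^+ 2); [lia|ring].
  + rewrite (_ : _ + _ + _ = 3 * b ^+ 2 + 4 * a ^+ 2); [lia|ring].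
  + case=> -[M1 d]; lia.
  + move=> _; have -> : b - 2 * a * 1 + 1 * (b - 2 * a * -1) = 2 * b by ring.
    rewrite coprimezMr; apply/andP; split; apply/coprimezP.
      by exists (1, - a - w); rewrite /= wE; ring.
    by exists (v, u - v); rewrite -[RHS]uvE /=; ring.
  + lia.
Qed.

Local Close Scope ring_scope.

(** * The groups J_n(m,k) with m and k coprime *)

Local Open Scope quotient_scope.

(** The quotient has to be a non-zero ring, so c must not be a unit. *)
Lemma ring_ideal_quot (R : comNzRingType) (c : R) : (forall d, c * d <> 1)%R ->
  exists (S : comNzRingType) (f : {rmorphism R -> S}),
    f c = 0%R /\ forall a, f a = 0%R -> exists d, a = (c * d)%R.
Proof.
move=> c1; pose I0 : R -> bool := fun a => `[< exists d, a = (c * d)%R >].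
have Icl : idealr_closed (I0 : {pred R}).
  split; first by apply/asboolP; exists 0%R; rewrite mulr0.
    by apply/asboolP=> -[d /esym]; exact: c1.
  move=> a u v /asboolP[d ->] /asboolP[d' ->]; apply/asboolP.
  by exists (a * d + d')%R; ring.
pose I : idealr R := HB.pack I0 (isIdealr.Build R I0 Icl).
have piE a : (\pi_({ideal_quot I}) a == 0 :> {ideal_quot I})%R = (a \in I).
  by rewrite -[a in RHS]subr0 Quotient.idealrBE rmorph0.
exists {ideal_quot I}, \pi_({ideal_quot I}); split.
  by apply/eqP; rewrite piE; apply/asboolP; exists 1%R; rewrite mulr1.
by move=> a /eqP; rewrite piE => /asboolP.
Qed.

Lemma finite_set_onto (T : finType) (U : Type) (f : T -> U) (A : set U) :
  (forall u, A u -> exists x, u = f x) -> finite_set A.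
Proof.
move=> fA; apply: (@sub_finite_set _ _ (f @` [set: T])%classic).
  by move=> u /fA[x ->]; exists x.
exact/finite_image/finite_finset.
Qed.

Lemma commute_mulgACA (G : groupType) (a b c d : G) :
  commute b c -> a * b * (c * d) = a * c * (b * d).
Proof. by move=> bc; rewrite !mulgA -(mulgA a b) bc !mulgA. Qed.

Lemma inj_surj_bij (T U : Type) (f : T -> U) :
  injective f -> (forall u, exists x, f x = u) -> bijective f.
Proof.
move=> finj /choice[g gK]; exists g => // x.
by apply: finj; rewrite gK.
Qed.

Lemma isomorphic_sym (G H : groupType) : isomorphic G H -> isomorphic H G.
Proof.
case=> f fbij; have [g fK gK] := fbij.
pose F : {multiplicative H -> G} :=
  HB.pack g (isMultiplicative.Build H G g (can2_gmulfM fK gK)).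
by exists F; exists f.
Qed.

(** * Elementwise criteria for subgroups and quotients *)

Section SubgroupLemmas.
Variables (G : groupType) (H : groupClosed G).
Implicit Types x : subgroup H.

Lemma subgroup_zexp x i : val (zexp x i) = zexp (val x) i.
Proof. exact: (hom_zexp (val : {multiplicative subgroup H -> G})). Qed.

Lemma trivial_subgroupP : trivial_group (subgroup H) <-> forall g, g \in H -> g = 1.
Proof.
split=> [H1 g gH|H1 x]; last by apply: val_inj; rewrite /= (H1 _ (valP x)).
by have /(congr1 val) := H1 (exist _ g gH : subgroup H).
Qed.

Lemma cyclic_subgroupP : cyclic_group (subgroup H) <->
  exists2 g, g \in H & forall h, h \in H -> exists i, h = zexp g i.
Proof.
split=> [[x xH]|[g gH gE]].
  exists (val x) => [|h hH]; first exact: valP.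
  have [i E] := xH (exist _ h hH : subgroup H); exists i.
  by rewrite -subgroup_zexp -E.
exists (exist _ g gH : subgroup H) => x; have [i E] := gE _ (valP x).
by exists i; apply: val_inj; rewrite subgroup_zexp.
Qed.

Lemma abelian_subgroupP : abelian_group (subgroup H) <->
  {in H &, forall g h, commute g h}.
Proof.
split=> [cH g h gH hH|cH x z]; last by apply: val_inj; exact: cH (valP x) (valP z).
exact: (congr1 val (cH (exist _ g gH : subgroup H) (exist _ h hH : subgroup H))).
Qed.
End SubgroupLemmas.

Lemma cyclic_quotient (G : groupType) (N : normalClosed G) (g : G) :
  (forall h, exists i, h * zexp g i \in N) -> cyclic_group (quotient N).
Proof.
move=> gE; exists (quot_proj N g) => x; rewrite -(quot_reprK x).
have [i hN] := gE (repr x)^-1; exists i.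
rewrite -(hom_zexp (quot_proj N : {multiplicative _ -> _})).
exact/quot_projP.
Qed.

Lemma der1_sub_cyclic_quotient (G : groupType) (N : normalClosed G) :
  cyclic_group (quotient N) -> {subset der G 1 <= N}.
Proof.
case=> q qE; pose pr : {multiplicative G -> quotient N} := quot_proj N.
apply: derived_sub => x z _ _; apply/quot_proj_eq1; rewrite -[LHS]/(pr _) homR.
apply/eqP/commgP; have [i ->] := qE (pr x); have [j ->] := qE (pr z).
exact: zexp_commute.
Qed.

Lemma der2_trivial (G : groupType) : {in der G 1 &, forall g h, commute g h} ->
  forall g, g \in der G 2 -> g = 1.
Proof.
move=> c1 g; have PF (u v : G) : u = 1 -> v = 1 -> u / v = 1 by move=> -> ->; rewrite divgg.
move=> gd; apply/(pred_subgroupP (P := fun u => u = 1) erefl PF).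
move: g gd; apply: derived_sub => u v u1 v1; apply/pred_subgroupP.
exact/eqP/commgP/c1.
Qed.

Lemma eqmod0E (d z : int) : (z = 0 %[mod d])%Z = (d %| z)%Z :> Prop.
Proof. by apply/propext; rewrite mod0z; split=> /dvdz_mod0P. Qed.

(** Each divisibility forces M to divide 1, or 2 in the third case; there M = 1 is impossible since
    n is even and 2l would be odd. *)
Lemma zero_cond_pos (n : nat) (M l : int) : n = 4 \/ n = 6 -> (0 < M)%R ->
  coprimez M l ->
  [\/ ((n%:Z * M)%R %| l)%Z, ((n%:Z * M)%R %| (M - l)%R)%Z
    | ((n%:Z * M)%R %| (M - 2 * l)%R)%Z] <->
  [\/ M = 1%R /\ (n%:Z %| l)%Z, M = 1%R /\ (n%:Z %| (l - 1)%R)%Z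
    | M = 2%R /\ (n%:Z %| (l - 1)%R)%Z].
Proof.
move=> hn M0 /coprimezP[[u v] /= uv].
have unit_M w : (M * w = 1)%R -> M = 1%R.
  by move=> E; have w0 : (0 < w)%R; [nia|nia].
split.
- case=> /dvdzP[q qE].
  + have M1 : M = 1%R by apply: (unit_M (u + v * q * n%:Z)%R); rewrite -[RHS]uv qE; ring.
    by apply: Or31; split=> //; apply/dvdzP; exists q; rewrite qE M1 mulr1.
  + have lE : l = (M * (1 - q * n%:Z))%R by rewrite -[LHS](subKr M) qE; ring.
    have M1 : M = 1%R.
      by apply: (unit_M (u + v * (1 - q * n%:Z))%R); rewrite -[RHS]uv lE; ring.
    by apply: Or32; split=> //; apply/dvdzP; exists (- q)%R; rewrite lE M1; ring.
  + have lE : (2 * l = M * (1 - q * n%:Z))%R.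
      by rewrite -[LHS](subKr M) qE; ring.
    have M2 : (M * (2 * u + v * (1 - q * n%:Z)) = 2)%R.
      transitivity (2 * (u * M + v * l))%R; last by rewrite uv.
      have -> : (2 * (u * M + v * l) = 2 * u * M + v * (2 * l))%R by ring.
      by rewrite lE; ring.
    have M12 : M = 1%R \/ M = 2%R.
      by move: M2; set w := (_ + _)%R => M2; have w0 : (0 < w)%R; [nia|nia].
    case: M12 => M1; rewrite M1 in lE; first by exfalso; case: hn lE => ->; lia.
    apply: Or33; split=> //; apply/dvdzP; exists (- q)%R.
    by apply: (@mulfI int 2%R) => //; rewrite mulrBr lE; ring.
- case=> -[-> d]; rewrite ?mulr1.
  + exact: Or31.
  + by apply: Or32; case/dvdzP: d => q E; apply/dvdzP; exists (- q)%R; rewrite mulNr -E opprB.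
  + apply: Or33; have -> : (2 - 2 * l = (l - 1) * - 2)%R by ring.
    have -> : (n%:Z * 2 = n%:Z * 2%:Z)%R by [].
    by case/dvdzP: d => q ->; apply/dvdzP; exists (- q)%R; ring.
Qed.

Opaque Jgroup.

Section CoprimeJ.
Variables (n : nat) (m k : int).
Hypotheses (hn : n = 4 \/ n = 6) (hm : m <> 0%R) (hmk : coprimez m k).
Local Notation J := (Jgroup n m k).
Local Notation t := (Jt n m k).
Local Notation y := (Jy n m k).
Local Notation R := (quad (pn n)).
Local Notation e := (eps (pn n)).
Local Notation alpha := (alpha n m k).
Local Notation tauJ := (tau n m t y).
Local Notation rotJ := (rot n m y).
Local Notation muJ := (mu (p := pn n) tauJ rotJ).

Let rel := J_rel n m k.
Let tn := Jt_n n m k.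
Let tau_comm : commute tauJ (tauJ ^ rotJ^-1).
Proof. by have [] := rot_facts hn tn rel. Qed.

Lemma alphaJ_spec : alpha_spec n `|m|%N (sgz m * k)%R alpha.
Proof.
have m0 : (0 < `|m|)%N by rewrite absz_gt0; apply/eqP.
have kapE : (n%:Z %| ((kap n m k)%:Z + sg n * (sgz m * k))%R)%Z.
  rewrite /kap gez0_abs; last by apply: modz_ge0; case: hn => ->.
  have -> : (- sg n * sgz m * k = - (sg n * (sgz m * k)))%R by ring.
  by move: (sg n * _)%R => w; case: hn => ->; lia.
rewrite /alpha /gam /del; move: kapE; rewrite /sg; case: hn => -> /= kapE.
  by rewrite expr1n mul1r; apply: alpha4_spec => //; move: kapE; rewrite mulN1r.
by apply: alpha6_spec => //; move: kapE; rewrite mul1r.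
Qed.

Lemma muJ_eq1 a : muJ a = 1 <-> exists d, a = (alpha * d)%R.
Proof.
split=> [a1|[d ->]]; last first.
  by have := mu_alpha hn tn rel d.
(* If alpha is a unit there is no non-zero quotient ring to act on, but then every a is a multiple
   of alpha. *)
have [[d d1]|nu] := pselect (exists d, alpha * d = 1)%R.
  by exists (d * a)%R; rewrite mulrA d1 mul1r.
have [|S [f [fa fI]]] := @ring_ideal_quot _ alpha; first by move=> d d1; apply: nu; exists d.
have [F FE] := affine_action hn hm hmk fa.
by apply: fI; have := FE a 0%R; rewrite a1 hom1 add0r => <-.
Qed.

Lemma muJ_trivial : (forall g, g \in der J 1 -> g = 1) <-> quad_norm alpha = 1%R.
Proof.
split=> [d1|N1].
  have /muJ_eq1[d /(congr1 (@quad_norm _))] : muJ 1%R = 1.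
    exact/d1/mem_mu_der.
  rewrite quad_normM (_ : quad_norm 1 = 1)%R; last by case: hn => ->.
  have norm_ge0 c : (0 <= quad_norm (c : R))%R.
    rewrite /quad_norm; move: c.1 c.2 => x z; case: hn => -> /=.
      by rewrite mul0r mul0r addr0 addr_ge0 ?sqr_ge0.
    by have := sqr_ge0 (2 * x + z)%R; have := sqr_ge0 z; rewrite !expr2 -[pn 6]/(1%R) mul1r; nia.
  have := norm_ge0 alpha; have := norm_ge0 d.
  move: (quad_norm alpha) (quad_norm d) => u v v0 u0 uv.
  by have [u1 v1] : (0 < u)%R /\ (0 < v)%R; [split; nia|nia].
move=> g /(der_muP hn hm hmk)[a ->]; apply/muJ_eq1.
exists (quad_conj alpha * a)%R; rewrite mulrA quad_mul_conj N1.
by rewrite -[X in (X * _)%R]/(1%R : R) mul1r.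
Qed.

Lemma zero_condE :
  [\/ (k = 0 %[mod n%:Z * m])%Z, (m - k = 0 %[mod n%:Z * m])%Z
    | (m - 2 * k = 0 %[mod n%:Z * m])%Z] <-> quad_norm alpha = 1%R.
Proof.
have [_ N1 N1' _ _] := alphaJ_spec.
rewrite !eqmod0E; have m0 : m != 0%R by exact/eqP.
case: (ltrP 0 m) => [mp|mn].
  have E : Posz `|m|%N = m by rewrite gtz0_abs.
  have := zero_cond_pos hn mp hmk; rewrite gtr0_sgz // mul1r in N1 N1' *.
  move=> zE; split=> [/zE zc|/N1 zc]; [apply: N1'|apply/zE]; move: zc.
    by case=> -[M1 d]; [apply: Or31|apply: Or32|apply: Or33]; split=> //; lia.
  by case=> -[M1 d]; [apply: Or31|apply: Or32|apply: Or33]; split=> //; lia.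
(* For negative m, pass to (-m, -k): the three divisibilities are insensitive to the sign. *)
have mn' : (m < 0)%R by move: m0 mn; lia.
have mp : (0 < - m)%R by rewrite oppr_gt0.
have hmk' : coprimez (- m) (- k) by rewrite coprimezE !abszN.
have := zero_cond_pos hn mp hmk'; rewrite ltr0_sgz // mulN1r in N1 N1' *.
have -> : (- m - - k = - (m - k))%R by ring.
have -> : (- m - 2 * - k = - (m - 2 * k))%R by ring.
rewrite mulrN !dvdzE !abszN -!dvdzE.
move=> zE; split=> [/zE zc|/N1 zc]; [apply: N1'|apply/zE]; move: zc.
  by case=> -[M1 d]; [apply: Or31|apply: Or32|apply: Or33]; split=> //; lia.
by case=> -[M1 d]; [apply: Or31|apply: Or32|apply: Or33]; split=> //; lia.
Qed.

Lemma Jy_N : zexp y (n%:Z * m) = 1.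
Proof.
have := rot_n hn tn rel; rewrite -zexp_nat -zexpM /sg.
have [n4|n4] := eqVneq n 4; last by rewrite mul1r mulrC.
move=> E; rewrite -[X in zexp _ X]opprK zexpN -mulrN mulrC.
by rewrite -mulN1r E invg1.
Qed.

Lemma Jder1_commute : {in der J 1 &, forall g h, commute g h}.
Proof.
move=> g h /(der_muP hn hm hmk)[a ->] /(der_muP hn hm hmk)[b ->].
exact: muC.
Qed.


Let norm_n0 : quad_norm alpha <> 0%R. Proof. by have [] := alphaJ_spec. Qed.

(** alpha divides its norm, a non-zero integer, so coordinates can be reduced modulo the norm. *)
Lemma Jder1_finite : exists (T : finType) (f : T -> J),
  forall g, g \in der J 1 -> exists x, g = f x.
Proof.
pose P := `|quad_norm alpha|%N.
exists ('I_P * 'I_P)%type, (fun x : 'I_P * 'I_P => muJ (Posz x.1, Posz x.2)).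
move=> g /(der_muP hn hm hmk)[a ->].
have lt_P (z : int) : (`|(z %% quad_norm alpha)%Z| < P)%N.
  have N0 : quad_norm alpha != 0%R by exact/eqP.
  by have := ltz_mod z N0; have := modz_ge0 z N0; rewrite /P; lia.
exists (Ordinal (lt_P a.1), Ordinal (lt_P a.2)) => /=.
have N0 : quad_norm alpha != 0%R by exact/eqP.
rewrite !gez0_abs ?modz_ge0 //.
pose q : R := ((a.1 %/ quad_norm alpha)%Z, (a.2 %/ quad_norm alpha)%Z).
pose r : R := ((a.1 %% quad_norm alpha)%Z, (a.2 %% quad_norm alpha)%Z).
have aE : a = ((quad_norm alpha)%:~R * q + r)%R.
  rewrite quad_int quad_mulE /=.
  rewrite [LHS]surjective_pairing; congr pair.
    by rewrite [LHS](divz_eq a.1 (quad_norm alpha)) /=; ring.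
  by rewrite [LHS](divz_eq a.2 (quad_norm alpha)) /=; ring.
rewrite -/r aE muD //; set b := (_ * _)%R; have -> : muJ b = 1; last by rewrite mul1g.
apply/muJ_eq1; rewrite /b quad_int -quad_mul_conj -mulrA; by eexists.
Qed.

Lemma J_der_y g : exists h i, h \in der J 1 /\ g = h * zexp y i.
Proof.
have [a [i ->]] := muz_elim hn hm tn rel hmk (@J_ind n m k) g.
by exists (muJ a), i; split=> //; exact: mem_mu_der.
Qed.

Lemma J_finite : finite_group J.
Proof.
have [T [f fE]] := Jder1_finite.
have n0 : (n%:Z * m)%R != 0%R by apply/eqP; case: hn => ->; lia.
apply: (@finite_set_onto (T * 'I_`|(n%:Z * m)%R|)%type _ (fun x => f x.1 * zexp y x.2)).
move=> g _; have [h [i [hd ->]]] := J_der_y g; have [x ->] := fE _ hd.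
have lt : (`|(i %% (n%:Z * m))%Z| < `|(n%:Z * m)%R|)%N.
  by have := ltz_mod i n0; have := modz_ge0 i n0; lia.
exists (x, Ordinal lt); rewrite /= -zexp_nat gez0_abs ?modz_ge0 //.
by rewrite -(zexp_modz i Jy_N).
Qed.

Let cond_abs : (m - 2 * k = 0 %[mod n%:Z])%Z
  = ((n%:Z %| (`|m|%:Z - 2 * (sgz m * k))%R)%Z : Prop).
Proof.
rewrite eqmod0E; case: (ltrP 0 m) => [mp|mn].
  by rewrite gtr0_sgz // mul1r gtz0_abs.
have mn' : (m < 0)%R by move: mn hm; lia.
rewrite ltr0_sgz // ltz0_abs //.
have -> : (- m - 2 * (-1 * k) = - (m - 2 * k))%R by ring.
by rewrite [in RHS]dvdzE abszN -dvdzE.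
Qed.

(** Modulo alpha, e is an integer i, so the rotated translation is tau^i and tau alone generates
    J'. *)
Lemma Jder1_cyclic : ~ (m - 2 * k = 0 %[mod n%:Z])%Z ->
  exists2 g, g \in der J 1 & forall h, h \in der J 1 -> exists i, h = zexp g i.
Proof.
have [_ _ _ prim _] := alphaJ_spec.
rewrite cond_abs => /prim[i [c E]].
exists tauJ; first exact: Jtau_der.
have eE : tauJ ^ rotJ^-1 = zexp tauJ i.
  rewrite -(mu_epsE _ _ (pn n)) -[eps _](subrK i%:~R%R) E muD //.
  have -> : muJ (alpha * c)%R = 1 by apply/muJ_eq1; exists c.
  by rewrite mul1g -[(i%:~R)%R]mulr1 (muMz tau_comm) mu1.
move=> h /(der_muP hn hm hmk)[a ->]; exists (a.1 + i * a.2)%R.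
by rewrite /mu eE -zexpM -zexpD.
Qed.

Section Square.
Hypothesis mk : (m - 2 * k = 0 %[mod n%:Z])%Z.

(* Here alpha is an integer P up to a unit, so J' = Z[e] / P. *)
Let alphaP : exists P : int, P <> 0%R /\
  forall a, muJ a = 1 <-> (P %| a.1)%Z /\ (P %| a.2)%Z.
Proof.
have [N0 _ _ _ intg] := alphaJ_spec; move: mk; rewrite cond_abs => /intg.
move=> [P [u [v [uv aE]]]]; exists P; split.
  by move=> P0; apply: N0; rewrite aE P0 mul0r /quad_norm !mulr0.
move=> a; rewrite muJ_eq1; split.
  move=> [d ->]; rewrite aE -mulrA; move: (u * d)%R => w.
  by rewrite quad_int quad_mulE /= mulr0 !mul0r subr0 !addr0; split; exact: dvdz_mulr.
move=> [/dvdzP[q1 E1] /dvdzP[q2 E2]]; exists (v * (q1, q2))%R.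
rewrite aE -mulrA (mulrA u) uv mul1r quad_int quad_mulE /=.
by rewrite [LHS]surjective_pairing E1 E2; congr pair; ring.
Qed.

Lemma Jder1_square : square_of_cyclic (subgroup (der J 1)).
Proof.
have [P [P0 muP]] := alphaP.
have C1 : exists i, 1 = zexp tauJ i by exists 0%R.
have CF x z : (exists i, x = zexp tauJ i) -> (exists i, z = zexp tauJ i) ->
    exists i, x / z = zexp tauJ i.
  by move=> [i ->] [j ->]; exists (i - j)%R; rewrite zexpD zexpN.
pose C : groupType := subgroup (pred_subgroup C1 CF).
have Ccyc : cyclic_group C.
  apply/cyclic_subgroupP; exists tauJ; first by apply/pred_subgroupP; exists 1%R.
  by move=> h /pred_subgroupP.
exists C, C; split=> //.
apply: isomorphic_sym.
pose v (c : C) : J := val c.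
have memC (c : C) : exists i, v c = zexp tauJ i by exact/(pred_subgroupP C1 CF)/(valP c).
have memF (c : C * C) : v c.1 * v c.2 ^ rotJ^-1 \in der J 1.
  have [i ->] := memC c.1; have [j ->] := memC c.2; rewrite zexpJ.
  exact: (mem_mu_der m k hn (i, j)).
(* The two factors are the coordinates along 1 and e in Z[e]/P. *)
pose f (c : C * C) : subgroup (der J 1) := exist (fun x => x \in der J 1) _ (memF c).
have mem1 (c : C) : v c \in der J 1.
  have [i ->] := memC c; apply: gpred_zexp; exact: Jtau_der.
have fM : {morph f : c d / c * d}.
  move=> c d; apply: val_inj => /=.
  have -> : v (c.1 * d.1) = v c.1 * v d.1 by [].
  have -> : v (c.2 * d.2) = v c.2 * v d.2 by [].
  rewrite conjMg; apply: commute_mulgACA.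
  by apply: Jder1_commute; [exact: mem1|exact/gpredNJ/mem1].
pose F : {multiplicative (C * C)%type -> subgroup (der J 1)} :=
  HB.pack f (isMultiplicative.Build _ _ f fM).
have tauP i : zexp tauJ i = 1 <-> (P %| i)%Z.
  have := muP (i, 0%R); rewrite /mu /= mulg1 => ->.
  by split=> [[]|]; rewrite ?dvdz0.
exists F; apply: inj_surj_bij.
  apply: hom_inj => c /(congr1 val) /=; have [i E1] := memC c.1; have [j E2] := memC c.2.
  rewrite E1 E2 zexpJ => /(muP (i, j)) /= [/tauP i1 /tauP j1].
  rewrite [c]surjective_pairing; congr pair; apply: val_inj; rewrite -/(v _).
    by rewrite E1 i1.
  by rewrite E2 j1.
move=> [x xd]; have [a xE] := der_muP hn hm hmk _ xd.
have memtau i : zexp tauJ i \in pred_subgroup C1 CF by apply/pred_subgroupP; exists i.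
pose mkC i : C := exist (fun x => x \in pred_subgroup C1 CF) _ (memtau i).
exists (mkC a.1, mkC a.2).
by apply: val_inj; rewrite /= xE /v /= zexpJ.
Qed.

(* If tau = h^i and its rotation is h^j with coprime i and j, then
   tau^j = (tau^rot)^i, so P divides both i and j. *)
Lemma J_not_metacyclic : (exists2 g, g \in der J 1 & g <> 1) -> ~ metacyclic J.
Proof.
move=> [g gd g1] [C [/cyclic_subgroupP[c cC cE] /der1_sub_cyclic_quotient dC]].
have [P [P0 muP]] := alphaP.
have [i iE] := cE _ (dC _ (Jtau_der m k hn)).
have [j jE] := cE _ (dC _ (gpredNJ _ rotJ^-1 (Jtau_der m k hn))).
have [D [i' [j' [u [v [iD jD uv]]]]]] : exists D i' j' u v : int,
    [/\ i = D * i', j = D * j' & u * i' + v * j' = 1]%R.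
  have [j0|j0] := eqVneq j 0%R.
    by exists i, 1%R, 0%R, 1%R, 0%R; rewrite j0 mulr0 mulr1 mul0r addr0 mulr1.
  have [u [v uvE]] := Bezoutz i j.
  have /dvdzP[i' iE'] := dvdz_gcdl i j; have /dvdzP[j' jE'] := dvdz_gcdr i j.
  have : gcdz i j != 0%R by rewrite gcdz_eq0 negb_and j0 orbT.
  move: (gcdz i j) uvE iE' jE' => D uvE iE' jE' D0.
  exists D, i', j', u, v; split; [by rewrite mulrC|by rewrite mulrC|].
  by apply: (mulIf D0); rewrite mul1r -[RHS]uvE iE' jE'; ring.
have [h [tauE tauE']] : exists h, tauJ = zexp h i' /\ tauJ ^ rotJ^-1 = zexp h j'.
  by exists (zexp c D); rewrite -!zexpM -iD -jD.
have /(muP (j', - i')%R) /= [/dvdzP[r rE] /dvdzP[l lE]] : muJ (j', - i')%R = 1.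
  rewrite /mu tauE' tauE -!zexpM /= -zexpD; have -> : (i' * j' + j' * - i' = 0)%R by ring.
  by [].
have P1 : (P %| 1)%Z.
  apply/dvdzP; exists (v * r - u * l)%R; rewrite -[LHS]uv rE.
  by rewrite -[i']opprK lE; ring.
apply: g1; have [a ->] := der_muP hn hm hmk _ gd; apply/muP.
by split; apply: (dvdz_trans P1); exact: dvd1z.
Qed.
End Square.
End CoprimeJ.

(** * Semidirect products and amalgams *)

Section SemidirectLift.
Variables (H : groupType) (z : H) (N : nat).
Local Notation A := (der H 1).
Hypothesis decH : forall h, exists a i, a \in A /\ h = a * zexp z i.
Hypothesis zN : z ^+ N = 1.
Hypothesis zA : forall i, zexp z i \in A -> (N %| `|i|)%N.

(** The map sends a z^i to th(a) V^i. It is well defined because the exponents of two decompositions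
    of one element differ by a multiple of N. *)
Lemma semidirect_lift (W : groupType) (th : H -> W) (V : W) :
  (forall a b, a \in A -> b \in A -> th (a * b) = th a * th b) -> V ^+ N = 1 ->
  {in A, forall a, th a ^ V = th (a ^ z)} ->
  exists F : {multiplicative H -> W}, {in A, F =1 th} /\ F z = V.
Proof.
move=> thM VN thV.
have mod0 i : (N %| `|i|)%N -> zexp z i = 1 /\ zexp V i = 1.
  move=> /dvdnP[l lE]; have : (N%:Z %| i)%Z by rewrite dvdzE lE dvdn_mull.
  by case/dvdzP=> q ->; rewrite mulrC !zexpM !zexp_nat zN VN !zexp1g.
have thVi i a : a \in A -> th a ^ zexp V i = th (a ^ zexp z i).
  have natE (l : nat) : {in A, forall b, th b ^ (V ^+ l) = th (b ^ (z ^+ l))}.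
    elim: l => [|l IH] b bA; first by rewrite !conjg1.
    by rewrite !expgSr !conjgM IH // thV // gpredNJ.
  move=> aA; case: i => l; first exact: natE.
  by rewrite /= -{1}[a](conjgKV (z ^+ l.+1)) -natE ?gpredNJ // conjgK.
have [sa [si sP]] : exists (sa : H -> H) (si : H -> int),
    forall h, sa h \in A /\ h = sa h * zexp z (si h).
  have /choice[s sP] : forall h, exists x : H * int, x.1 \in A /\ h = x.1 * zexp z x.2.
    by move=> h; have [a [i hE]] := decH h; exists (a, i).
  by exists (fun h => (s h).1), (fun h => (s h).2).
pose f h := th (sa h) * zexp V (si h).
have fE a i : a \in A -> f (a * zexp z i) = th a * zexp V i.
  move=> aA; rewrite /f; have [] := sP (a * zexp z i).
  move: (sa _) (si _) => b j bA E.
  have E' : b^-1 * a = zexp z (j - i).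
    rewrite zexpD zexpN; apply: (mulgI b); apply: (mulIg (zexp z i)).
    by rewrite mulVKg E mulgA mulgVK.
  have [z1 V1] : zexp z (j - i) = 1 /\ zexp V (j - i) = 1.
    by apply/mod0/zA; rewrite -E' gpredM // gpredV.
  move: E'; rewrite z1 => /(congr1 (fun x => b * x)); rewrite mulVKg mulg1 => ->.
  by rewrite -[j](subrK i) zexpD V1 mul1g.
have fM : {morph f : g h / g * h}.
  move=> g h; have [aA gE] := sP g; have [bA hE] := sP h.
  rewrite gE hE; move: (sa g) (si g) (sa h) (si h) aA bA => a i b j aA bA {gE hE}.
have -> : a * zexp z i * (b * zexp z j) = a * b ^ zexp z (- i) * zexp z (i + j).
    by rewrite zexpD zexpN; gword.
  have bA' : b ^ zexp z (- i) \in A by exact: gpredNJ.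
  have abA : a * b ^ zexp z (- i) \in A by exact: gpredM.
  rewrite !fE //; transitivity (th a * th (b ^ zexp z (- i)) * zexp V (i + j)).
    by congr (_ * _); exact: thM.
  by rewrite -thVi // (zexpD V) (zexpN V); gword.
exists (HB.pack f (isMultiplicative.Build _ _ f fM) : {multiplicative H -> W}).
split=> [a aA|] /=; first by rewrite -{1}[a]mulg1 -(zexp0 z) fE // mulg1.
have A1 : 1 \in A by exact: gpred1.
have th1 : th 1 = 1 by apply: (mulgI (th 1)); rewrite -thM // !mulg1.
by have := fE 1 1%R A1; rewrite mul1g !zexp1 => ->; rewrite th1 mul1g.
Qed.
End SemidirectLift.

Lemma iter_morph (G : groupType) (f : {multiplicative G -> G}) l :
  {morph iter l f : x y / x * y}.
Proof. by elim: l => [//|l IH] x y; rewrite !iterS IH homM. Qed.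

(* J is the amalgam of H = A x| <z> and <Y> over z = Y^d, stated through its
   universal property. J' is the free product of the conjugates of A by
   1, Y, ..., Y^(d-1), and the commutator subgroup of this free product acts
   freely on the tree of the amalgam. The quotient graph has a vertex for every
   q in Q = A^d and an edge (q, j) from q to the coset of q modulo the j-th
   factor; J acts on its fundamental groupoid, i.e. on pairs of an element of
   the free group on the edges and a vertex. *)
Section Amalgam.
Variables (H : groupType) (z : H) (N : nat).
Hypothesis cA : {in der H 1 &, forall a b, commute a b}.
Hypothesis decH : forall h, exists a i, a \in der H 1 /\ h = a * zexp z i.
Hypothesis zN : z ^+ N = 1.
Hypothesis zA : forall i, zexp z i \in der H 1 -> (N %| `|i|)%N.
Variables (J : groupType) (iota : {multiplicative H -> J}) (Y : J) (d' : nat).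
Local Notation d := d'.+1.
Hypothesis iz : iota z = Y ^+ d.
Hypothesis UP : forall (W : groupType) (f : {multiplicative H -> W}) (w : W),
  f z = w ^+ d -> exists F : {multiplicative J -> W}, F \o iota =1 f /\ F Y = w.
Hypothesis genJ : forall P : J -> Prop, P 1 ->
  (forall g a, a \in der H 1 -> P g -> P (g * iota a)) ->
  (forall g, P g -> P (g * Y)) -> (forall g, P g -> P (g * Y^-1)) -> forall g, P g.

Local Notation AT := (subgroup (der H 1)).
Implicit Types a b : AT.

Let cAT a b : commute a b.
Proof. by apply: val_inj; exact: cA (valP a) (valP b). Qed.

Definition amal_conj (h : H) a : AT :=
  exist (fun x => x \in der H 1) (val a ^ h) (gpredNJ _ _ (valP a)).

Lemma amal_conjM h a b : amal_conj h (a * b) = amal_conj h a * amal_conj h b.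
Proof. by apply: val_inj; rewrite /= conjMg. Qed.

Lemma amal_conjK h : cancel (amal_conj h) (amal_conj h^-1).
Proof. by move=> a; apply: val_inj; rewrite /= conjgK. Qed.

Lemma amal_conjVK h : cancel (amal_conj h^-1) (amal_conj h).
Proof. by move=> a; apply: val_inj; rewrite /= conjgKV. Qed.

Local Notation Q := {ffun 'I_d -> AT}.
Implicit Types (q : Q) (i j : 'I_d).

Definition delta j a : Q := [ffun i => if i == j then a else 1].

Let cQ q q' : commute q q'.
Proof. by apply/ffunP => i; rewrite !ffunE cAT. Qed.

Lemma deltaM j a b : delta j (a * b) = delta j a * delta j b.
Proof. by apply/ffunP => i; rewrite !ffunE; case: eqP; rewrite ?mulg1. Qed.

Lemma delta1 j : delta j 1 = 1.
Proof. by apply/ffunP => i; rewrite !ffunE; case: eqP. Qed.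

Lemma ordS_eq0 i : (ordS i == ord0) = (i == ord_max).
Proof.
apply/eqP/eqP => [/(congr1 val) /=|->]; last by apply: val_inj; rewrite /= modnn.
have := ltn_ord i; rewrite ltnS leq_eqVlt => /orP[/eqP id _|id]; first exact: val_inj.
by rewrite modn_small.
Qed.

(* The action of Y on vertices: rotate the factors, conjugating by z when
   passing from the last to the first. *)
Definition shift q : Q :=
  [ffun i => if i == ord0 then amal_conj z (q (ord_pred i)) else q (ord_pred i)].
Definition unshift q : Q :=
  [ffun i => if i == ord_max then amal_conj z^-1 (q (ordS i)) else q (ordS i)].

Lemma shiftK : cancel shift unshift.
Proof.
move=> q; apply/ffunP => i; rewrite !ffunE ordS_eq0 ordSK.
by case: eqP => // _; rewrite amal_conjK.
Qed.

Lemma unshiftK : cancel unshift shift.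
Proof.
move=> q; apply/ffunP => i; rewrite !ffunE -ordS_eq0 ord_predK.
by case: eqP => // _; rewrite amal_conjVK.
Qed.

Lemma shiftM q q' : shift (q * q') = shift q * shift q'.
Proof. by apply/ffunP => i; rewrite !ffunE; case: eqP; rewrite ?amal_conjM. Qed.

Lemma shift_delta j a :
  shift (delta j a) = delta (ordS j) (if j == ord_max then amal_conj z a else a).
Proof.
apply/ffunP => i; rewrite !ffunE.
have -> : (ord_pred i == j) = (i == ordS j).
  by apply/eqP/eqP => [<-|->]; rewrite ?ord_predK ?ordSK.
case: (i =P ordS j) => [->|_]; first by rewrite ordS_eq0.
by case: eqP => // _; apply: val_inj; rewrite /= conj1g.
Qed.

(** During at most d rotations an entry crosses the seam at most once, and is conjugated by z
    exactly then. At l = d every entry has crossed, matching z = Y^d. *)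
Lemma iter_shift l q i : l <= d -> iter l shift q i =
  if i < l then amal_conj z (q (inord (i + d - l))) else q (inord (i - l)).
Proof.
elim: l i => [|l IH] i ld /=.
  by rewrite subn0 inord_val.
rewrite ffunE !(IH _ (ltnW ld)).
have [->|i0] := eqVneq i ord0.
  have pE : nat_of_ord (@ord_pred d ord0) = d' by rewrite /= modn_small.
  have -> : (@ord_pred d ord0 < l) = false by rewrite pE ltnNge -ltnS ld.
  by congr (amal_conj z (q _)); congr inord; rewrite pE /=; lia.
have {}i0 : 0 < i by rewrite lt0n; apply: contra i0 => /eqP ?; apply/eqP/val_inj.
have pE : nat_of_ord (ord_pred i) = i.-1.
  by rewrite /= -subn1 addnC -addnBA // subn1 modnDl modn_small //; have := ltn_ord i; lia.
rewrite pE -ltnS prednK //.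
by case: ifP => _; [congr (amal_conj z (q _))|congr (q _)]; congr inord; lia.
Qed.

Lemma iter_shift_d q : iter d shift q = [ffun i => amal_conj z (q i)].
Proof.
apply/ffunP => i; rewrite iter_shift // ltn_ord ffunE.
by congr (amal_conj z (q _)); rewrite addnK inord_val.
Qed.

Lemma iter_shift_dN q : iter (d * N) shift q = q.
Proof.
have E l : iter (d * l) shift q = [ffun i => amal_conj (z ^+ l) (q i)].
  elim: l => [|l IH].
    by rewrite muln0; apply/ffunP => i; rewrite ffunE; apply: val_inj; rewrite /= conjg1.
  rewrite mulnS iterD IH iter_shift_d; apply/ffunP => i; rewrite !ffunE.
  by apply: val_inj; rewrite /= -conjgM -expgSr.
by rewrite E; apply/ffunP => i; rewrite ffunE; apply: val_inj; rewrite /= zN conjg1.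
Qed.

Lemma iter_ordS_d j : iter d (@ordS d) j = j.
Proof.
have E l : val (iter l (@ordS d) j) = (j + l) %% d.
  elim: l => [|l IH]; first by rewrite addn0 modn_small.
  by rewrite iterS /= IH -addn1 modnDml addn1 addnS.
by apply: val_inj; rewrite E modnDr modn_small.
Qed.

Local Notation E := (Q * 'I_d)%type.
Definition edge_next (x : E) : E := (shift x.1, ordS x.2).
Definition edge_prev (x : E) : E := (unshift x.1, ord_pred x.2).

Lemma edge_nextK : cancel edge_next edge_prev.
Proof. by case=> q j; rewrite /edge_next /edge_prev /= shiftK ordSK. Qed.
Lemma edge_prevK : cancel edge_prev edge_next.
Proof. by case=> q j; rewrite /edge_next /edge_prev /= unshiftK ord_predK. Qed.

Lemma iter_edge_next l q j :
  iter l edge_next (q, j) = (iter l shift q, iter l (@ordS d) j).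
Proof. by elim: l => [//|l IH]; rewrite iterS IH. Qed.

Local Notation FE := (free_group E).
Definition fnext : {multiplicative FE -> FE} := free_lift (fun x => free_gen (edge_next x)).
Definition fprev : {multiplicative FE -> FE} := free_lift (fun x => free_gen (edge_prev x)).

Lemma fnext_gen x : fnext (free_gen x) = free_gen (edge_next x).
Proof. exact: free_lift_gen. Qed.
Lemma fprev_gen x : fprev (free_gen x) = free_gen (edge_prev x).
Proof. exact: free_lift_gen. Qed.

Lemma fnextK : cancel fnext fprev.
Proof.
apply: (@eq_free_morph _ _ (fprev \o fnext) idfun) => x /=.
by rewrite fnext_gen fprev_gen edge_nextK.
Qed.
Lemma fprevK : cancel fprev fnext.
Proof.
apply: (@eq_free_morph _ _ (fnext \o fprev) idfun) => x /=.
by rewrite fprev_gen fnext_gen edge_prevK.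
Qed.

Lemma iter_fnext_gen l x : iter l fnext (free_gen x) = free_gen (iter l edge_next x).
Proof. by elim: l => [//|l IH]; rewrite !iterS IH fnext_gen. Qed.

Local Notation W := (bij_of (FE * Q)).
Definition actY : W :=
  @BijOf (FE * Q) (fun x => (fnext x.1, shift x.2)) (fun x => (fprev x.1, unshift x.2))
    (fun x => etrans (congr2 pair (fnextK x.1) (shiftK x.2)) (esym (surjective_pairing x)))
    (fun x => etrans (congr2 pair (fprevK x.1) (unshiftK x.2)) (esym (surjective_pairing x))).

Local Notation x_ q j := (free_gen (q, j) : FE).
(** The vertices q and q * delta j a share a coset vertex. The path between them uses their j-th
    edges with opposite signs, so successive paths in one factor telescope. *)
Definition act_fun j a (x : FE * Q) : FE * Q :=
  (x.1 * (x_ x.2 j)^-1 * x_ (x.2 * delta j a) j, x.2 * delta j a).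

Lemma act_funM j a b x : act_fun j (a * b) x = act_fun j b (act_fun j a x).
Proof. by rewrite /act_fun /= deltaM !mulgA mulgK. Qed.

Lemma act_fun1 j x : act_fun j 1 x = x.
Proof. by case: x => u q; rewrite /act_fun /= delta1 mulg1 mulgVK. Qed.

Fact act_funK j a : cancel (act_fun j a) (act_fun j a^-1).
Proof. by move=> x; rewrite -act_funM mulgV act_fun1. Qed.
Fact act_funVK j a : cancel (act_fun j a^-1) (act_fun j a).
Proof. by move=> x; rewrite -act_funM mulVg act_fun1. Qed.
Definition actA j a : W := BijOf (act_funK j a) (act_funVK j a).

Lemma actAM j a b : actA j (a * b) = actA j a * actA j b.
Proof. by apply: eq_bij => x; exact: act_funM. Qed.

Lemma actA_shift j a : actA j a ^ actY =
  actA (ordS j) (if j == ord_max then amal_conj z a else a).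
Proof.
apply: (mulgI actY); rewrite -conjgC; apply: eq_bij => -[u q].
rewrite !bij_funM /= /act_fun /= !homM !homV !fnext_gen /edge_next /=.
by rewrite shiftM shift_delta.
Qed.

Lemma actYX l u q :
  bij_fun (actY ^+ l) (u, q) = (iter l fnext u, iter l shift q).
Proof. by rewrite bij_funX; elim: l => [//|l IH]; rewrite iterS IH. Qed.

Lemma actY_dN : (actY ^+ d) ^+ N = 1.
Proof.
rewrite -expgnA; apply: eq_bij => -[u q]; rewrite actYX iter_shift_dN bij_fun1.
congr pair; pose F : {multiplicative FE -> FE} :=
  HB.pack (iter (d * N) fnext) (isMultiplicative.Build _ _ _ (iter_morph fnext (d * N))).
apply: (@eq_free_morph _ _ F idfun) => -[q' j] /=.
rewrite iter_fnext_gen iter_edge_next iter_shift_dN; congr (free_gen (_, _)).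
by elim: (N) => [|l IH]; [rewrite muln0|rewrite mulnS iterD IH iter_ordS_d].
Qed.

Let ordS_inord l : l.+1 < d -> ordS (inord l) = inord l.+1 :> 'I_d.
Proof. by move=> ld; apply: val_inj; rewrite /= !inordK ?modn_small // ltnW. Qed.

Let inord_eq_max l : l.+1 < d -> (inord l == ord_max :> 'I_d) = false.
Proof. by move=> ld; rewrite -val_eqE /= inordK 1?ltnW //; lia. Qed.

Lemma actA0_conjX a l : l < d -> actA ord0 a ^ (actY ^+ l) = actA (inord l) a.
Proof.
elim: l => [|l IH] ld; first by rewrite conjg1; congr actA; apply: val_inj; rewrite /= inordK.
by rewrite expgSr conjgM IH 1?ltnW // actA_shift ordS_inord // inord_eq_max.
Qed.

Lemma actA0_conj a : actA ord0 a ^ (actY ^+ d) = actA ord0 (amal_conj z a).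
Proof.
rewrite expgSr conjgM actA0_conjX // actA_shift.
have -> : inord d' = ord_max :> 'I_d by apply: val_inj; rewrite /= inordK.
by rewrite eqxx; congr actA; apply/eqP; rewrite ordS_eq0.
Qed.

Lemma amal_action : exists Phi : {multiplicative J -> W},
  (forall a, Phi (iota (val a)) = actA ord0 a) /\ Phi Y = actY.
Proof.
(* Outside H' the default 1 makes [th] trivial; only its values on H' are used. *)
pose th (h : H) : W := actA ord0 (insubd (1 : AT) h).
have insE h (hA : h \in der H 1) : insubd (1 : AT) h = exist _ h hA.
  by apply: val_inj; rewrite val_insubd hA.
have [||f [fth fz]] := @semidirect_lift H z N decH zN zA W th (actY ^+ d) _ actY_dN.
- move=> g h gA hA; rewrite /th -actAM; congr actA; apply: val_inj.
  by rewrite /= !val_insubd gA hA gpredM.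
- move=> g gA; rewrite /th actA0_conj; congr actA; apply: val_inj.
  by rewrite /= !val_insubd gA gpredNJ.
have [F [Fi FY]] := UP fz; exists F; split=> // a.
rewrite [LHS](Fi (val a)) fth ?(valP a) // /th; congr actA; apply: val_inj.
by rewrite val_insubd (valP a).
Qed.

(* a_ j a is the copy of a in the j-th free factor. *)
Definition a_ (l : nat) a : J := iota (val a) ^ (Y ^+ l).

Lemma a_M l a b : a_ l (a * b) = a_ l a * a_ l b.
Proof. by rewrite /a_ -conjMg -homM. Qed.

Lemma a_1 l : a_ l 1 = 1.
Proof. by rewrite /a_ hom1 conj1g. Qed.

Lemma a_der l a : a_ l a \in der J 1.
Proof. exact/gpredNJ/hom_der/(valP a). Qed.

(** Modulo the normal closure of the image of H', J is generated by Y alone and hence abelian; so J'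
    lies in that closure. *)
Lemma derJ_conj_ind (P : J -> Prop) : P 1 ->
  (forall g h, P g -> P h -> P (g / h)) -> (forall a, P (iota (val a))) ->
  (forall g, P g -> P (g ^ Y)) -> (forall g, P g -> P (g ^ Y^-1)) ->
  forall g, g \in der J 1 -> P g.
Proof.
move=> P1 PF Pa PY PYV.
have PV g : P g -> P g^-1 by move=> Pg; rewrite -[_^-1]mul1g; exact: PF.
have PM g h : P g -> P h -> P (g * h) by move=> Pg Ph; rewrite -[h]invgK; exact/PF/PV.
have PJ g : forall x, P x -> P (x ^ g).
  apply: (genJ (P := fun g => forall x, P x -> P (x ^ g))) => [x Px|h h' hA IH x Px|h IH x Px|h IH x Px].
  - by rewrite conjg1.
  - rewrite conjgM conjgE; have Ph := Pa (exist (fun y => y \in der H 1) _ hA).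
    exact: PM (PV _ Ph) (PM _ _ (IH _ Px) Ph).
  - by rewrite conjgM; exact/PY/IH.
  - by rewrite conjgM; exact/PYV/IH.
have PJ' x g : P x -> P (x ^ g) by exact: PJ.
pose S := pred_normal P1 PF PJ'.
suff dS : {subset der J 1 <= S} by move=> g /dS gS; apply/(pred_normalP P1 PF PJ').
apply: der1_sub_cyclic_quotient; apply: (cyclic_quotient (g := Y)) => g.
move: g; apply: (genJ (P := fun g => exists l, g * zexp Y l \in S)) => [|g h hA [l IH]|g [l IH]|g [l IH]].
- by exists 0%R; rewrite mulg1 gpred1.
- exists l; have -> : g * iota h * zexp Y l = g * zexp Y l * iota h ^ zexp Y l by gword.
  apply: gpredM => //; apply: gpredNJ; apply/pred_normalP.
  exact: (Pa (exist (fun y => y \in der H 1) h hA)).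
- by exists (-1 + l)%R; rewrite zexpD zexpN zexp1 -mulgA mulVKg.
- by exists (1 + l)%R; rewrite zexpD zexp1 -mulgA mulKg.
Qed.

Lemma a_conjY j a :
  a_ j a ^ Y = a_ (ordS j) (if j == ord_max then amal_conj z a else a).
Proof.
rewrite /a_ -conjgM -expgSr; case: eqP => [->|/eqP jm].
  have -> : nat_of_ord (ordS (ord_max : 'I_d)) = 0 by rewrite /= modnn.
  by rewrite -iz -homJ conjg1.
by rewrite /= modn_small //; have := ltn_ord j; move: jm; rewrite -val_eqE /=; lia.
Qed.

Lemma a_conjYV j a :
  a_ j a ^ Y^-1 = a_ (ord_pred j) (if j == ord0 then amal_conj z^-1 a else a).
Proof.
apply: (canLR (conjgK Y)); rewrite a_conjY ord_predK -ordS_eq0 ord_predK.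
by case: eqP; rewrite ?amal_conjVK.
Qed.

(** Conjugation by Y or its inverse permutes the d copies of A cyclically, up to conjugation by z at
    the seam, so no further conjugates are needed. *)
Lemma derJ_ind (P : J -> Prop) : P 1 ->
  (forall g h, P g -> P h -> P (g / h)) -> (forall j a, P (a_ j a)) ->
  forall g, g \in der J 1 -> P g.
Proof.
move=> P1 PF Pa g gd.
pose A0 : {pred J} := fun x => `[< exists j a, x = a_ (nat_of_ord (j : 'I_d)) a >].
have A0a (j : 'I_d) a : a_ j a \in generated A0.
  by apply/generated_sub/asboolP; exists j, a.
suff : g \in generated A0.
  by apply: generated_ind => // x /asboolP[j [a ->]].
move: g gd; apply: derJ_conj_ind => [|g h|a|g|g].
- exact: gpred1.
- exact: gpredF.
- by have := A0a ord0 a; rewrite /a_ conjg1.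
- apply: (generated_ind (P := fun g => g ^ Y \in generated A0)) => [|x h xA hA|x].
  + by rewrite conj1g gpred1.
  + by rewrite conjMg conjVg gpredF.
  + by move=> /asboolP[j [a ->]]; rewrite a_conjY.
- apply: (generated_ind (P := fun g => g ^ Y^-1 \in generated A0)) => [|x h xA hA|x].
  + by rewrite conj1g gpred1.
  + by rewrite conjMg conjVg gpredF.
  + by move=> /asboolP[j [a ->]]; rewrite a_conjYV.
Qed.

(* The tree path from 1 to q, truncated after r factors. *)
Definition at_ q (r : nat) : AT := if insub r is Some i then q i else 1.
Fixpoint wordr q r : J := if r is l.+1 then wordr q l * a_ l (at_ q l) else 1.
Definition word q := wordr q d.
(** The loop attached to an edge: along the tree to q with its j-th entry erased, through the j-th
    factor to q, and back along the tree. *)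
Definition gvec (x : E) : J :=
  word (x.1 * delta x.2 (x.1 x.2)^-1) * a_ x.2 (x.1 x.2) * (word x.1)^-1.
Definition Theta : {multiplicative FE -> J} := free_lift gvec.

Lemma at_ord q i : at_ q i = q i. Proof. by rewrite /at_ valK. Qed.

Lemma at_mul_delta q j a r : at_ (q * delta j a) r = if r == j then at_ q r * a else at_ q r.
Proof.
rewrite /at_; case: insubP => [i _ <-|]; first by rewrite !ffunE val_eqE; case: eqP; rewrite ?mulg1.
by case: eqP => // ->; rewrite ltn_ord.
Qed.

Lemma eq_wordr q q' r : (forall l, l < r -> at_ q l = at_ q' l) -> wordr q r = wordr q' r.
Proof.
elim: r => [//|r IH] E; rewrite /= E // IH // => l lr.
exact/E/ltnW.
Qed.

Lemma wordr_stable q r r' : r <= r' -> (forall l, r <= l -> at_ q l = 1) ->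
  wordr q r' = wordr q r.
Proof.
move=> /subnKC <- E; elim: (r' - r) => [|l IH]; first by rewrite addn0.
by rewrite addnS /= E ?leq_addr // a_1 mulg1 IH.
Qed.

Lemma word1 : word 1 = 1.
Proof.
rewrite /word (@wordr_stable _ 0) // => l _; rewrite /at_.
by case: insubP => // i _ _; rewrite ffunE.
Qed.

Lemma Theta_gen x : Theta (free_gen x) = gvec x.
Proof. exact: free_lift_gen. Qed.

Lemma gvecE q j a : q * delta j a * delta j (q j * a)^-1 = q * delta j (q j)^-1.
Proof.
rewrite -mulgA -deltaM; congr (_ * delta _ _).
by rewrite invgM mulVKg.
Qed.

(** The j-th edges at q and at q * delta j a both refer to the vertex with j-th entry erased, whose
    tree path therefore cancels. *)
Lemma word_a q j a : word q * a_ j a =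
  Theta ((x_ q j)^-1 * x_ (q * delta j a) j) * word (q * delta j a).
Proof.
have qja : (q * delta j a) j = q j * a by rewrite !ffunE eqxx.
rewrite homM homV !Theta_gen /gvec /= qja gvecE a_M.
by move: (word _) (word q) (word _) => w0 w w'; gword.
Qed.

(* The edges outside the spanning tree made of the paths [wordr q]. *)
Definition inX (x : E) : bool :=
  (x.1 x.2 != 1) && [exists i : 'I_d, (x.2 < i) && (x.1 i != 1)].
Local Notation X := {x : E | inX x}.
Local Notation FX := (free_group X).

Lemma gvec_notX x : ~~ inX x -> gvec x = 1.
Proof.
case: x => q j; rewrite negb_and negbK /= /gvec /= => /orP[/eqP -> |nX].
  by rewrite a_1 invg1 delta1 !mulg1 mulgV.
have q1 l : j < l -> at_ q l = 1.
  rewrite /at_ => jl; case: insubP => // i _ il; apply/eqP.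
  by apply: contraNT nX => qi; apply/existsP; exists i; rewrite il jl.
have jd := ltn_ord j; rewrite /word.
rewrite (@wordr_stable _ j.+1) // => [|l jl]; last first.
  by rewrite at_mul_delta gtn_eqF // q1.
rewrite (@wordr_stable q j.+1) //= at_mul_delta eqxx at_ord mulgV a_1 mulg1.
rewrite (@eq_wordr _ q j) ?mulgV // => l lj.
by rewrite at_mul_delta ltn_eqF.
Qed.

(** Modulo J'' the copies of A commute, so the factor [a_ j (q j)] can be moved back to its place in
    the word of q; the induction tracks it through truncated words. *)
Lemma gvec_der2 x : gvec x \in der J 2.
Proof.
case: x => q j; have [pr prP] : exists pr : {multiplicative J -> quotient (der J 2)},
    forall g, pr g = 1 <-> g \in der J 2.
  by exists (quot_proj (der J 2)) => g; exact: quot_proj_eq1.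
have ca l a l' b : commute (pr (a_ l a)) (pr (a_ l' b)).
  apply/commgP/eqP; rewrite -homR; apply/prP.
  exact: (mem_derived (N := der J 1) (a_der l a) (a_der l' b)).
set q0 := q * delta j (q j)^-1.
have wE r : pr (wordr q0 r * (if j < r then a_ j (q j) else 1)) = pr (wordr q r).
  elim: r => [|r IH]; first by rewrite ltn0 mulg1.
  rewrite /= at_mul_delta ltnS [r == j]eq_sym.
  case: (ltngtP j r) IH => [jr|rj|/esym jr] IH.
  - by rewrite homM homM -mulgA ca mulgA -homM IH -homM.
  - by rewrite !mulg1 in IH *; rewrite homM IH -homM.
  - by move: IH; rewrite jr mulg1 at_ord mulgV a_1 mulg1 !homM => ->.
apply/prP; rewrite homM homV /= -/q0.
by have := wE d; rewrite ltn_ord -/(word _) => ->; rewrite mulgV.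
Qed.

(** Contraction of the spanning tree. *)
Definition kappa : {multiplicative FE -> FX} :=
  free_lift (fun x => if insub x is Some y then free_gen (y : X) else 1).

Lemma kappa_gen (y : X) : kappa (free_gen (val y)) = free_gen y.
Proof. by rewrite [LHS]free_lift_gen valK. Qed.

Lemma kappa_notX x : ~~ inX x -> kappa (free_gen x) = 1.
Proof. by move=> nX; rewrite [LHS]free_lift_gen insubN. Qed.

Section Action.
Variable Phi : {multiplicative J -> W}.
Hypotheses (PhiA : forall a, Phi (iota (val a)) = actA ord0 a) (PhiY : Phi Y = actY).

Lemma Phi_a j a : Phi (a_ j a) = actA j a.
Proof.
rewrite /a_ homJ homX PhiA PhiY actA0_conjX //.
by congr actA; rewrite inord_val.
Qed.

(** The displacement c does not depend on the vertex, while the path f does. The second identity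
    says that [Theta] recovers g from that path. *)
Lemma Phi_der g : g \in der J 1 -> exists c : Q, forall q, exists f : FE,
  (forall u, bij_fun (Phi g) (u, q) = (u * f, q * c)) /\
  word q * g = Theta f * word (q * c).
Proof.
move: g; apply: derJ_ind => [|g h [c gc] [c' hc]|j a].
- exists 1 => q; exists 1; rewrite !hom1 !mulg1 mul1g; split=> // u.
  by rewrite bij_fun1 mulg1.
- exists (c * c'^-1) => q; have [f [fE fw]] := gc q.
  have qc : q * (c * c'^-1) * c' = q * c.
    by rewrite -mulgA (_ : c * c'^-1 * c' = c) //; exact: mulgVK.
  have [f' [fE' fw']] := hc (q * (c * c'^-1)); rewrite qc in fE' fw'.
  exists (f * f'^-1); split=> [u|].
    rewrite homF bij_funM fE; apply: (can_inj (bij_funK (Phi h))).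
    by rewrite bij_funV bij_invK fE'; congr pair; rewrite -mulgA mulgVK.
  rewrite homF.
  move: (word q) (word (q * c)) (word (q * (c * c'^-1))) fw fw' => w w1 w2 fw fw'.
  by apply: (mulIg h); rewrite -(mulgA _ w2) fw' mulgA !mulgVK mulgA mulgVK fw.
- exists (delta j a) => q; exists ((x_ q j)^-1 * x_ (q * delta j a) j).
  by split=> [u|]; [rewrite Phi_a /= /act_fun /= mulgA|exact: word_a].
Qed.

(** Displacement is multiplicative with values in the commutative group Q, so commutators of J' fix
    all vertices and g is the image of a closed path at 1. *)
Lemma Phi_der2 g : g \in der J 2 -> exists f : FE,
  (forall u, bij_fun (Phi g) (u, 1) = (u * f, 1)) /\ g = Theta f.
Proof.
move=> g2; have g1 : g \in der J 1 by exact: derived_sub_self g2.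
have [c gc] := Phi_der g1.
have [f [fE]] := gc 1; rewrite word1 !mul1g => fw.
suff c1 : c = 1.
  exists f; split=> [u|]; first by rewrite fE c1 mulg1.
  by rewrite fw c1 word1 mulg1.
pose T x (b : Q) := forall p, (bij_fun (Phi x) p).2 = p.2 * b.
have TM x y (a b : Q) : T x a -> T y b -> T (x * y) (a * b).
  by move=> Tx Ty p; rewrite homM bij_funM Ty Tx mulgA.
have TV x (a : Q) : T x a -> T x^-1 a^-1.
  move=> Tx p; rewrite homV bij_funV; apply: (mulIg a); rewrite -Tx bij_invK.
  by rewrite -mulgA (_ : a^-1 * a = 1) ?mulg1 //; exact: mulVg.
have T1 : T 1 1 by move=> p; rewrite hom1 mulg1.
have TF x y : T x 1 -> T y 1 -> T (x / y) 1.
  by move=> Tx /TV Ty p; rewrite (TM _ _ _ _ Tx Ty) invg1 mulg1.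
have Tder x : x \in der J 1 -> exists b : Q, T x b.
  case/Phi_der=> b bE; exists b => -[u q] /=.
  by have [f' [-> _]] := bE q.
have Tg : T g 1.
  apply/(pred_subgroupP (P := fun x => T x 1) T1 TF); move: g2.
  apply: derived_sub => x y /Tder[a Ta] /Tder[b Tb]; apply/pred_subgroupP.
  have -> : 1 = (b * a)^-1 * (a * b) :> Q by rewrite cQ mulVg.
  by rewrite commgEM; apply: (TM); [apply: (TV); exact: TM|exact: TM].
by have := Tg (1, 1); rewrite fE /= !mul1g.
Qed.

Lemma Phi_word q : exists2 f, kappa f = 1 &
  forall u, bij_fun (Phi (word q)) (u, 1) = (u * f, q).
Proof.
(* Partial vertices along the tree path. The r-th step uses an edge with trivial r-th entry and one
   with no later non-trivial entry, both in the tree. *)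
pose tr r : Q := [ffun i : 'I_d => if i < r then q i else 1].
have trS (j : 'I_d) : tr j * delta j (q j) = tr j.+1.
  apply/ffunP => i; rewrite !ffunE ltnS [i <= j]leq_eqVlt.
  have -> : (nat_of_ord i == nat_of_ord j) = (i == j) by [].
  by case: (i =P j) => [->|_]; [rewrite ltnn mul1g|rewrite mulg1].
have trd : q = tr d by apply/ffunP => i; rewrite ffunE ltn_ord.
suff aux r : r <= d -> exists2 f, kappa f = 1 &
    forall u, bij_fun (Phi (wordr q r)) (u, 1) = (u * f, tr r).
  by rewrite {2}trd; exact: aux.
elim: r => [_|r IH rd].
  exists 1 => [|u]; first by rewrite hom1.
  by rewrite hom1 bij_fun1 mulg1; congr pair; apply/ffunP => i; rewrite !ffunE.
have [f f1 fE] := IH (ltnW rd); pose j := Ordinal rd.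
exists (f * (x_ (tr r) j)^-1 * x_ (tr r.+1) j).
  rewrite !homM homV f1 mul1g !kappa_notX ?invg1 ?mulg1 //.
    rewrite negb_and /= orbC; apply/orP; left; rewrite negb_exists; apply/forallP => i.
    rewrite negb_and ffunE /= ltnS; case: (ltnP r i) => // ri.
    by rewrite eqxx.
  by rewrite negb_and ffunE /= ltnn eqxx.
move=> u; rewrite /= homM bij_funM fE.
have -> : at_ q r = q j by rewrite -at_ord.
have -> : a_ r = a_ j by [].
by rewrite Phi_a /= /act_fun /= -[r]/(nat_of_ord j) trS !mulgA.
Qed.

Definition alpha0 g : FX := kappa (bij_fun (Phi g) (1, 1)).1.

Lemma alpha0_gvec (y : X) : alpha0 (gvec (val y)) = free_gen y.
Proof.
case: y => -[q j] Xqj; rewrite /alpha0 /gvec /=.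
set q0 := q * _.
have [f f1 fE] := Phi_word q0; have [f' f1' fE'] := Phi_word q.
rewrite homM bij_funM homM bij_funM fE mul1g Phi_a homV bij_funV /=.
have q0E : q0 * delta j (q j) = q.
  by rewrite /q0 -mulgA -deltaM mulVg delta1 mulg1.
rewrite /act_fun /= q0E.
have -> : bij_inv (Phi (word q)) (f * (x_ q0 j)^-1 * x_ q j, q)
    = (f * (x_ q0 j)^-1 * x_ q j * f'^-1, 1).
  apply: (can_inj (bij_funK (Phi (word q)))).
  by rewrite bij_invK fE' mulgVK.
rewrite /= !homM !homV f1 f1' invg1 mulg1 mul1g kappa_notX.
  by rewrite invg1 mul1g -(kappa_gen (exist _ (q, j) Xqj)).
by rewrite negb_and /= !ffunE eqxx mulgV eqxx.
Qed.

(** [alpha0] sends each basis loop back to its generator, which gives injectivity. Surjectivity: g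
    is [Theta] of its path, and [Theta] factors through [kappa] because tree edges give trivial
    loops. *)
Lemma derJ2_free : exists beta : {multiplicative FX -> subgroup (der J 2)},
  bijective beta /\ forall y, val (beta (free_gen y)) = gvec (val y).
Proof.
pose bgen (y : X) : subgroup (der J 2) :=
  exist (fun g => g \in der J 2) _ (gvec_der2 (val y)).
pose beta : {multiplicative FX -> subgroup (der J 2)} := free_lift bgen.
have betaE y : beta (free_gen y) = bgen y by exact: free_lift_gen.
exists beta; split; last by move=> y; rewrite betaE.
pose al (g : subgroup (der J 2)) : FX := alpha0 (val g).
have alM : {morph al : g h / g * h}.
  move=> g h; rewrite /al /alpha0 /= homM bij_funM.
  have [f [fE _]] := Phi_der2 (valP g); have [f' [fE' _]] := Phi_der2 (valP h).
  by rewrite !fE !fE' /= !mul1g homM.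
pose Al : {multiplicative subgroup (der J 2) -> FX} :=
  HB.pack al (isMultiplicative.Build _ _ al alM).
apply: inj_surj_bij.
  apply: (can_inj (g := al)); apply: (@eq_free_morph _ _ (Al \o beta) idfun) => y /=.
  by rewrite betaE /al alpha0_gvec.
move=> g; have [f [_ gE]] := Phi_der2 (valP g); exists (kappa f).
apply: val_inj; rewrite gE.
pose vl : {multiplicative subgroup (der J 2) -> J} := val.
apply: (@eq_free_morph _ _ (vl \o (beta \o kappa)) Theta) => x /=.
rewrite Theta_gen; have [Xx|nX] := boolP (inX x).
  have -> : x = val (exist _ x Xx : X) by [].
  by rewrite kappa_gen betaE.
by rewrite kappa_notX // hom1 gvec_notX.
Qed.
End Action.


(** * Triviality, finiteness and freeness for amalgams *)

Lemma derJ_trivial : (forall g, g \in der J 1 -> g = 1) <->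
  (forall h, h \in der H 1 -> h = 1).
Proof.
split=> [dJ h hd|dH g gd].
  have [Phi [PhiA _]] := amal_action; pose a : AT := exist (fun x => x \in der H 1) h hd.
  have := PhiA a; rewrite /= (dJ (iota h)) ?hom_der // hom1.
  move/(congr1 (fun w : W => (bij_fun w (1, 1)).2 ord0)).
  by rewrite /= mul1g !ffunE /= => /(congr1 val).
move: g gd; apply: derJ_ind => [//|g h -> ->|j a]; first by rewrite divgg.
by rewrite /a_ (dH _ (valP a)) hom1 conj1g.
Qed.

Lemma J_der_Y g : exists h l, h \in der J 1 /\ g = h * zexp Y l.
Proof.
suff [l hl] : exists l, g * zexp Y l \in der J 1.
  by exists (g * zexp Y l), (- l)%R; rewrite zexpN mulgK.
move: g; apply: (genJ (P := fun g => exists l, g * zexp Y l \in der J 1)).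
- by exists 0%R; rewrite mulg1 gpred1.
- move=> g a aA [l IH]; exists l.
  have -> : g * iota a * zexp Y l = g * zexp Y l * iota a ^ zexp Y l by gword.
  by apply: gpredM => //; apply/gpredNJ/hom_der.
- by move=> g [l IH]; exists (-1 + l)%R; rewrite zexpD zexpN zexp1 -mulgA mulVKg.
- by move=> g [l IH]; exists (1 + l)%R; rewrite zexpD zexp1 -mulgA mulKg.
Qed.

Lemma Theta_der2 f : Theta f \in der J 2.
Proof.
elim/free_group_ind: f => [|f x IH|f x IH]; first by rewrite hom1 gpred1.
  by rewrite homM gpredM // Theta_gen gvec_der2.
by rewrite homM homV gpredM // gpredV Theta_gen gvec_der2.
Qed.

Section FiniteA.
Variables (T : finType) (fT : T -> H).
Hypothesis fTA : forall h, h \in der H 1 -> exists x, h = fT x.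

Let AT_onto : exists s : T -> AT, forall a, exists x, a = s x.
Proof.
exists (fun x => insubd (1 : AT) (fT x)) => a; have [x xE] := fTA (valP a).
by exists x; rewrite -xE valKd.
Qed.

Let Q_onto : exists s : {ffun 'I_d -> T} -> Q, forall q, exists x, q = s x.
Proof.
have [s sE] := AT_onto; exists (fun x => [ffun i => s (x i)]) => q.
have /choice[x xE] : forall i, exists x, q i = s x by move=> i; exact: sE.
by exists (finfun x); apply/ffunP => i; rewrite !ffunE.
Qed.

(** Modulo J'', an element is a word of a vertex times a power of Y; there are finitely many
    vertices and Y^(dN) = 1. *)
Lemma J_derJ2_finite : (0 < N)%N -> finite_group (quotient (der J 2)).
Proof.
move=> N0; have [s sE] := Q_onto; have [Phi [PhiA PhiY]] := amal_action.
pose pr : {multiplicative J -> quotient (der J 2)} := quot_proj (der J 2).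
apply: (@finite_set_onto ({ffun 'I_d -> T} * 'I_(d * N))%type _
  (fun x => pr (word (s x.1) * Y ^+ x.2))) => a _.
rewrite -(quot_reprK a); have [h [l [hd ->]]] := J_der_Y (repr a).
have [c /(_ 1) [f [_]]] := Phi_der PhiA PhiY hd; rewrite word1 !mul1g => ->.
have [x ->] := sE c.
have YdN : zexp Y (d * N)%N = 1 by rewrite zexp_nat expgnA -iz -homX zN hom1.
have dN0 : Posz (d * N)%N != 0%R by rewrite eqz_nat muln_eq0 -lt0n N0.
have lt : (`|(l %% (d * N)%N)%Z| < d * N)%N.
  by have := ltz_mod l dN0; have := modz_ge0 l dN0; lia.
exists (x, Ordinal lt); rewrite /= -zexp_nat gez0_abs ?modz_ge0 // -(zexp_modz l YdN).
rewrite -[LHS]/(pr _) -mulgA homM.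
suff -> : pr (Theta f) = 1 by rewrite mul1g.
exact/quot_proj_eq1/Theta_der2.
Qed.

Lemma derJ2_is_free : is_free (subgroup (der J 2)) /\
  finitely_generated (subgroup (der J 2)).
Proof.
have [Phi [PhiA PhiY]] := amal_action; have [beta [bbij _]] := derJ2_free PhiA PhiY.
split; first by exists X; apply: isomorphic_sym; exists beta.
have [s sE] := Q_onto.
have /finite_seqP[xs xsE] : finite_set [set: X]%classic.
  have [[y0]|nX] := pselect (inhabited X); last first.
    by apply: (@finite_set_onto void _ (fun v => match v with end)) => y _; case: nX.
  apply: (@finite_set_onto ({ffun 'I_d -> T} * 'I_d)%type _ (fun x => insubd y0 (s x.1, x.2))).
  by move=> y _; have [x xE] := sE (val y).1; exists (x, (val y).2); rewrite /= -xE -surjective_pairing valKd.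
exists [seq beta (free_gen x) | x <- xs] => g.
have [b' bK b'K] := bbij; rewrite -(b'K g).
have mem_gen x : beta (free_gen x) \in generated (mem [seq beta (free_gen x) | x <- xs]).
  apply/generated_sub/map_f; have : [set` xs]%classic x by rewrite -xsE.
  by [].
elim/free_group_ind: (b' g) => [|f x IH|f x IH]; first by rewrite hom1 gpred1.
  by rewrite homM gpredM.
by rewrite homM homV gpredM // gpredV.
Qed.
End FiniteA.

(** Rank at least two requires two distinct non-trivial elements of A to place in the second factor:
    a and its conjugate by z. *)
Lemma derJ2_noncommuting (a : AT) : 0 < d' -> val a ^ z <> val a ->
  exists u v, [/\ u \in der J 2, v \in der J 2 &
    forall p r, ~ commute (u ^+ p.+1) (v ^+ r.+1)].
Proof.
move=> d0 az; have [Phi [PhiA PhiY]] := amal_action.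
have [beta [[b' bK b'K] _]] := derJ2_free PhiA PhiY.
pose i1 : 'I_d := inord 1.
have a1 : a != 1 by apply/eqP => a1; apply: az; rewrite a1 /= conj1g.
pose a' := amal_conj z a.
have a'1 : a' != 1.
  apply/eqP => /(congr1 val) /= /eqP; rewrite conjg_eq1 => /eqP v1.
  have v1' : val a = 1 by exact: v1.
  by apply: az; rewrite v1' conj1g.
have aa' : a' != a by apply/eqP => /(congr1 val).
pose qq b : Q := [ffun i => if i == ord0 then a else if i == i1 then b else 1].
have i10 : (i1 == ord0) = false by rewrite -val_eqE /= inordK.
have inXqq b : b != 1 -> inX (qq b, ord0).
  move=> b1; rewrite /inX /= ffunE eqxx a1 /=; apply/existsP; exists i1.
  by rewrite ffunE i10 eqxx b1 inordK.
pose y1 : X := exist inX _ (inXqq a a1); pose y2 : X := exist inX _ (inXqq a' a'1).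
have y12 : y1 != y2.
  apply/eqP => /(congr1 (fun y : X => (val y).1 i1)) /=.
  by rewrite !ffunE i10 eqxx => E; rewrite E eqxx in aa'.
(* Send two free generators to transvections of Z^2 along different axes: no
   positive powers of these commute. *)
have shearK (c : int) : cancel (fun v : int * int => (v.1 + c * v.2, v.2)%R)
    (fun v => (v.1 - c * v.2, v.2)%R) by case=> x y /=; rewrite addrK.
have shearVK (c : int) : cancel (fun v : int * int => (v.1 - c * v.2, v.2)%R)
    (fun v => (v.1 + c * v.2, v.2)%R) by case=> x y /=; rewrite subrK.
have tshearK (c : int) : cancel (fun v : int * int => (v.1, v.2 + c * v.1)%R)
    (fun v => (v.1, v.2 - c * v.1)%R) by case=> x y /=; rewrite addrK.
have tshearVK (c : int) : cancel (fun v : int * int => (v.1, v.2 - c * v.1)%R)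
    (fun v => (v.1, v.2 + c * v.1)%R) by case=> x y /=; rewrite subrK.
pose S1 := BijOf (shearK 1%R) (shearVK 1%R).
pose S2 := BijOf (tshearK 1%R) (tshearVK 1%R).
have S1X p x y : bij_fun (S1 ^+ p) (x, y) = (x + p%:Z * y, y)%R.
  rewrite bij_funX; elim: p => [|p IH]; first by rewrite mul0r addr0.
  by rewrite iterS IH /= -addn1 PoszD; congr pair; ring.
have S2X p x y : bij_fun (S2 ^+ p) (x, y) = (x, y + p%:Z * x)%R.
  rewrite bij_funX; elim: p => [|p IH]; first by rewrite mul0r addr0.
  by rewrite iterS IH /= -addn1 PoszD; congr pair; ring.
pose sh : {multiplicative FX -> bij_of (int * int)} :=
  free_lift (fun y => if y == y1 then S1 else S2).
have sh1 : sh (free_gen y1) = S1 by rewrite [LHS]free_lift_gen eqxx.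
have sh2 : sh (free_gen y2) = S2.
  by rewrite [LHS]free_lift_gen eq_sym (negPf y12).
exists (val (beta (free_gen y1))), (val (beta (free_gen y2))); split; try exact: valP.
move=> p r cuv.
have : commute (beta (free_gen y1) ^+ p.+1) (beta (free_gen y2) ^+ r.+1).
  pose vl : {multiplicative subgroup (der J 2) -> J} := val.
  by apply: val_inj; rewrite -[LHS]/(vl _) -[RHS]/(vl _) !homM !homX.
rewrite -!homX => /(congr1 b'); rewrite -!homM !bK => /(congr1 sh).
(* Starting from (0, 1), the two orders of composition end with second coordinates 1 + (p + 1)(r +
   1) and 1. *)
rewrite !homM !homX sh1 sh2 => /(congr1 (fun w => bij_fun w (0%R, 1%R))).
by rewrite !bij_funM !S1X !S2X !S1X => -[]; lia.
Qed.
End Amalgam.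


(** * Virtual properties *)

Lemma left_coset_eq (G : groupType) (H : groupClosed G) (g h : G) :
  left_coset H g = left_coset H h <-> g^-1 * h \in H.
Proof.
split=> [E|ghH].
  have : left_coset H h h by exists 1; rewrite ?mulg1 //; exact: gpred1.
  by rewrite -E => -[x xH <-]; rewrite mulKg.
apply/seteqP; split=> _ [x xH <-].
  exists (h^-1 * g * x); last by rewrite !mulgA mulgV mul1g.
  by apply: gpredM => //; rewrite -gpredV invgM invgK.
exists (g^-1 * h * x); last by rewrite !mulgA mulgV mul1g.
exact: gpredM.
Qed.

Lemma finite_quotient_index (G : groupType) (N : normalClosed G) :
  finite_group (quotient N) -> finite_index N.
Proof.
move=> fin; apply: (sub_finite_set _ (finite_image (fun a => left_coset N (repr a)) fin)).
move=> _ [g _ <-]; exists (quot_proj N g) => //.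
by apply/left_coset_eq; apply/quot_projP; rewrite quot_reprK.
Qed.

Lemma finite_index_power (G : groupType) (H : groupClosed G) (u : G) :
  finite_index H -> exists p, u ^+ p.+1 \in H.
Proof.
case/finite_seqP=> s sE; pose f i := left_coset H (u ^+ i).
have fs i : f i \in s.
  by have : [set` s]%classic (f i) by rewrite -sE; exists (u ^+ i).
have : ~~ uniq [seq f i | i <- iota 0 (size s).+1].
  apply/negP => un; have /(uniq_leq_size un) : {subset [seq f i | i <- iota 0 (size s).+1] <= s}.
    by move=> _ /mapP[i _ ->].
  by rewrite size_map size_iota ltnn.
case/(uniqPn (f 0)) => i [j [ij]]; rewrite size_map size_iota => js.
have isz := ltn_trans ij js.
rewrite !(nth_map 0) ?size_iota // !nth_iota // !add0n => /left_coset_eq.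
rewrite -(subnKC (ltnW ij)) expgnDr mulKg => uH.
by exists (j - i).-1; rewrite prednK // subn_gt0.
Qed.

(** Positive powers of u and v lie in any subgroup of finite index, and would commute in a cyclic
    one. *)
Lemma not_virtually_cyclic (G : groupType) (u v : G) :
  (forall p r, ~ commute (u ^+ p.+1) (v ^+ r.+1)) -> ~ virtually cyclic_group G.
Proof.
move=> nc [H [fin /cyclic_subgroupP[g gH gE]]].
have [p /gE[i pE]] := finite_index_power u fin.
have [r /gE[j rE]] := finite_index_power v fin.
by apply: (nc p r); rewrite pE rE; exact: zexp_commute.
Qed.

(** * J_n(dm,dk) as an amalgam of J_n(m,k) *)

Lemma Zp_int_eq0 (N : nat) (i : int) : (1 < N)%N ->
  (1 *~ i = 0 :> 'Z_N)%R -> (N %| `|i|)%N.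
Proof.
move=> N1 i0; have : (`|i|%N%:R = 0 :> 'Z_N)%R.
  rewrite -[LHS]/(`|i|%N%:Z%:~R)%R abszEsg intrM.
  by rewrite -[X in (_ * X)%R]/(1 *~ i)%R i0 mulr0.
by move/(congr1 val); rewrite /= val_Zp_nat // => /eqP.
Qed.

Section MultipleJ.
Variables (n : nat) (m k : int) (d' : nat).
Hypotheses (hn : n = 4 \/ n = 6) (hm : m <> 0%R) (hmk : coprimez m k).
Local Notation d := d'.+1.
Local Notation H := (Jgroup n m k).
Local Notation z := (Jy n m k).
Local Notation dm := (d%:Z * m)%R.
Local Notation dk := (d%:Z * k)%R.
Local Notation J := (Jgroup n dm dk).
Local Notation Y := (Jy n dm dk).
Local Notation N := `|(n%:Z * m)%R|%N.

Let hdm : dm <> 0%R. Proof. by move: hm; nia. Qed.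

Lemma amalgam_rel (G : groupType) (t w : G) :
  zexp w (dm - dk) * t ^+ 3 * zexp w dk * t ^+ 2
  = zexp (w ^+ d) (m - k) * t ^+ 3 * zexp (w ^+ d) k * t ^+ 2.
Proof. by rewrite -mulrBr !zexpM zexp_nat. Qed.

Lemma amalgam_iota : exists i : {multiplicative H -> J},
  i (Jt n m k) = Jt n dm dk /\ i z = Y ^+ d.
Proof.
apply: J_lift; first exact: Jt_n.
by rewrite -amalgam_rel J_rel.
Qed.

Section Iota.
Variable i : {multiplicative H -> J}.
Hypotheses (it : i (Jt n m k) = Jt n dm dk) (iz : i z = Y ^+ d).

Lemma amalgam_UP (W : groupType) (f : {multiplicative H -> W}) (w : W) :
  f z = w ^+ d -> exists F : {multiplicative J -> W}, F \o i =1 f /\ F Y = w.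
Proof.
move=> fz; have [||F [Ft Fy]] := @J_lift n dm dk W (f (Jt n m k)) w.
- by rewrite -homX Jt_n hom1.
- have := congr1 f (J_rel n m k).
  by rewrite amalgam_rel -fz hom1 3!homM !homX !hom_zexp.
exists F; split=> // g /=; elim/J_ind: g => [|g IH|g IH|g IH|g IH].
- by rewrite !hom1.
- by rewrite (homM i) (homM F) (homM f) IH it Ft.
- by rewrite (homM i) (homM F) (homM f) IH (homV i) (homV F) (homV f) it Ft.
- by rewrite (homM i) (homM F) (homM f) IH iz homX Fy fz.
- by rewrite (homM i) (homM F) (homM f) IH (homV i) (homV F) (homV f) iz homX Fy fz.
Qed.

(** t is tau times a power of y, and tau lies in H', so the image of H' and Y suffice to generate
    J. *)
Lemma amalgam_gen (P : J -> Prop) : P 1 ->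
  (forall g a, a \in der H 1 -> P g -> P (g * i a)) ->
  (forall g, P g -> P (g * Y)) -> (forall g, P g -> P (g * Y^-1)) -> forall g, P g.
Proof.
move=> P1 Pa PY PYV.
have PX l g : P g -> P (g * zexp Y l).
  have natP (j : nat) h : P h -> P (h * Y ^+ j).
    by move=> Ph; elim: j => [|j IH]; [rewrite mulg1|rewrite expgSr mulgA; exact: PY].
  have natPV (j : nat) h : P h -> P (h * Y ^- j).
    move=> Ph; elim: j => [|j IH]; first by rewrite invg1 mulg1.
    by rewrite expgS invgM mulgA; exact: PYV.
  by case: l => j; [exact: natP|exact: natPV].
have tauH := Jtau_der m k hn.
have tE : Jt n dm dk = i (tau n m (Jt n m k) z) * zexp Y (d%:Z * (sg n * m)).
  by rewrite zexpM zexp_nat -iz -hom_zexp -homM -it mulgVK.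
apply: J_ind => // g Pg.
- by rewrite tE mulgA; exact/PX/Pa.
- rewrite tE invgM -zexpN -homV mulgA; apply: Pa; first by rewrite gpredV.
  exact: PX.
Qed.
End Iota.

Lemma Jy_orderN : z ^+ N = 1.
Proof.
by rewrite -zexp_nat abszEsg mulrC zexpM (Jy_N m k hn) zexp1g.
Qed.

Let cA := Jder1_commute hn hm hmk.
Let decH := J_der_y hn hm hmk.
Let zA := @Jy_der n m k hn hm.

Lemma J_quotient_finite : finite_group (quotient (der J 2)).
Proof.
have [i [it iz]] := amalgam_iota; have [T [fT fTE]] := Jder1_finite hn hm hmk.
apply: (J_derJ2_finite decH Jy_orderN zA iz (amalgam_UP it iz) (amalgam_gen it iz) fTE).
by have := JN_gt1 hn hm; lia.
Qed.

Lemma J_derived_trivial : trivial_group (subgroup (der J 1)) <->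
  trivial_group (subgroup (der H 1)).
Proof.
have [i [it iz]] := amalgam_iota; apply: (iff_trans (trivial_subgroupP _)).
apply: (iff_trans _ (iff_sym (trivial_subgroupP _))).
exact: (derJ_trivial decH Jy_orderN zA iz (amalgam_UP it iz) (amalgam_gen it iz)).
Qed.

Lemma J_der2_free : is_free (subgroup (der J 2)) /\
  finitely_generated (subgroup (der J 2)).
Proof.
have [i [it iz]] := amalgam_iota; have [T [fT fTE]] := Jder1_finite hn hm hmk.
exact: (derJ2_is_free cA decH Jy_orderN zA iz (amalgam_UP it iz) (amalgam_gen it iz) fTE).
Qed.

Lemma J_der2_noncommuting : 0 < d' -> ~ trivial_group (subgroup (der J 1)) ->
  exists u v, [/\ u \in der J 2, v \in der J 2 &
    forall p r, ~ commute (u ^+ p.+1) (v ^+ r.+1)].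
Proof.
move=> d0 nt; have [i [it iz]] := amalgam_iota.
(* If z centralized H', then H, generated by z and the abelian group H', would be abelian and H'
   trivial. *)
have [a az] : exists a : subgroup (der H 1), val a ^ z <> val a.
  apply: contrapT => nz; apply: nt; apply/J_derived_trivial/trivial_subgroupP.
  move=> g; apply: der1_abelian => {}g h.
  have cz a : a \in der H 1 -> commute a z.
    move=> aA; apply/commgP/conjg_fixP; apply: contrapT => naz; apply: nz.
    by exists (exist (fun x => x \in der H 1) a aA).
  have czX a j : a \in der H 1 -> commute a (zexp z j).
    by move=> aA; rewrite -[a]zexp1; apply: zexp_commute; exact: cz.
  have [a [j [aA ->]]] := decH g; have [b [l [bA ->]]] := decH h.
  have cj : commute (a * zexp z j) b.
    apply/commute_sym/commuteM; first exact: cA.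
    exact: czX.
  apply: commuteM => //; apply/commute_sym/commuteM; first exact/commute_sym/czX.
  exact: zexp_commute.
exact: (derJ2_noncommuting cA decH Jy_orderN zA iz (amalgam_UP it iz) (amalgam_gen it iz) d0 az).
Qed.

Lemma J_isomorphic_Zp : trivial_group (subgroup (der J 1)) ->
  isomorphic J 'Z_(`|(n%:Z * dm)%R|%N).
Proof.
move=> /trivial_subgroupP J1; have [D DY] := Jdeg dk hn hdm.
have [i [it iz]] := amalgam_iota; exists D.
have N1 := JN_gt1 hn hdm.
have YN : zexp Y (n%:Z * dm)%R = 1.
  by rewrite mulrCA zexpM zexp_nat -iz -hom_zexp (Jy_N m k hn) hom1.
apply: inj_surj_bij.
  apply: hom_inj => g; have [j /J1 jE] := @Jy_mod_der n dm dk hn g.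
  have -> : g = zexp Y (- j)%R by apply: (mulIg (zexp Y j)); rewrite jE zexpN mulVg.
  rewrite hom_zexp DY Zp_zexp => /(Zp_int_eq0 N1).
  by rewrite -dvdzE => /dvdzP[q ->]; rewrite (mulrC q) zexpM YN zexp1g.
move=> u; exists (Y ^+ u).
rewrite homX DY -zexp_nat Zp_zexp -[LHS]/(_%:R)%R.
exact: natr_Zp.
Qed.

Lemma J_derived_trivialE : trivial_group (subgroup (der J 1)) <->
  [\/ (dk = 0 %[mod n%:Z * dm])%Z, (dm - dk = 0 %[mod n%:Z * dm])%Z
    | (dm - 2 * dk = 0 %[mod n%:Z * dm])%Z].
Proof.
have E1 : (dm - dk = d%:Z * (m - k))%R by ring.
have E2 : (dm - 2 * dk = d%:Z * (m - 2 * k))%R by ring.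
rewrite !eqmod0E E1 E2 (mulrCA (Posz n)) !dvdz_mul2l //= -!eqmod0E.
apply: (iff_trans J_derived_trivial); apply: (iff_trans (trivial_subgroupP _)).
by apply: (iff_trans (muJ_trivial hn hm hmk)); apply: iff_sym; exact: zero_condE.
Qed.
End MultipleJ.

(** [d'] is the gcd minus one, so that the index type of the d factors is visibly non-empty. *)
Lemma gcd_factor (m k : int) : m <> 0%R -> exists d' m' k',
  [/\ m = (d'.+1%:Z * m')%R, k = (d'.+1%:Z * k')%R, m' <> 0%R, coprimez m' k'
    & d' = 0 <-> coprimez m k].
Proof.
move=> m0; have [u [v E]] := Bezoutz m k.
have /dvdzP[m' mE] := dvdz_gcdl m k; have /dvdzP[k' kE] := dvdz_gcdr m k.
have g0 : gcdz m k != 0%R by rewrite gcdz_eq0 negb_and; apply/orP; left; exact/eqP.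
have [d' dE] : exists d' : nat, gcdz m k = Posz d'.+1.
  have : (0 <= gcdz m k)%R by [].
  case: (gcdz m k) g0 => [[|l]|l] // _ _; by exists l.
have co : (d' = 0) <-> coprimez m k.
  by rewrite /coprimez dE; split=> [->|/eqP[]].
move: mE kE E g0; rewrite dE => mE kE E g0.
exists d', m', k'; split=> //; rewrite 1?mulrC //.
  by move=> m'0; apply: m0; rewrite mE m'0 mul0r.
apply/coprimezP; exists (u, v) => /=; apply: (mulIf g0).
by rewrite mul1r -[RHS]E [in RHS]mE [in RHS]kE; ring.
Qed.

Local Close Scope quotient_scope.
Local Close Scope group_scope.

Theorem theorem2 (n : nat) (m k : int)
    (hn : n = 4 \/ n = 6) (hm : m <> 0%R) :
  let J := Jgroup n m k in
  let J' := der J 1 in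
  let J'' := der J 2 in
  let nm := (n%:Z * m)%R in
  let zero_cond :=
    [\/ (k = 0 %[mod nm])%Z, (m - k = 0 %[mod nm])%Z
      | (m - 2 * k = 0 %[mod nm])%Z] in
  [/\ (* (a) *)
      finite_group (quotient J''),
      (* (b) *)
      (trivial_group (subgroup J') <-> zero_cond) /\
      (zero_cond -> isomorphic J 'Z_(`|nm|%N)),
      (* (c) *)
      coprimez m k ->
        [/\ metabelian J,
            finite_group J,
            (m - 2 * k <> 0 %[mod n%:Z])%Z ->
              cyclic_group (subgroup J') /\ metacyclic J
          & (m - 2 * k = 0 %[mod n%:Z])%Z ->
              square_of_cyclic (subgroup J') /\
              (~ trivial_group (subgroup J') -> ~ metacyclic J)]
    & (* (d) *)
      ~ coprimez m k -> ~ trivial_group (subgroup J') ->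
        [/\ [/\ is_free (subgroup J''), finitely_generated (subgroup J'')
              & ~ abelian_group (subgroup J'')],
            virtually is_free J
          & ~ virtually cyclic_group J]].
Proof.
move=> J J' J'' nm zero_cond.
(* Parts (a), (b) and (d) go through the amalgam, which for d = 1 adds nothing to the coprime group;
   (c) uses the coprime results directly. *)
have [d' [m' [k' [mE kE m'0 co' coE]]]] := gcd_factor k hm.
have finQ : finite_group (quotient J'').
  by rewrite /J'' /J mE kE; exact: J_quotient_finite.
have trivE : trivial_group (subgroup J') <-> zero_cond.
  by rewrite /zero_cond /nm /J' /J mE kE; exact: J_derived_trivialE.
split=> //.
- split=> // /trivE; rewrite /J' /J /nm mE kE; exact: J_isomorphic_Zp.
- move=> co; split.
  + apply/trivial_subgroupP/der2_trivial; exact: Jder1_commute.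
  + exact: J_finite.
  + move=> mk; have cyc : cyclic_group (subgroup J').
      exact/cyclic_subgroupP/Jder1_cyclic.
    split=> //; exists J'; split=> //.
    by apply: cyclic_quotient => g; exact: Jy_mod_der.
  + move=> mk; split; first exact: Jder1_square.
    move=> nt; apply: J_not_metacyclic => //; apply: contrapT => nex.
    apply: nt; apply/trivial_subgroupP => g gd; apply: contrapT => g1.
    by apply: nex; exists g.
- move=> nco nt.
  have d'0 : 0 < d' by rewrite lt0n; apply/eqP => /coE.
  have [u [v [uJ vJ uv]]] : exists u v, [/\ u \in J'', v \in J'' &
      forall p r, ~ commute (u ^+ p.+1)%g (v ^+ r.+1)%g].
    move: nt; rewrite /J'' /J' /J mE kE; exact: J_der2_noncommuting.
  have [free fg] : is_free (subgroup J'') /\ finitely_generated (subgroup J'').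
    by rewrite /J'' /J mE kE; exact: J_der2_free.
  split.
  + split=> // /abelian_subgroupP ab.
    by apply: (uv 0 0); exact: ab.
  + by exists J''; split=> //; exact: finite_quotient_index.
  + exact: not_virtually_cyclic uv.
Qed.
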